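(* Let $(M,\varphi,\xi,\eta,g)$ be a Sasaki-like almost contact complex Riemannian manifold of dimension $2n+1$. Then $H=\ker\eta$ is integrable, and for an integral submanifold $N^{2n}$ of $H$ (so $TN^{2n}=H$) with $J=\varphi|_H$ and $h=g|_H$, the manifold $(N^{2n},J,h)$ is a holomorphic complex Riemannian manifold. The curvature of $M$ is completely determined by the curvature $R^h$ of $(N^{2n},J,h)$: for all $X,Y,Z,U\in H$, $$R(X,Y,Z,U)=R^h(X,Y,Z,U)+g(\varphi X,Z)\,g(\varphi Y,U)-g(\varphi Y,Z)\,g(\varphi X,U),$$ and for all vector fields $x,y,z$ on $M$, $$R(x,y,\xi,z)=R(\xi,z,x,y)=\eta(y)g(x,z)-\eta(x)g(y,z).$$
   Context: An almost contact complex Riemannian manifold $(M,\varphi,\xi,\eta,g)$ is a smooth $(2n+1)$-dimensional manifold $M$ with an endomorphism field $\varphi$ of $TM$, a vector field $\xi$, a 1-form $\eta$ and a pseudo-Riemannian metric $g$ of signature $(n+1,n)$ such that $\varphi\xi=0$, $\varphi^2=-\mathrm{Id}+\eta\otimes\xi$, $\eta\circ\varphi=0$, $\eta(\xi)=1$ and $g(\varphi x,\varphi y)=-g(x,y)+\eta(x)\eta(y)$. Let $\nabla$ be the Levi-Civita connection of $g$ and $F(x,y,z)=g((\nabla_x\varphi)y,z)$. The manifold is Sasaki-like if for all $X,Y,Z$ in $H=\ker\eta$ one has $F(X,Y,Z)=F(\xi,Y,Z)=F(\xi,\xi,Z)=0$ and $F(X,Y,\xi)=-g(X,Y)$. Curvature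 convention: $R(x,y)=[\nabla_x,\nabla_y]-\nabla_{[x,y]}$ and $R(x,y,z,u)=g(R(x,y)z,u)$; $R^h$ is defined in the same way from the Levi-Civita connection $\nabla^h$ of $h$. A holomorphic complex Riemannian manifold $(N^{2n},J,h)$ is a $2n$-dimensional manifold with an almost complex structure $J$ and a pseudo-Riemannian metric $h$ of signature $(n,n)$ such that $h(JX,JY)=-h(X,Y)$ and $\nabla^hJ=0$. *)

(* Defs.v *)
From HB Require Import structures.
From mathcomp Require Import all_boot all_order all_algebra.
From mathcomp Require Import all_classical all_reals all_analysis.
Set Implicit Arguments.
Unset Strict Implicit.
Unset Printing Implicit Defensive.
Import Order.TTheory GRing.Theory Num.Theory.
Import numFieldNormedType.Exports.
Local Open Scope classical_set_scope.
Local Open Scope ring_scope.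

(* C^k on the open set U: Frechet differentiable on U, with every directional
   derivative of class C^(k-1). *)
Fixpoint Ck (R : realType) (V W : normedModType R) (k : nat) (U : set V)
    (f : V -> W) : Prop :=
  match k with
  | 0 => forall x, U x -> {for x, continuous f}
  | k'.+1 => (forall x, U x -> differentiable f x) /\
             (forall v : V, Ck k' U (fun x => 'D_v f x))
  end.

Definition smooth_on (R : realType) (V W : normedModType R) (U : set V)
    (f : V -> W) : Prop := forall k, Ck k U f.

Definition smooth_near (R : realType) (V W : normedModType R) (f : V -> W)
    (x : V) : Prop := exists U : set V, [/\ open U, U x & smooth_on U f].

(* A smooth manifold of dimension m without boundary.  The atlas is indexed by
   the points: [chart p], with domain [dom p] and inverse [chartI p], is a chart
   around p.  (Any atlas yields such an indexed one by choosing a chart around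
   each point; the resulting subatlas generates the same smooth structure.) *)
Record smoothManifold (R : realType) (m : nat) := SmoothManifold {
  carrier :> topologicalType;
  dom : carrier -> set carrier;
  chart : carrier -> carrier -> 'rV[R]_m;
  chartI : carrier -> 'rV[R]_m -> carrier;
  manifold_hausdorff : hausdorff_space carrier;
  manifold_second_countable : @second_countable carrier;
  dom_open : forall p, open (dom p);
  dom_center : forall p, dom p p;
  chart_image_open : forall p, open (chart p @` dom p);
  chartK : forall p q, dom p q -> chartI p (chart p q) = q;
  chart_continuous : forall p q, dom p q -> {for q, continuous (chart p)};
  chartI_continuous : forall p x, (chart p @` dom p) x ->
    {for x, continuous (chartI p)};
  chart_transition : forall p q,
    smooth_on (chart p @` (dom p `&` dom q)) (chart q \o chartI p)
}.

(* Encoding of tangent vectors and tensors.  The tangent space at q is 'rV[R]_m,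
   a tangent vector being the row of its components in the preferred chart
   [chart q]; a vector field is X : M -> 'rV[R]_m with X q tangent at q.
   Likewise an endomorphism field A : M -> 'M[R]_m acts at q by u |-> u *m A q,
   a 1-form w : M -> 'cV[R]_m by u |-> u *m w q, and a bilinear form
   G : M -> 'M[R]_m is the field of Gram matrices (u, v) |-> u *m G q *m v^T.
   These are all pointwise (arbitrary) sections; smoothness is a separate
   predicate, which transports the components to one fixed chart. *)

Definition bilin (R : realType) (m : nat) (G : 'M[R]_m) (u v : 'rV[R]_m) : R :=
  (u *m G *m v^T) 0 0.

Definition covec (R : realType) (m : nat) (w : 'cV[R]_m) (u : 'rV[R]_m) : R :=
  (u *m w) 0 0.

Section Manifold.
Variables (R : realType) (m : nat) (M : smoothManifold R m).

Definition vfield := M -> 'rV[R]_m.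
Definition endofield := M -> 'M[R]_m.
Definition formfield := M -> 'cV[R]_m.
Definition bilinfield := M -> 'M[R]_m.

(* Components of X in the chart around p, as a function of the coordinates. *)
Definition vrep (p : M) (X : vfield) (x : 'rV[R]_m) : 'rV[R]_m :=
  let q := chartI p x in
  X q *m jacobian (chart p \o chartI q) (chart q q).

(* Smoothness in a neighbourhood of p. *)
Definition fun_smooth_at (p : M) (f : M -> R) : Prop :=
  smooth_near (f \o chartI p : 'rV[R]_m -> R) (chart p p).

Definition vfield_smooth_at (p : M) (X : vfield) : Prop :=
  smooth_near (vrep p X) (chart p p).

Definition endo_app (A : endofield) (X : vfield) : vfield := fun q => X q *m A q.

(* A tensor field is smooth when it maps smooth (local) vector fields to smooth
   (local) vector fields, resp. functions. *)
Definition endofield_smooth (A : endofield) : Prop :=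
  forall p X, vfield_smooth_at p X -> vfield_smooth_at p (endo_app A X).

Definition formfield_smooth (w : formfield) : Prop :=
  forall p X, vfield_smooth_at p X ->
    fun_smooth_at p (fun q => covec (w q) (X q)).

Definition bilinfield_smooth (G : bilinfield) : Prop :=
  forall p X Y, vfield_smooth_at p X -> vfield_smooth_at p Y ->
    fun_smooth_at p (fun q => bilin (G q) (X q) (Y q)).

(* Derivative of a function at p in the direction u. *)
Definition dfun (p : M) (f : M -> R) (u : 'rV[R]_m) : R :=
  'D_u (f \o chartI p : 'rV[R]_m -> R) (chart p p).

(* [X, Y]^j = X^i d_i Y^j - Y^i d_i X^j, computed at p in the chart around p. *)
Definition lie_bracket (X Y : vfield) : vfield := fun p =>
  'D_(X p) (vrep p Y) (chart p p) - 'D_(Y p) (vrep p X) (chart p p).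

(* G has signature (a, b): a pluses and b minuses. *)
Definition has_signature (a b : nat) (G : 'M[R]_m) : Prop :=
  (a + b)%N = m /\
  exists2 P : 'M[R]_m, P \in unitmx &
    P *m G *m P^T = diag_mx (\row_(i < m) (if (i < a)%N then 1 else -1)).

Definition pseudo_riemannian_metric (a b : nat) (g : bilinfield) : Prop :=
  [/\ bilinfield_smooth g,
      (forall p u v, bilin (g p) u v = bilin (g p) v u)
    & (forall p, has_signature a b (g p))].

(* [D p u Y] is the covariant derivative at p of the vector field Y in the
   direction u; it is meaningful for every Y that is smooth near p, so that a
   connection acts on locally defined vector fields. *)
Definition connection := M -> 'rV[R]_m -> vfield -> 'rV[R]_m.

Definition cov (D : connection) (X Y : vfield) : vfield := fun p => D p (X p) Y.

Record is_connection (D : connection) : Prop := IsConnection {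
  conn_linear : forall p a u v Y, vfield_smooth_at p Y ->
    D p (a *: u + v) Y = a *: D p u Y + D p v Y;
  conn_add : forall p u Y Z, vfield_smooth_at p Y -> vfield_smooth_at p Z ->
    D p u (fun q => Y q + Z q) = D p u Y + D p u Z;
  conn_leibniz : forall p u f Y, fun_smooth_at p f -> vfield_smooth_at p Y ->
    D p u (fun q => f q *: Y q) = dfun p f u *: Y p + f p *: D p u Y;
  conn_smooth : forall p X Y, vfield_smooth_at p X -> vfield_smooth_at p Y ->
    vfield_smooth_at p (cov D X Y)
}.

Record levi_civita (g : bilinfield) (D : connection) : Prop := LeviCivita {
  lc_connection : is_connection D;
  lc_torsion_free : forall p X Y,
    vfield_smooth_at p X -> vfield_smooth_at p Y ->
    cov D X Y p - cov D Y X p = lie_bracket X Y p;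
  lc_metric : forall p u Y Z,
    vfield_smooth_at p Y -> vfield_smooth_at p Z ->
    dfun p (fun q => bilin (g q) (Y q) (Z q)) u
    = bilin (g p) (D p u Y) (Z p) + bilin (g p) (Y p) (D p u Z)
}.

(* (D_u A) Y at p *)
Definition cov_endo (D : connection) (A : endofield) (p : M) (u : 'rV[R]_m)
    (Y : vfield) : 'rV[R]_m :=
  D p u (endo_app A Y) - D p u Y *m A p.

(* R(x, y) = [D_x, D_y] - D_[x, y] *)
Definition curv (D : connection) (X Y Z : vfield) : vfield := fun p =>
  cov D X (cov D Y Z) p - cov D Y (cov D X Z) p - cov D (lie_bracket X Y) Z p.

(* R(x, y, z, u) = g(R(x, y) z, u) *)
Definition curv4 (g : bilinfield) (D : connection) (X Y Z U : vfield) (p : M) :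
    R := bilin (g p) (curv D X Y Z p) (U p).

End Manifold.

Record almost_contact_complex_riemannian (R : realType) (n : nat)
    (M : smoothManifold R n.*2.+1) (phi : endofield M) (xi : vfield M)
    (eta : formfield M) (g : bilinfield M) : Prop := AlmostContactCR {
  acr_phi_smooth : endofield_smooth phi;
  acr_xi_smooth : forall p, vfield_smooth_at p xi;
  acr_eta_smooth : formfield_smooth eta;
  acr_metric : pseudo_riemannian_metric n.+1 n g;
  acr_phi_xi : forall p, xi p *m phi p = 0;
  acr_phi2 : forall p (u : 'rV[R]_(n.*2.+1)),
    u *m phi p *m phi p = - u + covec (eta p) u *: xi p;
  acr_eta_phi : forall p u, covec (eta p) (u *m phi p) = 0;
  acr_eta_xi : forall p, covec (eta p) (xi p) = 1;
  acr_g_phi : forall p u v,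
    bilin (g p) (u *m phi p) (v *m phi p)
    = - bilin (g p) u v + covec (eta p) u * covec (eta p) v
}.

Section SasakiLike.
Variables (R : realType) (m : nat) (M : smoothManifold R m).

(* F(x, y, z) = g((D_x phi) y, z) *)
Definition Ftensor (phi : endofield M) (g : bilinfield M) (D : connection M)
    (X Y Z : vfield M) (p : M) : R :=
  bilin (g p) (cov_endo D phi p (X p) Y) (Z p).

Definition ker_form (eta : formfield M) (p : M) : set 'rV[R]_m :=
  [set u | covec (eta p) u = 0].

(* X is a smooth section near p of the distribution H. *)
Definition section_at (H : M -> set 'rV[R]_m) (p : M) (X : vfield M) : Prop :=
  vfield_smooth_at p X /\ \forall q \near p, H q (X q).

Definition sasaki_like (phi : endofield M) (xi : vfield M) (eta : formfield M)
    (g : bilinfield M) (D : connection M) : Prop :=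
  forall p X Y Z, section_at (ker_form eta) p X ->
    section_at (ker_form eta) p Y -> section_at (ker_form eta) p Z ->
    [/\ Ftensor phi g D X Y Z p = 0,
        Ftensor phi g D xi Y Z p = 0,
        Ftensor phi g D xi xi Z p = 0
      & Ftensor phi g D X Y xi p = - bilin (g p) (X p) (Y p)].

End SasakiLike.

Section Submanifold.
Variables (R : realType) (k m : nat).

Definition smooth_map (N : smoothManifold R k) (M : smoothManifold R m)
    (f : N -> M) : Prop :=
  forall q, {for q, continuous f} /\
    smooth_near (chart (f q) \o f \o chartI q) (chart q q).

(* Matrix of the differential of f at q; it acts by v |-> v *m tangent_map f q. *)
Definition tangent_map (N : smoothManifold R k) (M : smoothManifold R m)
    (f : N -> M) (q : N) : 'M[R]_(k, m) :=
  jacobian (chart (f q) \o f \o chartI q) (chart q q).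

(* An (injectively immersed) submanifold iota : N -> M with TN = H. *)
Definition integral_submanifold (N : smoothManifold R k)
    (M : smoothManifold R m) (H : M -> set 'rV[R]_m) (iota : N -> M) : Prop :=
  [/\ smooth_map iota, injective iota,
      (forall q, row_free (tangent_map iota q))
    & (forall q, range (fun v : 'rV[R]_k => v *m tangent_map iota q)
                 = H (iota q))].

Definition pullback_form (N : smoothManifold R k) (M : smoothManifold R m)
    (iota : N -> M) (g : bilinfield M) : bilinfield N := fun q =>
  tangent_map iota q *m g (iota q) *m (tangent_map iota q)^T.

(* J is the restriction of A to the submanifold: d iota o J = A o d iota. *)
Definition restricts_endo (N : smoothManifold R k) (M : smoothManifold R m)
    (iota : N -> M) (A : endofield M) (J : endofield N) : Prop :=
  forall q (v : 'rV[R]_k),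
    v *m J q *m tangent_map iota q = v *m tangent_map iota q *m A (iota q).

End Submanifold.

(* A distribution with k-dimensional fibres is integrable when an integral
   submanifold passes through every point. *)
Definition integrable_distribution (R : realType) (k m : nat)
    (M : smoothManifold R m) (H : M -> set 'rV[R]_m) : Prop :=
  forall p : M, exists (N : smoothManifold R k) (iota : N -> M),
    integral_submanifold H iota /\ exists q, iota q = p.

Record holomorphic_complex_riemannian (R : realType) (n : nat)
    (N : smoothManifold R n.*2) (J : endofield N) (h : bilinfield N) : Prop :=
  HolomorphicCR {
  hcr_J_smooth : endofield_smooth J;
  hcr_J2 : forall p (v : 'rV[R]_(n.*2)), v *m J p *m J p = - v;
  hcr_metric : pseudo_riemannian_metric n n h;
  hcr_h_J : forall p u v, bilin (h p) (u *m J p) (v *m J p) = - bilin (h p) u v;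
  hcr_parallel : forall D : connection N, levi_civita h D ->
    forall p u Y, vfield_smooth_at p Y -> cov_endo D J p u Y = 0
}.

(* Main.v *)
Require Import Defs.
From HB Require Import structures.
From mathcomp Require Import all_boot all_order all_algebra.
From mathcomp Require Import all_classical all_reals all_analysis.
From mathcomp Require Import ring lra zify.
Import Order.TTheory GRing.Theory Num.Theory.
Import numFieldNormedType.Exports.
Set Implicit Arguments.
Unset Strict Implicit.
Unset Printing Implicit Defensive.
Local Open Scope classical_set_scope.
Local Open Scope ring_scope.

(** In a chart, tensors are matrix-valued functions and a connection is given by a
    matrix-valued Christoffel form. The Sasaki-like conditions amount to
    [(D_x phi) y = (2 eta(x) eta(y) - g(x,y)) xi - eta(y) x], and they yield [D_x xi = - phi x].

    As [eta = g(., xi)] and [phi] is [g]-symmetric, [d eta = 0]. A local primitive of [eta] comes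
    from the Poincare lemma, and its level sets are graphs over [ker eta], which gives the leaves.

    On a leaf, [D_X Y = D^h_X Y + g(phi X, Y) xi]. The Gauss equation is then the relation between
    [R] and [R^h], and the tangential part of [D phi] vanishes on [H], so [D^h J = 0]. The
    anti-isometry [J] exchanges positive and negative vectors, which makes [h] neutral.
    Finally [R(x, y) xi] is the antisymmetrised [- (D_x phi) y], and the pair symmetry of [R]
    gives the last identity. *)

(** * Smooth functions *)

(** All signs come from one computation. Differentiating [phi xi = 0] gives [phi (D_x xi) = - (D_x
    phi) xi = x - eta(x) xi]. As [g(xi, xi) = 1], the vector [D_x xi] is horizontal, and a second
    [phi] gives its value. Then [(D_x eta) y = - g(phi x, y)] is symmetric, which closes [eta], and
    [g(D_X Y, xi) = - g(Y, D_X xi) = g(phi X, Y)] is the second fundamental form, whose products are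
    the correction terms of the Gauss equation.

    What shapes the proof is the encoding. A tangent vector is stored in the preferred chart of its
    own base point, so nothing can be differentiated before being transported to one fixed chart by
    [trans_jac]; the [_rep] functions are the transported tensors. The hypersurface computation is
    therefore made for matrix-valued functions on coordinate spaces, with vectors as rows and
    operators acting from the right. As the connection of the leaf is an arbitrary Levi-Civita
    connection of [h], the uniqueness argument has to be part of that computation. *)

Section Ck.
Variable R : realType.
Implicit Types V W : normedModType R.

Lemma CkW V W k (U : set V) (f : V -> W) : Ck k.+1 U f -> Ck k U f.
Proof.
elim: k f => [|k IH] f [df Df] /=.
  by move=> x Ux; apply: differentiable_continuous; exact: df.
by split=> // v; exact: IH.
Qed.

Lemma sub_Ck V W k (U U' : set V) (f : V -> W) : U' `<=` U -> Ck k U f -> Ck k U' f.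
Proof.
move=> sU; elim: k f => [|k IH] f /=; first by move=> cf x /sU; exact: cf.
by move=> [df Df]; split=> [x /sU|v]; [exact: df|exact: IH].
Qed.

(** Serves to localise differentiability and, later, to differentiate a function known only through
    mean value estimates. *)
Lemma eps_is_diff V W (f : V -> W) (L : {linear V -> W}) x :
  continuous L ->
  (forall e, 0 < e -> \forall h \near 0, `|f (h + x) - f x - L h| <= e * `|h|) ->
  is_diff x f L.
Proof.
move=> cL fL.
have E : f \o shift x = cst (f x) + L +o_ 0 id.
  apply/eqaddoP => e /fL; apply: filterS => h.
  by rewrite /= !fctE /= opprD addrA.
have dE := diff_unique cL E.
by apply: DiffDef => //; apply/diff_locallyP; rewrite dE.
Qed.

Lemma near_differentiable V W (f g : V -> W) x :
  {near x, f =1 g} -> differentiable f x -> differentiable g x.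
Proof.
move=> fg df; suff D : is_diff x g ('d f x) by exact: ex_diff.
apply: (eps_is_diff (L := 'd f x)); first exact: diff_continuous.
move=> e e0; have := diff_locally df; move=> /eqaddoP /(_ e e0) H.
have fg0 : \forall h \near 0, f (h + x) = g (h + x).
  by move: fg; rewrite /= (near_shift 0) /=; apply: filterS => h; rewrite subr0.
near=> h; rewrite -(nbhs_singleton fg).
have -> : g (h + x) = f (h + x) by apply/esym; near: h.
have : `|(f \o shift x - (cst (f x) + 'd f x)) h| <= e * `|h| by near: h.
by rewrite /= !fctE /= opprD addrA.
Unshelve. all: by end_near. Qed.

Lemma eq_Ck V W k (U : set V) (f g : V -> W) :
  open U -> {in U, f =1 g} -> Ck k U f -> Ck k U g.
Proof.
move=> oU; elim: k f g => [|k IH] f g fg /=.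
  move=> cf x Ux; rewrite /prop_for /continuous_at -fg ?inE//.
  apply: cvg_trans (cf x Ux); apply: near_eq_cvg.
  by apply: filterS (open_nbhs_nbhs (conj oU Ux)) => y Uy; rewrite fg ?inE.
move=> [df Df].
have nfg x : U x -> {near x, f =1 g}.
  by move=> Ux; apply: filterS (open_nbhs_nbhs (conj oU Ux)) => y Uy; rewrite fg ?inE.
split=> [x Ux|v]; first by apply: near_differentiable (df x Ux); exact: nfg.
apply: IH (Df v) => x; rewrite inE => Ux; apply: near_eq_derive; exact: nfg.
Qed.

Lemma Ck_cst V W k (U : set V) (a : W) : Ck k U (fun=> a).
Proof.
elim: k a => [|k IH] a /=; first by move=> x _; exact: cvg_cst.
split=> [x _|v]; first exact: differentiable_cst.
suff -> : (fun x => 'D_v (fun=> a) x) = (fun=> 0 : W) by exact: IH.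
by apply/funext => x; exact: derive_cst.
Qed.

Lemma CkD V W k (U : set V) (f g : V -> W) : open U ->
  Ck k U f -> Ck k U g -> Ck k U (fun x => f x + g x).
Proof.
move=> oU; elim: k f g => [|k IH] f g /=.
  by move=> cf cg x Ux; apply: continuousD; [exact: cf|exact: cg].
move=> [df Df] [dg Dg]; split=> [x Ux|v].
  by apply: differentiableD; [exact: df|exact: dg].
apply: eq_Ck (IH _ _ (Df v) (Dg v)) => // x; rewrite inE => Ux.
by rewrite -deriveD//; apply: diff_derivable; [exact: df|exact: dg].
Qed.

Lemma CkN V W k (U : set V) (f : V -> W) : open U ->
  Ck k U f -> Ck k U (fun x => - f x).
Proof.
move=> oU; elim: k f => [|k IH] f /=.
  by move=> cf x Ux; apply: continuousN; exact: cf.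
move=> [df Df]; split=> [x Ux|v].
  by apply: differentiableN; exact: df.
apply: eq_Ck (IH _ (Df v)) => // x; rewrite inE => Ux.
by rewrite -deriveN//; apply: diff_derivable; exact: df.
Qed.

Lemma Ck_sum V W k (U : set V) I (s : seq I) (P : pred I) (f : I -> V -> W) : open U ->
  (forall i, Ck k U (f i)) -> Ck k U (fun x => \sum_(i <- s | P i) f i x).
Proof.
move=> oU Cf; elim: s => [|i s IH].
  by under eq_fun do rewrite big_nil; exact: Ck_cst.
under eq_fun do rewrite big_cons.
by case: (P i) => //; exact: CkD.
Qed.

Lemma CkM V k (U : set V) (f g : V -> R) : open U ->
  Ck k U f -> Ck k U g -> Ck k U (fun x => f x * g x).
Proof.
move=> oU; elim: k f g => [|k IH] f g.
  by move=> cf cg x Ux; apply: continuousM; [exact: cf|exact: cg].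
move=> Cf Cg; have [[df Df] [dg Dg]] := (Cf, Cg); split=> [x Ux|v].
  by apply: differentiableM; [exact: df|exact: dg].
apply: eq_Ck (CkD oU (IH _ _ (CkW Cf) (Dg v)) (IH _ _ (CkW Cg) (Df v))) => //.
move=> x; rewrite inE => Ux.
by rewrite deriveM//; apply: diff_derivable; [exact: df|exact: dg].
Qed.

Lemma CkV V k (U : set V) (f : V -> R) : open U ->
  (forall x, U x -> f x != 0) -> Ck k U f -> Ck k U (fun x => (f x)^-1).
Proof.
move=> oU f0; elim: k => [|k IH].
  by move=> cf x Ux; apply: cvgV; [exact: f0|exact: cf].
move=> Cf; have [df Df] := Cf; split=> [x Ux|v].
  by apply: differentiableV; [exact: df|exact: f0].
have Ci := IH (CkW Cf).
apply: eq_Ck (CkN oU (CkM oU (CkM oU Ci Ci) (Df v))) => //.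
move=> x; rewrite inE => Ux.
rewrite deriveV; [|exact: f0|by apply: diff_derivable; exact: df].
by rewrite scaleNr /GRing.scale/= -exprVn expr2.
Qed.

Lemma derivable_mxij V m n (f : V -> 'M[R]_(m, n)) x v i j :
  derivable f x v -> 'D_v (fun y => f y i j) x = ('D_v f x) i j.
Proof. by move=> df; rewrite derive_mx// mxE. Qed.

Lemma differentiable_mxP V m n (f : V -> 'M[R]_(m, n)) x :
  differentiable f x <-> forall i j, differentiable (fun y => f y i j) x.
Proof.
split=> [df i j|df].
  apply: (@differentiable_comp _ _ _ _ f (fun M : 'M[R]_(m, n) => M i j)) => //.
  exact: differentiable_coord.
rewrite (_ : f = \sum_i \sum_j (fun y => f y i j *: delta_mx i j)).
  by apply: differentiable_sum => i; apply: differentiable_sum => j; exact: differentiableZl.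
apply/funext => y; rewrite [LHS]matrix_sum_delta fct_sumE; apply: eq_bigr => i _.
by rewrite fct_sumE.
Qed.

Lemma Ck_mxP V m n k (U : set V) (f : V -> 'M[R]_(m, n)) : open U ->
  Ck k U f <-> forall i j, Ck k U (fun y => f y i j).
Proof.
move=> oU; elim: k f => [|k IH] f.
  split=> [cf i j x Ux|cf x Ux].
    apply: (@continuous_comp _ _ _ f (fun M : 'M[R]_(m, n) => M i j)); first exact: cf.
    exact: coord_continuous.
  apply/cvgrPdist_le => e e0; near=> y.
  rewrite /Num.Def.normr/= mx_normrE (bigmax_le _ (ltW e0))//= => i _.
  rewrite !mxE; move: i; near: y; apply: filter_forall => /= i.
  exact: (cvgrPdist_le _ _).1 (cf i.1 i.2 x Ux) _ e0.
split=> [[df Df] i j|Cf].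
  split=> [x Ux|v]; first by have /differentiable_mxP := df x Ux.
  apply: eq_Ck ((IH _).1 (Df v) i j) => // x; rewrite inE => Ux.
  by rewrite derivable_mxij//; apply: diff_derivable; exact: df.
have df x : U x -> differentiable f x.
  by move=> Ux; apply/differentiable_mxP => i j; exact: (Cf i j).1.
split=> // v; apply/IH => i j.
apply: eq_Ck ((Cf i j).2 v) => // x; rewrite inE => Ux.
by rewrite derivable_mxij//; apply: diff_derivable; exact: df.
Unshelve. all: by end_near. Qed.

Lemma derive_comp V W W' (f : W -> W') (g : V -> W) x v :
  differentiable g x -> differentiable f (g x) ->
  'D_v (fun y => f (g y)) x = 'D_('D_v g x) f (g x).
Proof.
move=> dg df; rewrite !deriveE//; last exact: differentiable_comp.
by rewrite diff_comp.
Qed.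

Lemma derive_lin V W (f : V -> W) x : differentiable f x ->
  linear (fun v => 'D_v f x).
Proof. by move=> df a u v; rewrite !deriveE// linearP. Qed.

Lemma derive_delta m W (f : 'rV[R]_m -> W) x v : differentiable f x ->
  'D_v f x = \sum_i v 0 i *: 'D_(delta_mx 0 i) f x.
Proof.
move=> df; rewrite deriveE// {1}(row_sum_delta v) linear_sum.
by apply: eq_bigr => i _; rewrite linearZ deriveE.
Qed.

(** [Ck] speaks of derivatives in fixed directions, whereas the chain rule differentiates [f] in the
    varying direction ['D_v g x]. Expanding that direction in coordinates leaves products to which
    the induction hypothesis applies. *)
Lemma Ck_comp V m k (U : set V) (U' : set 'rV[R]_m) (f : 'rV[R]_m -> R) (g : V -> 'rV[R]_m) :
  open U -> open U' -> (forall x, U x -> U' (g x)) ->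
  Ck k U g -> Ck k U' f -> Ck k U (fun x => f (g x)).
Proof.
move=> oU oU' gU; elim: k f => [|k IH] f.
  move=> cg cf x Ux; apply: (@continuous_comp _ _ _ g f); first exact: cg.
  by apply: cf; exact: gU.
move=> Cg Cf; have [[dg Dg] [df Df]] := (Cg, Cf); split=> [x Ux|v].
  apply: (@differentiable_comp _ _ _ _ g f); first exact: dg.
  by apply: df; exact: gU.
apply: (@eq_Ck _ _ _ _ (fun x => \sum_i ('D_v g x) 0 i * 'D_(delta_mx 0 i) f (g x))) => //.
  move=> x; rewrite inE => Ux; have Ugx := gU _ Ux.
  by rewrite [RHS]derive_comp ?[RHS]derive_delta//; [exact: df|exact: dg|exact: df].
apply: Ck_sum => // i; apply: CkM => //.
  exact: ((Ck_mxP _ _ oU).1 (Dg v) 0 i).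
by apply: (IH (fun y => 'D_(delta_mx 0 i) f y)); [exact: CkW|exact: Df].
Qed.

End Ck.

(** * Smoothness near a point *)

Section SmoothNear.
Variable R : realType.
Implicit Types V W : normedModType R.

Lemma smooth_near_fin V W (I : finType) (f : I -> V -> W) x :
  (forall i, smooth_near (f i) x) ->
  exists U : set V, [/\ open U, U x & forall i, smooth_on U (f i)].
Proof.
move=> /choice[U HU]; exists [set y | forall i, U i y]; split.
- rewrite openE => y Uy; apply: filter_forall => i.
  by have [oU _ _] := HU i; exact: open_nbhs_nbhs.
- by move=> i; have [] := HU i.
- by move=> i k; have [_ _ /(_ k)] := HU i; apply: sub_Ck => y; exact.
Qed.

Lemma smooth_near2 V W W' (f : V -> W) (g : V -> W') x :
  smooth_near f x -> smooth_near g x ->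
  exists U : set V, [/\ open U, U x, smooth_on U f & smooth_on U g].
Proof.
move=> [A [oA Ax fA]] [B [oB Bx gB]]; exists (A `&` B); split.
- exact: openI.
- by [].
- by move=> k; apply: sub_Ck (fA k) => ? [].
- by move=> k; apply: sub_Ck (gB k) => ? [].
Qed.

Lemma eq_smooth_near V W (f g : V -> W) x :
  {near x, f =1 g} -> smooth_near f x -> smooth_near g x.
Proof.
rewrite /prop_near1 nbhsE => -[B [oB Bx] fg] [A [oA Ax fA]].
exists (A `&` B); split; [exact: openI|by []|move=> k].
apply: (eq_Ck (f := f)); first exact: openI.
  by move=> y; rewrite inE => -[_ /fg].
by apply: sub_Ck (fA k) => ? [].
Qed.

Lemma ext_smooth_near V W (f g : V -> W) x :
  f =1 g -> smooth_near f x -> smooth_near g x.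
Proof. by move=> /funext ->. Qed.

Lemma smooth_near_near V W (f : V -> W) x :
  smooth_near f x -> \forall y \near x, smooth_near f y.
Proof.
move=> [U [oU Ux Uf]]; apply: filterS (open_nbhs_nbhs (conj oU Ux)) => y Uy.
by exists U.
Qed.

Lemma smooth_near_differentiable V W (f : V -> W) x :
  smooth_near f x -> differentiable f x.
Proof. by move=> [U [_ Ux /(_ 1%N)[+ _]]]; exact. Qed.

Lemma smooth_near_derivable V W (f : V -> W) x v :
  smooth_near f x -> derivable f x v.
Proof. by move/smooth_near_differentiable => *; exact: diff_derivable. Qed.

Lemma smooth_near_continuous V W (f : V -> W) x :
  smooth_near f x -> {for x, continuous f}.
Proof. by move/smooth_near_differentiable => *; exact: differentiable_continuous. Qed.

Lemma smooth_near_cst V W (a : W) (x : V) : smooth_near (fun=> a) x.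
Proof. by exists setT; split=> [|//|k]; [exact: openT|exact: Ck_cst]. Qed.

Lemma smooth_near_derive V W (f : V -> W) x v :
  smooth_near f x -> smooth_near (fun y => 'D_v f y) x.
Proof. by move=> [U [oU Ux Uf]]; exists U; split=> // k; have [_ ] := Uf k.+1; exact. Qed.

Lemma smooth_nearD V W (f g : V -> W) x :
  smooth_near f x -> smooth_near g x -> smooth_near (fun y => f y + g y) x.
Proof.
move=> sf sg; have [U [oU Ux fU gU]] := smooth_near2 sf sg.
by exists U; split=> // k; apply: CkD.
Qed.

Lemma smooth_nearM V (f g : V -> R) x :
  smooth_near f x -> smooth_near g x -> smooth_near (fun y => f y * g y) x.
Proof.
move=> sf sg; have [U [oU Ux fU gU]] := smooth_near2 sf sg.
by exists U; split=> // k; apply: CkM.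
Qed.

Lemma smooth_near_sum V W I (s : seq I) (P : pred I) (f : I -> V -> W) x :
  (forall i, smooth_near (f i) x) -> smooth_near (fun y => \sum_(i <- s | P i) f i y) x.
Proof.
move=> sf; elim: s => [|i s IH].
  by under eq_fun do rewrite big_nil; exact: smooth_near_cst.
under eq_fun do rewrite big_cons.
by case: (P i) => //; exact: smooth_nearD.
Qed.

Lemma smooth_near_prod V I (s : seq I) (P : pred I) (f : I -> V -> R) x :
  (forall i, smooth_near (f i) x) -> smooth_near (fun y => \prod_(i <- s | P i) f i y) x.
Proof.
move=> sf; elim: s => [|i s IH].
  by under eq_fun do rewrite big_nil; exact: smooth_near_cst.
under eq_fun do rewrite big_cons.
by case: (P i) => //; exact: smooth_nearM.
Qed.

Lemma smooth_nearV V (f : V -> R) x :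
  f x != 0 -> smooth_near f x -> smooth_near (fun y => (f y)^-1) x.
Proof.
move=> f0 sf; have cf := smooth_near_continuous sf.
have : \forall y \near x, f y != 0 by exact: cvgr_neq0 _ cf f0.
rewrite /prop_near1 nbhsE => -[B [oB Bx] nf]; have [A [oA Ax fA]] := sf.
exists (A `&` B); split; [exact: openI|by []|move=> k].
apply: CkV; [exact: openI|by move=> y [_ /nf]|].
by apply: sub_Ck (fA k) => ? [].
Qed.

Lemma smooth_near_mxP V m n (f : V -> 'M[R]_(m, n)) x :
  smooth_near f x <-> forall i j, smooth_near (fun y => f y i j) x.
Proof.
split=> [[U [oU Ux Uf]] i j|sf].
  by exists U; split=> // k; exact: ((Ck_mxP _ _ oU).1 (Uf k)).
have [|U [oU Ux Uf]] :=
  @smooth_near_fin _ _ _ (fun (p : 'I_m * 'I_n) y => f y p.1 p.2) x.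
  by move=> p; exact: sf.
by exists U; split=> // k; apply/(Ck_mxP _ _ oU) => i j; exact: (Uf (i, j)).
Qed.

Lemma smooth_near_scalarmx V (f : V -> R) x n :
  smooth_near f x -> smooth_near (fun y => (f y)%:M : 'M[R]_n) x.
Proof.
move=> sf; apply/smooth_near_mxP => i j.
under eq_fun do rewrite mxE.
case: (i == j); first exact: sf.
exact: smooth_near_cst.
Qed.

Lemma smooth_nearZ V m n (a : V -> R) (f : V -> 'M[R]_(m, n)) x :
  smooth_near a x -> smooth_near f x -> smooth_near (fun y => a y *: f y) x.
Proof.
move=> sa /smooth_near_mxP sf; apply/smooth_near_mxP => i j.
by under eq_fun do rewrite mxE; exact: smooth_nearM.
Qed.

Lemma smooth_near_mulmx V m n p (A : V -> 'M[R]_(m, n)) (B : V -> 'M[R]_(n, p)) x :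
  smooth_near A x -> smooth_near B x -> smooth_near (fun y => A y *m B y) x.
Proof.
move=> /smooth_near_mxP sA /smooth_near_mxP sB; apply/smooth_near_mxP => i j.
under eq_fun do rewrite mxE; apply: smooth_near_sum => k.
exact: smooth_nearM.
Qed.

Lemma smooth_near_trmx V m n (A : V -> 'M[R]_(m, n)) x :
  smooth_near A x -> smooth_near (fun y => (A y)^T) x.
Proof.
move=> /smooth_near_mxP sA; apply/smooth_near_mxP => i j.
by under eq_fun do rewrite mxE.
Qed.

Lemma smooth_near_rowsP V m n (A : V -> 'M[R]_(m, n)) x :
  (forall i, smooth_near (fun y => row i (A y)) x) -> smooth_near A x.
Proof.
move=> sA; apply/smooth_near_mxP => i j.
have /smooth_near_mxP/(_ 0 j) := sA i.
by apply: eq_smooth_near; apply: nearW => y; rewrite mxE.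
Qed.

Lemma smooth_near_det V n (A : V -> 'M[R]_n) x :
  smooth_near A x -> smooth_near (fun y => \det (A y)) x.
Proof.
move=> /smooth_near_mxP sA; rewrite /determinant.
apply: smooth_near_sum => s; apply: smooth_nearM; first exact: smooth_near_cst.
exact: smooth_near_prod.
Qed.

(** Cramer's formula: the adjugate and the determinant are polynomial in the entries, and the
    determinant stays nonzero near [x]. *)
Lemma smooth_near_invmx V n (A : V -> 'M[R]_n) x :
  A x \in unitmx -> smooth_near A x -> smooth_near (fun y => invmx (A y)) x.
Proof.
move=> uA sA; have sd := smooth_near_det sA.
have d0 : \det (A x) != 0 by rewrite -unitfE -unitmxE.
have : \forall y \near x, \det (A y) != 0.
  exact: cvgr_neq0 _ (smooth_near_continuous sd) d0.
move=> nd; apply: (@eq_smooth_near _ _ (fun y => (\det (A y))^-1 *: \adj (A y))).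
  by apply: filterS nd => y dy; rewrite /invmx unitmxE unitfE dy.
apply: smooth_nearZ; first exact: smooth_nearV.
apply/smooth_near_mxP => i j; under eq_fun do rewrite mxE /cofactor.
apply: smooth_nearM; first exact: smooth_near_cst.
apply: smooth_near_det; apply/smooth_near_mxP => i' j'.
under eq_fun do rewrite !mxE.
by move: i' j'; have /smooth_near_mxP := sA.
Qed.

Lemma smooth_near_comp V m p q (f : 'rV[R]_m -> 'M[R]_(p, q)) (g : V -> 'rV[R]_m) x :
  smooth_near g x -> smooth_near f (g x) -> smooth_near (fun y => f (g y)) x.
Proof.
move=> sg /smooth_near_mxP sf; apply/smooth_near_mxP => i j.
have {sf} [A [oA Agx fA]] := sf i j; have [B [oB Bx gB]] := sg.
have : nbhs x [set y | A (g y)].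
  by apply: (smooth_near_continuous sg); exact: open_nbhs_nbhs.
rewrite nbhsE => -[C [oC Cx] CA].
exists (B `&` C); split; [exact: openI|by []|move=> k].
apply: (Ck_comp (U' := A) (f := fun z => f z i j)) => //; first exact: openI.
  by move=> y [_ /CA].
by apply: sub_Ck (gB k) => ? [].
Qed.

Lemma smooth_near_comp1 V m (f : 'rV[R]_m -> R) (g : V -> 'rV[R]_m) x :
  smooth_near g x -> smooth_near f (g x) -> smooth_near (fun y => f (g y)) x.
Proof.
move=> sg sf; have sF : smooth_near (fun z => (f z)%:M : 'M[R]_1) (g x).
  exact: smooth_near_scalarmx.
have /smooth_near_mxP /(_ 0 0) := smooth_near_comp sg sF.
by apply: eq_smooth_near; apply: nearW => y; rewrite mxE.
Qed.

Lemma smooth_near_id m n (x : 'M[R]_(m, n)) : smooth_near id x.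
Proof.
exists setT; split=> [|//|]; first exact: openT.
move=> -[|k] /=; first by move=> y _; exact: cvg_id.
split=> [y _|v]; first exact: (@ex_diff _ _ _ _ _ _ id).
suff -> : (fun y => 'D_v id y) = (fun=> v) by exact: Ck_cst.
by apply/funext => y; exact: derive_id.
Qed.

(** The direction moves with the point, so the derivative is expanded along fixed basis vectors. *)
Lemma smooth_near_derive_dir m p q (f : 'rV[R]_m -> 'M[R]_(p, q)) (v : 'rV[R]_m -> 'rV[R]_m) x :
  smooth_near f x -> smooth_near v x -> smooth_near (fun y => 'D_(v y) f y) x.
Proof.
move=> sf sv.
apply: (@eq_smooth_near _ _ (fun y => \sum_i v y 0 i *: 'D_(delta_mx 0 i) f y)).
  apply: filterS (smooth_near_near sf) => y /smooth_near_differentiable df.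
  by rewrite -derive_delta.
apply: smooth_near_sum => i; apply: smooth_nearZ.
  by have /smooth_near_mxP := sv.
exact: smooth_near_derive.
Qed.

Lemma row_jacobian m n (f : 'rV[R]_m -> 'rV[R]_n) x i :
  differentiable f x -> row i (jacobian f x) = 'D_(delta_mx 0 i) f x.
Proof. by move=> df; rewrite deriveEjacobian// rowE. Qed.

Lemma smooth_near_jacobian m n (f : 'rV[R]_m -> 'rV[R]_n) x :
  smooth_near f x -> smooth_near (fun y => jacobian f y) x.
Proof.
move=> sf; apply: smooth_near_rowsP => i.
apply: (@eq_smooth_near _ _ (fun y => 'D_(delta_mx 0 i) f y)).
  apply: filterS (smooth_near_near sf) => y /smooth_near_differentiable df.
  by rewrite row_jacobian.
exact: smooth_near_derive.
Qed.

End SmoothNear.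

(** * Product rules, mean values and the symmetry of second derivatives *)

Section Rules.
Variable R : realType.
Implicit Types V W : normedModType R.

Lemma is_derive_mxP V m n (f : V -> 'M[R]_(m, n)) x v (D : 'M[R]_(m, n)) :
  (forall i j, is_derive x v (fun y => f y i j) (D i j)) -> is_derive x v f D.
Proof.
move=> df; have dvf : derivable f x v by apply/derivable_mxP => i j; exact: ex_derive.
apply: DeriveDef => //; rewrite derive_mx//; apply/matrixP => i j; rewrite mxE.
exact: derive_val.
Qed.

Lemma is_derive_sum_fin V W I (s : seq I) (f : I -> V -> W) x v D :
  (forall i, is_derive x v (f i) (D i)) ->
  is_derive x v (fun y => \sum_(i <- s) f i y) (\sum_(i <- s) D i).
Proof.
move=> df; elim: s => [|i s IH].
  by under eq_fun do rewrite big_nil; rewrite big_nil; exact: is_derive_cst.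
by under eq_fun do rewrite big_cons; rewrite big_cons; exact: is_deriveD.
Qed.

Lemma is_derive_mulmx V m n p (A : V -> 'M[R]_(m, n)) (B : V -> 'M[R]_(n, p)) x v :
  derivable A x v -> derivable B x v ->
  is_derive x v (fun y => A y *m B y) ('D_v A x *m B x + A x *m 'D_v B x).
Proof.
move=> dA dB; apply: is_derive_mxP => i j; rewrite !mxE -big_split/=.
under eq_fun do rewrite mxE.
apply: is_derive_sum_fin => k.
have dAik : derivable (fun y => A y i k) x v by exact: ((derivable_mxP _ _ _).1 dA).
have dBkj : derivable (fun y => B y k j) x v by exact: ((derivable_mxP _ _ _).1 dB).
have := is_deriveM (derivableP dAik) (derivableP dBkj).
rewrite (derivable_mxij _ _ dA) (derivable_mxij _ _ dB) => H.
by apply: is_derive_eq H _; rewrite [LHS]addrC; congr (_ + _); exact: mulrC.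
Qed.

Lemma derive_mulmx V m n p (A : V -> 'M[R]_(m, n)) (B : V -> 'M[R]_(n, p)) x v :
  derivable A x v -> derivable B x v ->
  'D_v (fun y => A y *m B y) x = 'D_v A x *m B x + A x *m 'D_v B x.
Proof. by move=> dA dB; have [] := is_derive_mulmx dA dB. Qed.

Lemma derive_mulmxl V m n p (A : 'M[R]_(m, n)) (B : V -> 'M[R]_(n, p)) x v :
  derivable B x v -> 'D_v (fun y => A *m B y) x = A *m 'D_v B x.
Proof.
move=> dB; rewrite (derive_mulmx (A := fun=> A))//.
by rewrite derive_cst mul0mx add0r.
Qed.

Lemma derive_mulmxr V m n p (A : V -> 'M[R]_(m, n)) (B : 'M[R]_(n, p)) x v :
  derivable A x v -> 'D_v (fun y => A y *m B) x = 'D_v A x *m B.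
Proof.
move=> dB; rewrite (derive_mulmx (B := fun=> B))//.
by rewrite derive_cst mulmx0 addr0.
Qed.

Lemma is_derive_trmx V m n (A : V -> 'M[R]_(m, n)) x v :
  derivable A x v -> is_derive x v (fun y => (A y)^T) ('D_v A x)^T.
Proof.
move=> dA; apply: is_derive_mxP => i j; rewrite mxE -derivable_mxij//.
under eq_fun do rewrite mxE.
by apply: derivableP; move/derivable_mxP : dA.
Qed.

Lemma derive_trmx V m n (A : V -> 'M[R]_(m, n)) x v :
  derivable A x v -> 'D_v (fun y => (A y)^T) x = ('D_v A x)^T.
Proof. by move=> dA; have [] := is_derive_trmx dA. Qed.

Lemma is_derive_affine V (v x : V) (r : R) : is_derive r 1 (fun s => s *: v + x) v.
Proof.
have dZ : is_derive r 1 ( *:%R^~ v) v.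
  apply: DeriveDef; first exact: diff_derivable.
  by rewrite deriveE// diff_val scale1r.
by have := is_deriveD dZ (is_derive_cst x r 1); rewrite addr0.
Qed.

Lemma is_derive_line V W (f : V -> W) x v (r : R) :
  differentiable f (r *: v + x) ->
  is_derive r 1 (fun s => f (s *: v + x)) ('D_v f (r *: v + x)).
Proof.
move=> df; have [da va] := is_derive_affine v x r.
have dg : differentiable (fun s : R => s *: v + x) r by exact/derivable1_diffP.
apply: DeriveDef; last by rewrite derive_comp ?va.
by apply: diff_derivable; exact: differentiable_comp.
Qed.

Lemma MVT_is_derive (f df : R -> R) (t : R) : 0 < t ->
  (forall s, 0 <= s <= t -> is_derive s 1 f (df s)) ->
  exists2 c, 0 <= c <= t & f t - f 0 = df c * t.
Proof.
move=> t0 dfE; have [||c ct E] := @MVT _ f df 0 t t0.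
- by move=> s; rewrite in_itv/= => /andP[s0 st]; apply: dfE; rewrite !ltW.
- apply: derivable_within_continuous => s; rewrite in_itv/= => st.
  by have [] := dfE s st.
- exists c; last by rewrite subr0 in E.
  by move: ct; rewrite in_itv/= => /andP[? ?]; rewrite !ltW.
Qed.

Lemma MVT_line V (f : V -> R) x v (t : R) : 0 < t ->
  (forall s, 0 <= s <= t -> differentiable f (s *: v + x)) ->
  exists2 c, 0 <= c <= t & f (t *: v + x) - f x = 'D_v f (c *: v + x) * t.
Proof.
move=> t0 df.
have [|c ct E] := @MVT_is_derive (fun s => f (s *: v + x)) (fun s => 'D_v f (s *: v + x)) t t0.
  by move=> s /df; exact: is_derive_line.
by exists c => //; rewrite -E scale0r add0r.
Qed.

(** The mean value theorem twice: along [u] for the increment of [f] in direction [v], then along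
    [v] for the derivative ['D_u f]. The quotient on the right is symmetric in [u] and [v], which is
    what the symmetry of second derivatives needs. *)
Lemma second_difference V (f : V -> R) x u v (h : R) : 0 < h ->
  (forall s t, 0 <= s <= h -> 0 <= t <= h -> differentiable f (t *: v + (s *: u + x))) ->
  (forall s t, 0 <= s <= h -> 0 <= t <= h ->
     differentiable (fun y => 'D_u f y) (t *: v + (s *: u + x))) ->
  exists c d, [/\ 0 <= c <= h, 0 <= d <= h &
    'D_v (fun y => 'D_u f y) (d *: v + (c *: u + x)) =
    (f (h *: v + (h *: u + x)) - f (h *: u + x) - (f (h *: v + x) - f x)) / h / h].
Proof.
move=> h0 df d2f.
pose g s := f (h *: v + (s *: u + x)) - f (s *: u + x).
pose dg s := 'D_u f (h *: v + (s *: u + x)) - 'D_u f (s *: u + x).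
have [|c ch E] := @MVT_is_derive g dg h h0.
  move=> s sh; apply: is_deriveB; last first.
    by apply: is_derive_line; have := df s 0 sh; rewrite scale0r add0r; apply; rewrite lexx ltW.
  have -> : (fun s => f (h *: v + (s *: u + x))) = (fun s => f (s *: u + (h *: v + x))).
    by apply/funext => r; rewrite addrCA.
  by rewrite addrCA; apply: is_derive_line; rewrite addrCA; apply: df => //; rewrite lexx ltW.
have [|d dh E2] := @MVT_line _ (fun y => 'D_u f y) (c *: u + x) v h h0.
  by move=> s; exact: d2f.
exists c, d; split=> //.
move: E; rewrite /g /dg E2 scale0r add0r => ->.
by rewrite !mulfK ?gt_eqF.
Qed.

(** The mean value theorem gives different intermediate points for the two mixed derivatives, so [A]
    and [B] are compared at distinct points [y] and [z] tending to [x]. *)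
Lemma eq_at_limit V (A B : V -> R) x :
  {for x, continuous A} -> {for x, continuous B} ->
  (forall r, 0 < r -> exists y z, [/\ ball x r y, ball x r z & A y = B z]) -> A x = B x.
Proof.
move=> cA cB H.
apply/eqP; rewrite -subr_eq0 -normr_le0; apply/ler_addgt0Pr => e e0; rewrite add0r.
have e20 : 0 < e / 2 by rewrite divr_gt0.
have /nbhs_ballP[r1 /= r10 H1] : \forall t \near x, `|A x - A t| <= e / 2.
  exact: ((cvgrPdist_le _ _).1 cA).
have /nbhs_ballP[r2 /= r20 H2] : \forall t \near x, `|B x - B t| <= e / 2.
  exact: ((cvgrPdist_le _ _).1 cB).
have r0 : 0 < Num.min r1 r2 by rewrite lt_min r10.
have [y [z [xy xz AB]]] := H _ r0.
have -> : A x - B x = (A x - A y) - (B x - B z) by rewrite AB; ring.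
apply: le_trans (ler_normB _ _) _; rewrite [leRHS]splitr; apply: lerD.
  by apply: H1; apply: le_ball xy; rewrite ge_min lexx.
by apply: H2; apply: le_ball xz; rewrite ge_min lexx orbT.
Qed.

Lemma schwarz1 V (f : V -> R) x u v : smooth_near f x ->
  'D_v (fun y => 'D_u f y) x = 'D_u (fun y => 'D_v f y) x.
Proof.
move=> sf.
apply: (@eq_at_limit V (fun y => 'D_v (fun z => 'D_u f z) y)
                       (fun y => 'D_u (fun z => 'D_v f z) y)).
- by apply: smooth_near_continuous; do 2!apply: smooth_near_derive.
- by apply: smooth_near_continuous; do 2!apply: smooth_near_derive.
move=> e e0.
have /nbhs_ballP[r' /= r0' Hr'] := smooth_near_near sf.
have [r [r0 Hr re]] : exists r, [/\ 0 < r, forall y, ball x r y -> smooth_near f y &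
    forall y, ball x r y -> ball x e y].
  exists (Num.min r' e); split=> [|y xy|y]; first by rewrite lt_min r0'.
    by apply: Hr'; apply: le_ball xy; rewrite ge_min lexx.
  by apply: le_ball; rewrite ge_min lexx orbT.
have [h h0 hr] : exists2 h, 0 < h & h * (`|u| + `|v|) < r.
  have uv0 : 0 < `|u| + `|v| + 1 by rewrite ltr_wpDl ?addr_ge0.
  (* Keeps the parallelogram with sides [h u] and [h v] inside the ball of radius [r]; the added 1
     covers the case [u = v = 0]. *)
  pose h := r / 2 / (`|u| + `|v| + 1).
  have h0 : 0 < h by rewrite !divr_gt0.
  exists h => //.
  have E : h * (`|u| + `|v| + 1) * 2 = r by rewrite /h divfK ?gt_eqF// divfK.
  have := mulr_ge0 (ltW h0) (normr_ge0 u); have := mulr_ge0 (ltW h0) (normr_ge0 v).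
  move: E; rewrite !mulrDr mulr1; lra.
have near_uv s t : 0 <= s <= h -> 0 <= t <= h -> ball x r (t *: v + (s *: u + x)).
  move=> /andP[s0 sh] /andP[t0 th].
  rewrite -ball_normE /ball_/= distrC addrA addrK.
  apply: le_lt_trans (ler_normD _ _) _; rewrite !normrZ !ger0_norm//.
  apply: le_lt_trans hr; rewrite mulrDr addrC.
  by apply: lerD; apply: ler_wpM2r.
have near_vu s t : 0 <= s <= h -> 0 <= t <= h -> ball x r (t *: u + (s *: v + x)).
  by move=> sh th; rewrite addrCA; exact: near_uv.
have [||c [d [ch dh E]]] := @second_difference _ f x u v h h0.
- by move=> s t sh th; apply: smooth_near_differentiable; apply/Hr/near_uv.
- move=> s t sh th; apply: smooth_near_differentiable; apply: smooth_near_derive.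
  by apply/Hr/near_uv.
have [||c' [d' [ch' dh' E']]] := @second_difference _ f x v u h h0.
- by move=> s t sh th; apply: smooth_near_differentiable; apply/Hr/near_vu.
- move=> s t sh th; apply: smooth_near_differentiable; apply: smooth_near_derive.
  by apply/Hr/near_vu.
exists (d *: v + (c *: u + x)), (d' *: u + (c' *: v + x)); split.
- exact/re/near_uv.
- exact/re/near_vu.
rewrite E E'; congr (_ / _ / _).
rewrite [h *: u + (h *: v + x)]addrCA.
move: (f (h *: v + (h *: u + x))) (f (h *: u + x)) (f (h *: v + x)) (f x) => *.
ring.
Qed.

Lemma schwarz V m n (f : V -> 'M[R]_(m, n)) x u v : smooth_near f x ->
  'D_v (fun y => 'D_u f y) x = 'D_u (fun y => 'D_v f y) x.
Proof.
move=> sf; have dD w w' : derivable (fun y => 'D_w f y) x w'.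
  by apply: smooth_near_derivable; exact: smooth_near_derive.
have E w w' i j : ('D_w' (fun y => 'D_w f y) x) i j =
    'D_w' (fun y => 'D_w (fun z => f z i j) y) x.
  rewrite -derivable_mxij//; apply: near_eq_derive.
  apply: filterS (smooth_near_near sf) => y sfy.
  by rewrite derivable_mxij//; exact: smooth_near_derivable.
apply/matrixP => i j.
transitivity ('D_v (fun y => 'D_u (fun z => f z i j) y) x); first exact: E.
transitivity ('D_u (fun y => 'D_v (fun z => f z i j) y) x); last exact/esym/E.
apply: schwarz1.
by move/smooth_near_mxP : sf.
Qed.

End Rules.

(** * Tensors and connections in charts *)

Section Charts.
Variables (R : realType) (m : nat) (M : smoothManifold R m).
Implicit Types (p q : M) (X Y : vfield M) (u v : 'rV[R]_m).

(* Sealed behind an opaque proof: unification would otherwise unfold the Jacobians when it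
   compares products of such matrices. *)
Fact trans_jac_sealed : {J : M -> M -> M -> 'M[R]_m |
  J = fun p p' q => jacobian (chart p' \o chartI p) (chart p q)}.
Proof. by eexists. Qed.

Definition trans_jac : M -> M -> M -> 'M[R]_m := sval trans_jac_sealed.

Lemma trans_jacE p p' q :
  trans_jac p p' q = jacobian (chart p' \o chartI p) (chart p q).
Proof. by rewrite /trans_jac (svalP trans_jac_sealed). Qed.

Lemma near_chart p q : dom p q ->
  \forall x \near chart p q, (chart p @` dom p) x.
Proof.
by move=> pq; apply: open_nbhs_nbhs; split; [exact: chart_image_open|exists q].
Qed.

Lemma near_chartI p q (P : set M) : dom p q -> nbhs q P ->
  \forall x \near chart p q, P (chartI p x).
Proof.
move=> pq nP; have : (chart p @` dom p) (chart p q) by exists q.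
by move/chartI_continuous; apply; rewrite chartK.
Qed.

Lemma chartIK p x : (chart p @` dom p) x -> chart p (chartI p x) = x.
Proof. by move=> [q pq <-]; rewrite chartK. Qed.

Lemma dom_chartI p x : (chart p @` dom p) x -> dom p (chartI p x).
Proof. by move=> [q pq <-]; rewrite chartK. Qed.

Lemma near_dom p q : dom p q -> nbhs q (dom p).
Proof. by move=> pq; apply: open_nbhs_nbhs; split; first exact: dom_open. Qed.

Lemma smooth_near_transition p p' q : dom p q -> dom p' q ->
  smooth_near (chart p' \o chartI p) (chart p q).
Proof.
move=> pq p'q; exists (chart p @` (dom p `&` dom p')); split.
- rewrite openE => _ [q' [pq' p'q'] <-]; rewrite /interior.
  have H1 := near_chart pq'; have H2 := near_chartI pq' (near_dom p'q').
  apply: filterS2 H1 H2 => x Ux p'x.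
  by exists (chartI p x); rewrite ?chartIK//; split=> //; exact: dom_chartI.
- by exists q.
- exact: chart_transition.
Qed.

Lemma near_chartIK p p' q : dom p q -> dom p' q ->
  \forall x \near chart p q, chartI p' (chart p' (chartI p x)) = chartI p x.
Proof.
move=> pq p'q; apply: filterS (near_chartI pq (near_dom p'q)) => x.
exact: chartK.
Qed.

Lemma jacobian_comp k l n (f : 'rV[R]_k -> 'rV[R]_l) (g : 'rV[R]_l -> 'rV[R]_n) x :
  differentiable f x -> differentiable g (f x) ->
  jacobian (g \o f) x = jacobian f x *m jacobian g (f x).
Proof.
move=> df dg; apply/row_matrixP => i; rewrite row_mul !row_jacobian//; last first.
  exact: differentiable_comp.
by rewrite [LHS]derive_comp// [LHS]deriveEjacobian.
Qed.

Lemma near_eq_jacobian k l (f g : 'rV[R]_k -> 'rV[R]_l) x :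
  {near x, f =1 g} -> differentiable f x -> jacobian f x = jacobian g x.
Proof.
move=> fg df; have dg := near_differentiable fg df.
apply/row_matrixP => i.
transitivity ('D_(delta_mx 0 i) f x); first exact: row_jacobian.
transitivity ('D_(delta_mx 0 i) g x); last by apply/esym; exact: row_jacobian.
exact: near_eq_derive fg.
Qed.

Lemma jacobian_id k (x : 'rV[R]_k) : jacobian id x = 1%:M.
Proof.
apply/row_matrixP => i; rewrite row_jacobian; last exact: (@ex_diff _ _ _ _ _ _ id).
by rewrite derive_id rowE mulmx1.
Qed.

(** Chain rule: the inner chart and its inverse cancel near [chart p q]. *)
Lemma trans_jacM p p' p'' q : dom p q -> dom p' q -> dom p'' q ->
  trans_jac p p' q *m trans_jac p' p'' q = trans_jac p p'' q.
Proof.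
move=> pq p'q p''q; rewrite !trans_jacE.
have s1 := smooth_near_differentiable (smooth_near_transition pq p'q).
have s2 := smooth_near_differentiable (smooth_near_transition p'q p''q).
have E : (chart p' \o chartI p) (chart p q) = chart p' q by rewrite /= chartK.
rewrite -E in s2; have := jacobian_comp s1 s2; rewrite E => <-.
apply: near_eq_jacobian; last exact: differentiable_comp.
by apply: filterS (near_chartIK pq p'q) => x /= ->.
Qed.

Lemma trans_jac1 p q : dom p q -> trans_jac p p q = 1%:M.
Proof.
move=> pq; rewrite trans_jacE -(jacobian_id (chart p q)).
apply: near_eq_jacobian; last first.
  exact: smooth_near_differentiable (smooth_near_transition pq pq).
by apply: filterS (near_chart pq) => x /= /chartIK.
Qed.

Lemma trans_jacV p p' q : dom p q -> dom p' q ->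
  trans_jac p p' q *m trans_jac p' p q = 1%:M.
Proof. by move=> pq p'q; rewrite trans_jacM ?trans_jac1. Qed.

Lemma vrepE p X q : dom p q -> vrep p X (chart p q) = X q *m trans_jac q p q.
Proof. by move=> pq; rewrite trans_jacE /vrep (chartK pq). Qed.

Lemma vrep_center p X : vrep p X (chart p p) = X p.
Proof. by have pp := dom_center p; rewrite (vrepE X pp) (trans_jac1 pp) mulmx1. Qed.

Lemma vrep_change p p' X q : dom p q -> dom p' q ->
  vrep p' X (chart p' q) = vrep p X (chart p q) *m trans_jac p p' q.
Proof.
move=> pq p'q; rewrite (vrepE X pq) (vrepE X p'q) -mulmxA trans_jacM//.
exact: dom_center.
Qed.

Lemma smooth_near_trans_jac p p' q : dom p q -> dom p' q ->
  smooth_near (fun x => trans_jac p p' (chartI p x)) (chart p q).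
Proof.
move=> pq p'q; apply: (@eq_smooth_near _ _ _ (fun x => jacobian (chart p' \o chartI p) x)).
  by apply: filterS (near_chart pq) => x Ux; rewrite trans_jacE chartIK.
by apply: smooth_near_jacobian; exact: smooth_near_transition.
Qed.

Lemma smooth_near_change p p' q k l (f : M -> 'M[R]_(k, l)) : dom p q -> dom p' q ->
  smooth_near (f \o chartI p) (chart p q) -> smooth_near (f \o chartI p') (chart p' q).
Proof.
move=> pq p'q sf.
apply: (@eq_smooth_near _ _ _ (fun x => (f \o chartI p) ((chart p \o chartI p') x))).
  by apply: filterS (near_chartIK p'q pq) => x /= ->.
apply: smooth_near_comp; first exact: smooth_near_transition.
by rewrite /= chartK.
Qed.

Lemma smooth_near_change1 p p' q (f : M -> R) : dom p q -> dom p' q ->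
  smooth_near (f \o chartI p : _ -> R) (chart p q) ->
  smooth_near (f \o chartI p' : _ -> R) (chart p' q).
Proof.
move=> pq p'q sf.
apply: (@eq_smooth_near _ _ _ (fun x => (f \o chartI p) ((chart p \o chartI p') x))).
  by apply: filterS (near_chartIK p'q pq) => x /= ->.
apply: smooth_near_comp1; first exact: smooth_near_transition.
by rewrite /= chartK.
Qed.

(** Detaches smoothness from the preferred chart of [q], so that all points near [p] can be treated
    in the one chart around [p]. *)
Lemma vfield_smoothP p q X : dom p q ->
  vfield_smooth_at q X <-> smooth_near (vrep p X) (chart p q).
Proof.
suff H a b : dom a q -> dom b q -> smooth_near (vrep a X) (chart a q) ->
    smooth_near (vrep b X) (chart b q).
  by move=> pq; split; apply: H => //; exact: dom_center.
move=> aq bq sX.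
pose F := fun r => vrep a X (chart a r) *m trans_jac a b r.
have sF : smooth_near (F \o chartI a) (chart a q).
  apply: (@eq_smooth_near _ _ _ (fun x => vrep a X x *m trans_jac a b (chartI a x))).
    by apply: filterS (near_chart aq) => x Ux; rewrite /F/= chartIK.
  by apply: smooth_near_mulmx => //; exact: smooth_near_trans_jac.
apply: eq_smooth_near (smooth_near_change aq bq sF).
have H1 := near_chart bq; have H2 := near_chartI bq (near_dom aq).
apply: filterS2 H1 H2 => x Ux ax.
by rewrite /F/= -vrep_change ?chartIK//; exact: dom_chartI.
Qed.

Lemma fun_smoothP p q f : dom p q ->
  fun_smooth_at q f <-> smooth_near (f \o chartI p : _ -> R) (chart p q).
Proof.
by move=> pq; split; apply: smooth_near_change1 => //; exact: dom_center.
Qed.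

Lemma dfunE p q (f : M -> R) u : dom p q ->
  smooth_near (f \o chartI p : _ -> R) (chart p q) ->
  dfun q f u = 'D_(u *m trans_jac q p q) (f \o chartI p : _ -> R) (chart p q).
Proof.
move=> pq sf; have qq := dom_center q; rewrite /dfun.
have st := smooth_near_transition qq pq.
transitivity ('D_u (fun x => (f \o chartI p) ((chart p \o chartI q) x)) (chart q q)).
  by apply: near_eq_derive; apply: filterS (near_chartIK qq pq) => x /= ->.
have E : (chart p \o chartI q) (chart q q) = chart p q by rewrite /= chartK.
rewrite derive_comp.
- rewrite E trans_jacE deriveEjacobian//; exact: smooth_near_differentiable st.
- exact: smooth_near_differentiable.
- by rewrite E; exact: smooth_near_differentiable.
Qed.

(** Inverse of [vrep p] over [dom p]; elsewhere its values carry no meaning. *)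
Definition lift_field p (z : 'rV[R]_m -> 'rV[R]_m) : vfield M :=
  fun q => z (chart p q) *m trans_jac p q q.

Lemma vrep_lift p z q : dom p q -> vrep p (lift_field p z) (chart p q) = z (chart p q).
Proof.
move=> pq; rewrite (vrepE _ pq) /lift_field -mulmxA trans_jacV ?mulmx1//.
exact: dom_center.
Qed.

Lemma lift_vrep p X q : dom p q -> lift_field p (vrep p X) q = X q.
Proof.
move=> pq; rewrite /lift_field (vrepE _ pq) -mulmxA trans_jacV ?mulmx1//.
exact: dom_center.
Qed.

Lemma lift_smooth p z q : dom p q -> smooth_near z (chart p q) ->
  vfield_smooth_at q (lift_field p z).
Proof.
move=> pq sz; apply/(vfield_smoothP _ pq); apply: eq_smooth_near sz.
apply: filterS (near_chart pq) => x Ux.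
by have := vrep_lift z (dom_chartI Ux); rewrite chartIK.
Qed.

End Charts.

(** * Connections and their Christoffel forms *)

Section Connections.
Variables (R : realType) (m : nat) (M : smoothManifold R m).
Implicit Types (p q : M) (X Y Z : vfield M) (u v : 'rV[R]_m) (f : M -> R).

Lemma near_vfield_smooth p Y Z : (\forall q \near p, Y q = Z q) ->
  vfield_smooth_at p Y -> vfield_smooth_at p Z.
Proof.
move=> YZ; apply: eq_smooth_near.
by apply: filterS (near_chartI (dom_center p) YZ) => x E; rewrite /vrep E.
Qed.

Lemma vfield_smoothZ p f Y : fun_smooth_at p f -> vfield_smooth_at p Y ->
  vfield_smooth_at p (fun q => f q *: Y q).
Proof.
move=> sf sY.
apply: (@ext_smooth_near _ _ _ (fun x => (f \o chartI p) x *: vrep p Y x)).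
  by move=> x; rewrite /vrep scalemxAl.
exact: smooth_nearZ.
Qed.

Lemma vfield_smoothD p Y Z : vfield_smooth_at p Y -> vfield_smooth_at p Z ->
  vfield_smooth_at p (fun q => Y q + Z q).
Proof.
move=> sY sZ.
apply: (@ext_smooth_near _ _ _ (fun x => vrep p Y x + vrep p Z x)).
  by move=> x; rewrite /vrep mulmxDl.
exact: smooth_nearD.
Qed.

Lemma vfield_smooth0 p : vfield_smooth_at p (fun=> 0 : 'rV[R]_m).
Proof.
apply: (@ext_smooth_near _ _ _ (fun=> 0)); last exact: smooth_near_cst.
by move=> x; rewrite /vrep mul0mx.
Qed.

Lemma vfield_smooth_sum p I (s : seq I) (F : I -> vfield M) :
  (forall i, vfield_smooth_at p (F i)) ->
  vfield_smooth_at p (fun q => \sum_(i <- s) F i q).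
Proof.
move=> sF; elim: s => [|i s IH].
  by under eq_fun do rewrite big_nil; exact: vfield_smooth0.
by under eq_fun do rewrite big_cons; exact: vfield_smoothD.
Qed.

Lemma fun_smooth_cst p (c : R) : fun_smooth_at p (fun=> c).
Proof. exact: smooth_near_cst. Qed.

Lemma dfun_cst p (c : R) u : dfun p (fun=> c) u = 0.
Proof. exact: derive_cst. Qed.

Lemma near_dfun p f g u : (\forall q \near p, f q = g q) -> dfun p f u = dfun p g u.
Proof.
move=> fg; rewrite /dfun; apply: near_eq_derive.
exact: (near_chartI (dom_center p) fg).
Qed.

Lemma near_fun_smooth p f g : (\forall q \near p, f q = g q) ->
  fun_smooth_at p f -> fun_smooth_at p g.
Proof.
move=> fg; apply: eq_smooth_near; exact: (near_chartI (dom_center p) fg).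
Qed.

Variable D : connection M.
Hypothesis cD : is_connection D.

(* The cut-off function of the Leibniz rule only has to be smooth near p, so the indicator of a
   neighbourhood is enough. *)
Lemma conn_local p u Y Z : (\forall q \near p, Y q = Z q) ->
  vfield_smooth_at p Y -> D p u Y = D p u Z.
Proof.
move=> YZ sY; have sZ := near_vfield_smooth YZ sY.
pose f q : R := if `[< Y q = Z q >] then 1 else 0.
have f1 : \forall q \near p, 1 = f q.
  by apply: filterS YZ => q E; rewrite /f asboolT.
have sf : fun_smooth_at p f := near_fun_smooth f1 (fun_smooth_cst p 1).
have df : dfun p f u = 0 by rewrite -(near_dfun u f1) dfun_cst.
have fp : f p = 1 by rewrite -(nbhs_singleton f1).
have LY := conn_leibniz cD u sf sY; have LZ := conn_leibniz cD u sf sZ.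
move: LY LZ; rewrite df !scale0r !add0r fp !scale1r => <- <-.
congr (D p u _); apply/funext => q; rewrite /f.
by case: asboolP => [->//|_]; rewrite !scale0r.
Qed.

Lemma conn_zero p u : D p u (fun=> 0) = 0.
Proof.
have := conn_leibniz cD u (fun_smooth_cst p 0) (vfield_smooth0 p).
rewrite dfun_cst !scale0r addr0 => H; rewrite -[RHS]H.
by congr (D p u _); apply/funext => q; rewrite scaler0.
Qed.

Lemma conn_sum p u I (s : seq I) (f : I -> M -> R) (Y : I -> vfield M) :
  (forall i, fun_smooth_at p (f i)) -> (forall i, vfield_smooth_at p (Y i)) ->
  D p u (fun q => \sum_(i <- s) f i q *: Y i q) =
  \sum_(i <- s) (dfun p (f i) u *: Y i p + f i p *: D p u (Y i)).
Proof.
move=> sf sY; elim: s => [|i s IH].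
  by under eq_fun do rewrite big_nil; rewrite big_nil conn_zero.
under eq_fun do rewrite big_cons; rewrite big_cons -IH.
rewrite (conn_add cD).
- by rewrite (conn_leibniz cD).
- exact: vfield_smoothZ.
- by apply: vfield_smooth_sum => j; exact: vfield_smoothZ.
Qed.

Definition cst_field p v : vfield M := lift_field p (fun=> v).

Lemma cst_field_smooth p q v : dom p q -> vfield_smooth_at q (cst_field p v).
Proof. by move=> pq; apply: lift_smooth => //; exact: smooth_near_cst. Qed.

Lemma vrep_cst_field p q v : dom p q -> vrep p (cst_field p v) (chart p q) = v.
Proof. by move=> pq; rewrite /cst_field vrep_lift. Qed.

(** The connection form: row [k] of [christ p x v] holds the components, in the chart around [p], of
    the derivative along [v] of the [k]-th coordinate field. With vectors as rows,
    [D_u Y = dY(u) + Y Gamma(u)]. Sealed like [trans_jac]. *)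
Fact christ_sealed : {C : M -> 'rV[R]_m -> 'rV[R]_m -> 'M[R]_m | C = fun p x v =>
  let q := chartI p x in
  \matrix_k (D q (v *m trans_jac p q q) (cst_field p (delta_mx 0 k)) *m trans_jac q p q)}.
Proof. by eexists. Qed.

Definition christ : M -> 'rV[R]_m -> 'rV[R]_m -> 'M[R]_m := sval christ_sealed.

Lemma row_christ p q u k : dom p q ->
  row k (christ p (chart p q) u) =
  D q (u *m trans_jac p q q) (cst_field p (delta_mx 0 k)) *m trans_jac q p q.
Proof. by move=> pq; rewrite /christ (svalP christ_sealed) rowK (chartK pq). Qed.

Lemma christ_linear p x : (chart p @` dom p) x -> linear (christ p x).
Proof.
move=> [q pq <-] a u v; apply/row_matrixP => k.
rewrite [RHS]rowE mulmxDr -scalemxAr -!rowE !row_christ// mulmxDl -scalemxAl.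
rewrite (conn_linear cD); last exact: cst_field_smooth.
by rewrite mulmxDl -scalemxAl.
Qed.

Lemma fun_smooth_vrep p q Y i : dom p q -> vfield_smooth_at q Y ->
  fun_smooth_at q (fun r => vrep p Y (chart p r) 0 i).
Proof.
move=> pq /(vfield_smoothP Y pq)/smooth_near_mxP/(_ 0 i) sY.
apply/(fun_smoothP _ pq); apply: eq_smooth_near sY.
by apply: filterS (near_chart pq) => x Ux; rewrite /= chartIK.
Qed.

(** Near [q] the field is a combination of coordinate fields with smooth coefficients. Locality
    replaces [Y] by that combination, and the Leibniz rule separates the derivatives of the
    coefficients from the Christoffel term. *)
Lemma conn_rep p q u Y : dom p q -> vfield_smooth_at q Y ->
  D q u Y *m trans_jac q p q =
  'D_(u *m trans_jac q p q) (vrep p Y) (chart p q)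
  + vrep p Y (chart p q) *m christ p (chart p q) (u *m trans_jac q p q).
Proof.
move=> pq sY; have qq := dom_center q.
have sy := (vfield_smoothP Y pq).1 sY.
pose y i r := vrep p Y (chart p r) 0 i.
have YE : \forall r \near q, Y r = \sum_i y i r *: cst_field p (delta_mx 0 i) r.
  apply: filterS (near_dom pq) => r pr; rewrite -{1}(lift_vrep Y pr) /lift_field.
  rewrite [X in X *m _]row_sum_delta mulmx_suml; apply: eq_bigr => i _.
  by rewrite -scalemxAl.
rewrite (conn_local u YE sY) conn_sum; last first.
- by move=> i; exact: cst_field_smooth.
- by move=> i; exact: fun_smooth_vrep.
rewrite mulmx_suml.
rewrite [X in X *m christ _ _ _]row_sum_delta mulmx_suml.
rewrite (row_sum_delta ('D_(_) _ _)) -big_split/=; apply: eq_bigr => i _.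
rewrite mulmxDl -!scalemxAl; congr (_ *: _ + _ *: _).
- rewrite -derivable_mxij; last exact: smooth_near_derivable.
  have sf : smooth_near (y i \o chartI p : _ -> R) (chart p q).
    by apply/(fun_smoothP _ pq); exact: fun_smooth_vrep.
  rewrite (dfunE u pq sf); apply: near_eq_derive.
  by apply: filterS (near_chart pq) => x Ux; rewrite /y /= chartIK.
- by rewrite -vrepE// vrep_cst_field.
- by rewrite -rowE row_christ// -mulmxA trans_jacV// mulmx1.
Qed.

(** The rows are the components of covariant derivatives of coordinate fields, which [conn_smooth]
    makes smooth. *)
Lemma christ_smooth p q v : dom p q -> smooth_near (fun x => christ p x v) (chart p q).
Proof.
move=> pq; apply: smooth_near_rowsP => k.
have : vfield_smooth_at q (cov D (cst_field p v) (cst_field p (delta_mx 0 k))).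
  by apply: conn_smooth => //; exact: cst_field_smooth.
move=> /(vfield_smoothP _ pq); apply: eq_smooth_near.
apply: filterS (near_chart pq) => x Ux; have px := dom_chartI Ux.
by rewrite -(chartIK Ux) row_christ// vrepE.
Qed.

Lemma vrep_cov p q X Y : dom p q -> vfield_smooth_at q Y ->
  vrep p (cov D X Y) (chart p q) =
  'D_(vrep p X (chart p q)) (vrep p Y) (chart p q)
  + vrep p Y (chart p q) *m christ p (chart p q) (vrep p X (chart p q)).
Proof.
move=> pq sY; rewrite (vrepE (cov D X Y) pq) /cov (conn_rep _ pq sY).
by rewrite (vrepE X pq).
Qed.

Lemma conn_center p u Y : vfield_smooth_at p Y ->
  D p u Y = 'D_u (vrep p Y) (chart p p) + Y p *m christ p (chart p p) u.
Proof.
move=> sY; have pp := dom_center p; have := conn_rep u pp sY.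
by rewrite trans_jac1// !mulmx1 vrep_center.
Qed.

End Connections.

(** * Tensor fields and the Levi-Civita conditions in a chart *)

Section Tensors.
Variables (R : realType) (m : nat) (M : smoothManifold R m).
Implicit Types (p q : M) (X Y Z : vfield M) (u v : 'rV[R]_m).

Lemma smooth_near_rows_mul n k (A : 'rV[R]_n -> 'M[R]_(n, k)) x :
  (forall v : 'rV[R]_n, smooth_near (fun y => v *m A y) x) -> smooth_near A x.
Proof.
move=> sA; apply: smooth_near_rowsP => i; apply: ext_smooth_near (sA (delta_mx 0 i)).
by move=> y; rewrite rowE.
Qed.

(** Right multiplication by [trans_jac p q q] turns components in the chart around [p] into
    components in the preferred chart of [q], where the tensor is stored; [endo_rep] and [form_rep]
    follow the same pattern. *)
Definition bilin_rep (g : bilinfield M) p x : 'M[R]_m :=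
  let q := chartI p x in trans_jac p q q *m g q *m (trans_jac p q q)^T.

Definition endo_rep (A : endofield M) p x : 'M[R]_m :=
  let q := chartI p x in trans_jac p q q *m A q *m trans_jac q p q.

Definition form_rep (w : formfield M) p x : 'cV[R]_m :=
  let q := chartI p x in trans_jac p q q *m w q.

Lemma trans_jacKV p q (u : 'rV[R]_m) : dom p q ->
  u *m trans_jac q p q *m trans_jac p q q = u.
Proof. by move=> pq; rewrite -mulmxA trans_jacV ?mulmx1//; exact: dom_center. Qed.

Lemma trans_jacVK p q (u : 'rV[R]_m) : dom p q ->
  u *m trans_jac p q q *m trans_jac q p q = u.
Proof. by move=> pq; rewrite -mulmxA trans_jacV ?mulmx1//; exact: dom_center. Qed.

Lemma bilin_repE g p q u v : dom p q ->
  bilin (bilin_rep g p (chart p q)) u v =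
  bilin (g q) (u *m trans_jac p q q) (v *m trans_jac p q q).
Proof.
by move=> pq; rewrite /bilin_rep (chartK pq) /bilin trmx_mul !mulmxA.
Qed.

Lemma bilin_vrep g p q X Y : dom p q ->
  bilin (bilin_rep g p (chart p q)) (vrep p X (chart p q)) (vrep p Y (chart p q)) =
  bilin (g q) (X q) (Y q).
Proof.
move=> pq; rewrite bilin_repE// (vrepE X pq) (vrepE Y pq).
by rewrite !trans_jacKV.
Qed.

Lemma endo_repE A p q u : dom p q ->
  u *m endo_rep A p (chart p q) = u *m trans_jac p q q *m A q *m trans_jac q p q.
Proof. by move=> pq; rewrite /endo_rep (chartK pq) !mulmxA. Qed.

Lemma vrep_endo A p q X : dom p q ->
  vrep p (endo_app A X) (chart p q) = vrep p X (chart p q) *m endo_rep A p (chart p q).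
Proof.
move=> pq; rewrite (endo_repE A _ pq) (vrepE X pq) (vrepE (endo_app A X) pq).
by rewrite trans_jacKV.
Qed.

Lemma form_repE w p q u : dom p q ->
  covec (form_rep w p (chart p q)) u = covec (w q) (u *m trans_jac p q q).
Proof. by move=> pq; rewrite /form_rep (chartK pq) /covec mulmxA. Qed.

Lemma bilin_rep_center g p : bilin_rep g p (chart p p) = g p.
Proof.
have pp := dom_center p.
by rewrite /bilin_rep (chartK pp) (trans_jac1 pp) trmx1 mulmx1 mul1mx.
Qed.

Lemma endo_rep_center A p : endo_rep A p (chart p p) = A p.
Proof.
have pp := dom_center p.
by rewrite /endo_rep (chartK pp) (trans_jac1 pp) mulmx1 mul1mx.
Qed.

Lemma form_rep_center w p : form_rep w p (chart p p) = w p.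
Proof.
have pp := dom_center p.
by rewrite /form_rep (chartK pp) (trans_jac1 pp) mul1mx.
Qed.

Lemma bilin_delta (G : 'M[R]_m) i j : bilin G (delta_mx 0 i) (delta_mx 0 j) = G i j.
Proof. by rewrite /bilin -rowE trmx_delta -colE !mxE. Qed.

Lemma bilin_rep_entry g p x i j : (chart p @` dom p) x ->
  bilin_rep g p x i j = bilin (g (chartI p x)) (cst_field p (delta_mx 0 i) (chartI p x))
    (cst_field p (delta_mx 0 j) (chartI p x)).
Proof.
move=> Ux; have px := dom_chartI Ux.
by rewrite -[LHS]bilin_delta -[in LHS](chartIK Ux) bilin_repE.
Qed.

Lemma bilin_rep_smooth g p q : bilinfield_smooth g -> dom p q ->
  smooth_near (bilin_rep g p) (chart p q).
Proof.
move=> sg pq; apply/smooth_near_mxP => i j.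
have := sg q _ _ (cst_field_smooth (delta_mx 0 i) pq) (cst_field_smooth (delta_mx 0 j) pq).
move/(fun_smoothP _ pq); apply: eq_smooth_near; apply: filterS (near_chart pq) => x Ux.
by rewrite [RHS]bilin_rep_entry.
Qed.

Lemma endo_rep_smooth A p q : endofield_smooth A -> dom p q ->
  smooth_near (endo_rep A p) (chart p q).
Proof.
move=> sA pq; apply: smooth_near_rows_mul => v.
have := sA q _ (cst_field_smooth v pq).
move=> /(vfield_smoothP _ pq); apply: eq_smooth_near.
apply: filterS (near_chart pq) => x Ux; have px := dom_chartI Ux.
by rewrite -(chartIK Ux) vrep_endo// vrep_cst_field.
Qed.

Lemma form_rep_smooth w p q : formfield_smooth w -> dom p q ->
  smooth_near (form_rep w p) (chart p q).
Proof.
move=> sw pq; apply/smooth_near_mxP => i j.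
have := sw q _ (cst_field_smooth (delta_mx 0 i) pq).
move/(fun_smoothP _ pq); apply: eq_smooth_near; apply: filterS (near_chart pq) => x Ux.
have px := dom_chartI Ux; rewrite /= -form_repE// chartIK// /covec -rowE !mxE.
by rewrite (ord1 j).
Qed.

Variable D : connection M.
Hypothesis cD : is_connection D.

(** Coordinate form of [D_u A] for the connection form [Gam] at [x]. The order of the factors comes
    from [Y (D_u A) = D_u (Y A) - (D_u Y) A] with [Y] a row. *)
Definition endo_cov (Gam : 'rV[R]_m -> 'M[R]_m) (A : 'rV[R]_m -> 'M[R]_m) x u :=
  'D_u A x + A x *m Gam u - Gam u *m A x.

Lemma cov_endo_rep A p q u Y : endofield_smooth A -> dom p q -> vfield_smooth_at q Y ->
  cov_endo D A q u Y *m trans_jac q p q =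
  vrep p Y (chart p q) *m endo_cov (christ D p (chart p q)) (endo_rep A p) (chart p q)
                            (u *m trans_jac q p q).
Proof.
move=> sA pq sY; rewrite /cov_endo mulmxBl (conn_rep cD u pq (sA _ _ sY)).
set x := chart p q; set u' := u *m _.
have DY : D q u Y *m A q *m trans_jac q p q =
   D q u Y *m trans_jac q p q *m endo_rep A p x.
  by rewrite endo_repE// trans_jacKV.
rewrite DY (conn_rep cD u pq sY) -/u' -/x.
have -> : 'D_u' (vrep p (endo_app A Y)) x = 'D_u' (fun y => vrep p Y y *m endo_rep A p y) x.
  apply: near_eq_derive; apply: filterS (near_chart pq) => y Uy.
  by rewrite -(chartIK Uy) vrep_endo//; exact: dom_chartI.
rewrite derive_mulmx; last first.
- exact: smooth_near_derivable (endo_rep_smooth sA pq).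
- exact: smooth_near_derivable ((vfield_smoothP Y pq).1 sY).
rewrite vrep_endo// -/x /endo_cov mulmxBr mulmxDr mulmxDl !mulmxA.
by rewrite -[X in X - _ = _]addrA [X in X - _ = _]addrC addrKA.
Qed.

Variable g : bilinfield M.
Hypothesis lc : levi_civita g D.
Hypothesis sg : bilinfield_smooth g.

(** Metric compatibility for two coordinate fields: their components are constant in the chart, so
    the left side differentiates the Gram entry alone. *)
Lemma christ_metric p q u : dom p q ->
  'D_u (bilin_rep g p) (chart p q) =
  christ D p (chart p q) u *m bilin_rep g p (chart p q)
  + bilin_rep g p (chart p q) *m (christ D p (chart p q) u)^T.
Proof.
move=> pq; set x := chart p q; set G := bilin_rep g p.
have sG : smooth_near G x := bilin_rep_smooth sg pq.
apply/matrixP => i j; rewrite -derivable_mxij; last exact: smooth_near_derivable.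
have si : vfield_smooth_at q (cst_field p (delta_mx 0 i)) by exact: cst_field_smooth.
have sj : vfield_smooth_at q (cst_field p (delta_mx 0 j)) by exact: cst_field_smooth.
have := lc_metric lc (u *m trans_jac p q q) si sj.
have sf := (fun_smoothP _ pq).1 (sg si sj).
rewrite (dfunE _ pq sf) trans_jacVK// => E.
transitivity ('D_u ((fun r => bilin (g r) (cst_field p (delta_mx 0 i) r)
  (cst_field p (delta_mx 0 j) r)) \o chartI p : _ -> R) x).
  apply: near_eq_derive; apply: filterS (near_chart pq) => y Uy.
  exact: bilin_rep_entry.
rewrite {}E.
have DE k : D q (u *m trans_jac p q q) (cst_field p (delta_mx 0 k)) =
    row k (christ D p x u) *m trans_jac p q q.
  by rewrite /x row_christ// trans_jacKV.
rewrite !{}DE /cst_field /lift_field -!bilin_repE// -/x -/G mxE; congr (_ + _).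
  by rewrite /bilin trmx_delta -colE -row_mul !mxE.
by rewrite /bilin tr_row -rowE !mxE; apply: eq_bigr => k _; rewrite !mxE.
Qed.

(** [lie_bracket] is computed in the preferred chart of [q], where the coordinate fields of another
    chart have varying components. Their derivatives are second derivatives of the transition
    map. *)
Lemma derive_vrep_cst_field p q u v : dom p q ->
  'D_(u *m trans_jac p q q) (vrep q (cst_field p v)) (chart q q) =
  'D_u (fun x => 'D_v (chart q \o chartI p) x) (chart p q).
Proof.
move=> pq; have qq := dom_center q; have sT := smooth_near_transition pq qq.
have sS := smooth_near_transition qq pq.
have sDT := smooth_near_derive v sT.
have SE : (chart p \o chartI q) (chart q q) = chart p q by rewrite /= chartK.
transitivity ('D_(u *m trans_jac p q q)
    (fun y => (fun x => 'D_v (chart q \o chartI p) x) ((chart p \o chartI q) y)) (chart q q)).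
  apply: near_eq_derive; have H1 := near_chart qq; have H2 := near_chartI qq (near_dom pq).
  apply: filterS2 H1 H2 => y Uy py; have qy := dom_chartI Uy.
  have dT := smooth_near_differentiable (smooth_near_transition py qy).
  rewrite [RHS](deriveEjacobian v dT).
  rewrite -[in LHS](chartIK Uy) (vrepE _ qy) /cst_field /lift_field -mulmxA.
  by rewrite (trans_jacM py (dom_center _) qy) trans_jacE.
rewrite [LHS](@derive_comp _ _ _ _ (fun x => 'D_v (chart q \o chartI p) x)
  (chart p \o chartI q)).
- rewrite SE (deriveEjacobian _ (smooth_near_differentiable sS)).
  by rewrite -trans_jacE trans_jacVK.
- exact: smooth_near_differentiable sS.
- by rewrite SE; exact: smooth_near_differentiable sDT.
Qed.

(** Vanishing torsion on two coordinate fields, which commute because second derivatives of the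
    transition map are symmetric. *)
Lemma christ_sym p q u v : dom p q ->
  v *m christ D p (chart p q) u = u *m christ D p (chart p q) v.
Proof.
move=> pq; set x := chart p q; have qq := dom_center q.
have su := cst_field_smooth u pq; have sv := cst_field_smooth v pq.
have cE w w' : cov D (cst_field p w) (cst_field p w') q *m trans_jac q p q =
    w' *m christ D p x w.
  rewrite /cov (conn_rep cD _ pq (cst_field_smooth w' pq)) -(vrepE (cst_field p w) pq).
  rewrite !vrep_cst_field// -/x; set V := vrep p (cst_field p w').
  have -> : 'D_w V x = 'D_w (fun=> w') x.
    apply: near_eq_derive; apply: filterS (near_chart pq) => y Uy.
    by rewrite -(chartIK Uy); apply: vrep_cst_field; exact: dom_chartI.
  by rewrite derive_cst add0r.
have tf := lc_torsion_free lc su sv.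
rewrite -!cE; apply/eqP; rewrite -subr_eq0 -mulmxBl tf /lie_bracket.
have E w : cst_field p w q = w *m trans_jac p q q by [].
rewrite (E u) (E v) !derive_vrep_cst_field//.
rewrite (schwarz _ _ (smooth_near_transition pq qq)) subrr mul0mx//.
Qed.

End Tensors.

(** * Bilinear forms and covectors as matrices *)

Section Bilin.
Variables (R : realType) (m : nat).
Implicit Types (G : 'M[R]_m) (u v w : 'rV[R]_m) (a : R).

Lemma bilinDl G u v w : bilin G (u + v) w = bilin G u w + bilin G v w.
Proof. by rewrite /bilin !mulmxDl mxE. Qed.
Lemma bilinDr G u v w : bilin G w (u + v) = bilin G w u + bilin G w v.
Proof. by rewrite /bilin linearD mulmxDr mxE. Qed.
Lemma bilinZl G a u w : bilin G (a *: u) w = a * bilin G u w.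
Proof. by rewrite /bilin -!scalemxAl mxE. Qed.
Lemma bilinZr G a u w : bilin G w (a *: u) = a * bilin G w u.
Proof. by rewrite /bilin linearZ -!scalemxAr mxE. Qed.
Lemma bilinNl G u w : bilin G (- u) w = - bilin G u w.
Proof. by rewrite -scaleN1r bilinZl mulN1r. Qed.
Lemma bilinNr G u w : bilin G w (- u) = - bilin G w u.
Proof. by rewrite -scaleN1r bilinZr mulN1r. Qed.
Lemma bilin0l G w : bilin G 0 w = 0.
Proof. by rewrite -(scale0r 0) bilinZl mul0r. Qed.
Lemma bilin0r G w : bilin G w 0 = 0.
Proof. by rewrite -(scale0r 0) bilinZr mul0r. Qed.
Lemma bilin_mulmxl G (A : 'M[R]_m) u v : bilin G (u *m A) v = bilin (A *m G) u v.
Proof. by rewrite /bilin !mulmxA. Qed.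
Lemma bilin_mulmxr G (A : 'M[R]_m) u v : bilin G u (v *m A) = bilin (G *m A^T) u v.
Proof. by rewrite /bilin trmx_mul !mulmxA. Qed.

Lemma bilin_tr G u v : bilin G u v = bilin G^T v u.
Proof.
transitivity ((u *m G *m v^T)^T 0 0); first by rewrite [RHS]mxE.
by rewrite !trmx_mul trmxK mulmxA.
Qed.

Lemma bilin_inj G G' : (forall u v, bilin G u v = bilin G' u v) -> G = G'.
Proof. by move=> E; apply/matrixP => i j; rewrite -!bilin_delta. Qed.

Lemma covecD (w : 'cV[R]_m) u v : covec w (u + v) = covec w u + covec w v.
Proof. by rewrite /covec mulmxDl mxE. Qed.
Lemma covecZ (w : 'cV[R]_m) a u : covec w (a *: u) = a * covec w u.
Proof. by rewrite /covec -scalemxAl mxE. Qed.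
Lemma covecN (w : 'cV[R]_m) u : covec w (- u) = - covec w u.
Proof. by rewrite /covec mulNmx mxE. Qed.

Lemma signature_unit k l G : has_signature k l G -> G \in unitmx.
Proof.
move=> [_ [P uP PG]].
suff : P *m G *m P^T \in unitmx by rewrite !unitmx_mul uP /= => /andP[].
rewrite PG unitmxE det_diag unitfE; apply/prodf_neq0 => i _; rewrite mxE.
by case: ifP => _; rewrite ?oppr_eq0 oner_eq0.
Qed.

Lemma bilin_nondeg G u : G \in unitmx -> (forall v, bilin G u v = 0) -> u = 0.
Proof.
move=> uG H; apply: (can_inj (mulmxK uG)); rewrite mul0mx.
apply/rowP => i; rewrite mxE.
by have := H (delta_mx 0 i); rewrite /bilin trmx_delta -colE !mxE.
Qed.

Lemma bilin_nondegr G u v : G \in unitmx -> (forall w, bilin G u w = bilin G v w) -> u = v.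
Proof.
move=> uG H; apply/eqP; rewrite -subr_eq0; apply/eqP/(bilin_nondeg uG) => w.
by rewrite bilinDl bilinNl H subrr.
Qed.

End Bilin.

(** * Sasaki-like structures *)

Section ACCR.
Variables (R : realType) (n : nat) (M : smoothManifold R n.*2.+1).
Variables (phi : endofield M) (xi : vfield M) (eta : formfield M) (g : bilinfield M).
Hypothesis acr : almost_contact_complex_riemannian phi xi eta g.
Local Notation m := n.*2.+1.
Implicit Types (p q : M) (u v w : 'rV[R]_m).

Lemma acr_g_smooth : bilinfield_smooth g.
Proof. by have [] := acr_metric acr. Qed.

Lemma acr_g_sym p u v : bilin (g p) u v = bilin (g p) v u.
Proof. by have [_ ? _] := acr_metric acr. Qed.

Lemma acr_g_tr p : (g p)^T = g p.
Proof. by apply: bilin_inj => u v; rewrite -bilin_tr acr_g_sym. Qed.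

Lemma acr_g_unit p : g p \in unitmx.
Proof. by have [_ _ /(_ p)/signature_unit] := acr_metric acr. Qed.

(** The compatibility of [g] and [phi] with [xi] as second argument, where its left side vanishes.
    In particular [g(xi, xi) = 1]. *)
Lemma acr_eta_g p u : covec (eta p) u = bilin (g p) u (xi p).
Proof.
have := acr_g_phi acr p u (xi p).
rewrite (acr_phi_xi acr) bilin0r (acr_eta_xi acr) mulr1 addrC => /eqP.
by rewrite eq_sym subr_eq0 => /eqP.
Qed.

(** The compatibility of [g] and [phi] with [phi v] as second argument; [phi (phi v) = - v] up to a
    multiple of [xi], to which [phi u] is orthogonal. *)
Lemma acr_phi_sym p u v : bilin (g p) (u *m phi p) v = bilin (g p) u (v *m phi p).
Proof.
have := acr_g_phi acr p u (v *m phi p).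
rewrite (acr_eta_phi acr) mulr0 addr0 (acr_phi2 acr) bilinDr bilinNr bilinZr.
rewrite -acr_eta_g (acr_eta_phi acr) mulr0 addr0.
exact: oppr_inj.
Qed.

Definition horiz p u := u - covec (eta p) u *: xi p.

Lemma horiz_ker p u : covec (eta p) (horiz p u) = 0.
Proof. by rewrite /horiz covecD covecN covecZ (acr_eta_xi acr) mulr1 subrr. Qed.

Lemma horizE p u : u = horiz p u + covec (eta p) u *: xi p.
Proof. by rewrite subrK. Qed.

Lemma horiz_id p u : covec (eta p) u = 0 -> horiz p u = u.
Proof. by rewrite /horiz => ->; rewrite scale0r subr0. Qed.

(** [sasaki_like] quantifies over local sections of [ker eta]. Projecting a constant-component field
    along [xi] extends a given horizontal vector to such a section, which makes the conditions
    pointwise. *)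
Definition hfield p v : vfield M := fun q => horiz q (cst_field p v q).

Lemma hfield_section p v : section_at (ker_form eta) p (hfield p v).
Proof.
have sv := cst_field_smooth v (dom_center p); split; last first.
  by near=> q; exact: horiz_ker.
have sf : fun_smooth_at p (fun q => -1 * covec (eta q) (cst_field p v q)).
  apply: smooth_nearM; first exact: smooth_near_cst.
  exact: (acr_eta_smooth acr).
have := vfield_smoothD sv (vfield_smoothZ sf (acr_xi_smooth acr p)).
apply: ext_smooth_near => x; rewrite /vrep /hfield /horiz.
by rewrite mulN1r scaleNr.
Unshelve. all: by end_near. Qed.

Lemma hfieldE p v : covec (eta p) v = 0 -> hfield p v p = v.
Proof.
move=> v0; rewrite /hfield.
have -> : cst_field p v p = v.
  by rewrite /cst_field /lift_field trans_jac1 ?mulmx1//; exact: dom_center.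
exact: horiz_id.
Qed.

Variable D : connection M.
Hypothesis lc : levi_civita g D.
Let cD := lc_connection lc.

Definition nabla_phi p u : 'M[R]_m :=
  endo_cov (christ D p (chart p p)) (endo_rep phi p) (chart p p) u.

Lemma cov_endo_center p u Y : vfield_smooth_at p Y ->
  cov_endo D phi p u Y = Y p *m nabla_phi p u.
Proof.
move=> sY; have pp := dom_center p.
have := cov_endo_rep cD u (acr_phi_smooth acr) pp sY.
by rewrite (trans_jac1 pp) !mulmx1 vrep_center.
Qed.

Lemma christ_linear_center p a u v :
  christ D p (chart p p) (a *: u + v) = a *: christ D p (chart p p) u + christ D p (chart p p) v.
Proof. by apply: christ_linear => //; exists p => //; exact: dom_center. Qed.

Lemma nabla_phi_linear p a u v : nabla_phi p (a *: u + v) = a *: nabla_phi p u + nabla_phi p v.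
Proof.
have sp := smooth_near_differentiable (endo_rep_smooth (acr_phi_smooth acr) (dom_center p)).
rewrite /nabla_phi /endo_cov christ_linear_center (derive_lin sp).
rewrite mulmxDr mulmxDl -scalemxAr -scalemxAl.
by rewrite addrACA opprD [LHS]addrACA -scalerDr -scalerBr.
Qed.

Section SasakiPointwise.
Hypothesis sas : sasaki_like phi xi eta g D.

Lemma sasaki_center p u v w :
  covec (eta p) u = 0 -> covec (eta p) v = 0 -> covec (eta p) w = 0 ->
  [/\ bilin (g p) (v *m nabla_phi p u) w = 0,
      bilin (g p) (v *m nabla_phi p (xi p)) w = 0,
      bilin (g p) (xi p *m nabla_phi p (xi p)) w = 0
    & bilin (g p) (v *m nabla_phi p u) (xi p) = - bilin (g p) u v].
Proof.
move=> u0 v0 w0; have Hu := hfield_section p u.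
have Hv := hfield_section p v; have Hw := hfield_section p w.
have sx := acr_xi_smooth acr p.
have [] := sas Hu Hv Hw; rewrite /Ftensor !hfieldE//.
rewrite !(cov_endo_center _ (proj1 Hv)) !(cov_endo_center _ sx) !hfieldE//.
Qed.

(** [D phi] inherits the [g]-symmetry of [phi] because [D g = 0]. In matrices, [S = phi G] is
    symmetric near the point, hence so is its derivative, and the Christoffel terms match by metric
    compatibility. *)
Lemma nabla_phi_sym p u v w :
  bilin (g p) (v *m nabla_phi p u) w = bilin (g p) (w *m nabla_phi p u) v.
Proof.
have pp := dom_center p; set x := chart p p.
pose S y := endo_rep phi p y *m bilin_rep g p y.
have sA := endo_rep_smooth (acr_phi_smooth acr) pp.
have sG := bilin_rep_smooth acr_g_smooth pp.
have GE : bilin_rep g p x = g p by exact: bilin_rep_center.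
have trS : \forall y \near x, (S y)^T = S y.
  apply: filterS (near_chart pp) => y Uy; have py := dom_chartI Uy.
  apply: bilin_inj => a b; rewrite -bilin_tr /S -!(bilin_mulmxl (bilin_rep g p y)) -(chartIK Uy).
  rewrite !bilin_repE// !endo_repE// !trans_jacKV//.
  by rewrite acr_phi_sym acr_g_sym.
have trDS : ('D_u S x)^T = 'D_u S x.
  rewrite -derive_trmx; last exact: smooth_near_derivable (smooth_near_mulmx sA sG).
  exact: near_eq_derive.
have DS : 'D_u S x = 'D_u (endo_rep phi p) x *m g p + phi p *m
   (christ D p x u *m g p + g p *m (christ D p x u)^T).
  rewrite /S derive_mulmx; [|exact: smooth_near_derivable..].
  by rewrite (christ_metric lc acr_g_smooth _ pp) -/x GE -(endo_rep_center phi p).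
have phiG : (phi p *m g p)^T = phi p *m g p.
  have := nbhs_singleton trS; rewrite /S GE.
  by rewrite (endo_rep_center phi p).
have NG : nabla_phi p u *m g p = 'D_u S x - phi p *m g p *m (christ D p x u)^T
      - christ D p x u *m phi p *m g p.
  rewrite /nabla_phi -/x /endo_cov (endo_rep_center phi p) mulmxBl mulmxDl DS.
  by rewrite mulmxDr !mulmxA; congr (_ - _); rewrite addrA addrK.
rewrite !bilin_mulmxl [LHS]bilin_tr; congr (bilin _ w v).
rewrite NG !linearB/= trDS; rewrite !trmx_mul trmxK acr_g_tr.
rewrite trmx_mul acr_g_tr in phiG.
by rewrite phiG (mulmxA (g p)) phiG addrAC !mulmxA.
Qed.

(** [g(xi, xi) = 1] has zero derivative. *)
Lemma cov_xi_eta p u : covec (eta p) (D p u xi) = 0.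
Proof.
have sx := acr_xi_smooth acr p.
have := lc_metric lc u sx sx.
have -> : (fun q => bilin (g q) (xi q) (xi q)) = (fun=> 1).
  by apply/funext => q; rewrite -acr_eta_g (acr_eta_xi acr).
rewrite dfun_cst [X in _ + X]acr_g_sym -acr_eta_g => /eqP.
by rewrite eq_sym -mulr2n mulrn_eq0/= => /eqP.
Qed.

Lemma xi_nabla_phi p u : xi p *m nabla_phi p u = - (D p u xi *m phi p).
Proof.
have sx := acr_xi_smooth acr p.
rewrite -(cov_endo_center u sx) /cov_endo.
have -> : endo_app phi xi = (fun=> 0) by apply/funext => q; exact: acr_phi_xi acr q.
by rewrite (conn_zero cD) sub0r.
Qed.

(** Tested against [w]. The [xi]-part of [w] drops out because [(D_u phi) xi = - phi (D_u xi)] is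
    horizontal; for the horizontal part, symmetry of [D_u phi] leads to [F(., ., xi)], and the
    [xi]-part of [u] is removed by [F(xi, xi, .) = 0]. *)
Lemma xi_nabla_phiE p u : xi p *m nabla_phi p u = - horiz p u.
Proof.
apply: (bilin_nondegr (acr_g_unit p)) => w.
have u0 := horiz_ker p u; have w0 := horiz_ker p w.
have [_ _ E3 E4] := sasaki_center u0 w0 w0.
rewrite {1}(horizE p w) bilinDr bilinZr -acr_eta_g xi_nabla_phi covecN.
rewrite (acr_eta_phi acr) oppr0 mulr0 addr0 -xi_nabla_phi nabla_phi_sym.
rewrite {1}(horizE p u) addrC nabla_phi_linear mulmxDr -scalemxAr bilinDl bilinZl.
rewrite (nabla_phi_sym p (xi p)) E3 mulr0 add0r E4.
rewrite bilinNl; congr (- _).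
by rewrite [w in RHS](horizE p w) bilinDr bilinZr -acr_eta_g horiz_ker mulr0 addr0.
Qed.

(** [phi] applied to [phi (D_u xi) = horiz u]; since [D_u xi] is horizontal, [phi^2] acts on it as
    [- Id]. *)
Lemma cov_xi p u : D p u xi = - (u *m phi p).
Proof.
have H : D p u xi *m phi p = horiz p u.
  by apply: oppr_inj; rewrite -xi_nabla_phi xi_nabla_phiE.
have := acr_phi2 acr p (D p u xi).
rewrite cov_xi_eta scale0r addr0 H /horiz mulmxBl -scalemxAl (acr_phi_xi acr).
by rewrite scaler0 subr0 => ->; rewrite opprK.
Qed.

(** [F] vanishes on horizontal [v] and [w], so only the component along [xi] survives, and
    [F(u, v, xi)] gives it. *)
Lemma nabla_phi_horiz p u v : covec (eta p) v = 0 ->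
  v *m nabla_phi p u = - bilin (g p) u v *: xi p.
Proof.
move=> v0; apply: (bilin_nondegr (acr_g_unit p)) => w.
have u0 := horiz_ker p u; have w0 := horiz_ker p w.
have [E1 E2 _ E4] := sasaki_center u0 v0 w0; have [_ _ E3 _] := sasaki_center u0 v0 v0.
rewrite {1}(horizE p w) bilinDr bilinZr {1 2}(horizE p u) addrC.
rewrite [_ + covec _ _ *: xi p]addrC nabla_phi_linear mulmxDr -scalemxAr !bilinDl !bilinZl.
rewrite E1 E2 E4 (nabla_phi_sym p (xi p)) E3.
rewrite !(mulr0, addr0, add0r) (acr_g_sym _ (xi p)) -acr_eta_g.
have -> : bilin (g p) u v = bilin (g p) (horiz p u) v.
  rewrite {1}(horizE p u) bilinDl bilinZl (acr_g_sym _ (xi p)) -acr_eta_g v0.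
  by rewrite mulr0 addr0.
by rewrite mulrC.
Qed.

(** Splits [v] along [xi]. Of the two copies of [eta(u) eta(v)], one comes from [g(u, horiz v)] and
    the other from [horiz u]. *)
Lemma nabla_phiE p u v : v *m nabla_phi p u =
  (2 * covec (eta p) u * covec (eta p) v - bilin (g p) u v) *: xi p
  - covec (eta p) v *: u.
Proof.
rewrite {1}(horizE p v) mulmxDl (nabla_phi_horiz _ (horiz_ker p v)) -scalemxAl.
rewrite xi_nabla_phiE /horiz bilinDr bilinNr bilinZr -acr_eta_g.
rewrite scalerN scalerBr [X in _ + X]opprB scalerA addrA -scalerDl; congr (_ *: _ - _).
ring.
Qed.

End SasakiPointwise.

End ACCR.

(* Linear identities between sums of matrices, products being treated as atoms. *)
Ltac mx_lin :=
  repeat match goal with |- context [@mulmx ?R ?a ?b ?c ?x ?y] =>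
    let t := fresh "t" in move: (@mulmx R a b c x y) => t end;
  let i := fresh "i" in let j := fresh "j" in
  apply/matrixP => i j; rewrite !mxE;
  repeat match goal with |- context [@fun_of_matrix ?R ?a ?b ?x i j] =>
    let t := fresh "t" in move: (@fun_of_matrix R a b x i j) => t end;
  ring.

(** * Curvature of a connection form in coordinates *)

Section CoordCurvature.
Variables (R : realType) (m : nat).
Implicit Types (u v w x : 'rV[R]_m).

Lemma linear_rowE (U : lmodType R) (L : 'rV[R]_m -> U) v : linear L ->
  L v = \sum_i v 0 i *: L (delta_mx 0 i).
Proof.
move=> linL; pose L' := HB.pack_for {linear 'rV[R]_m -> U} L (GRing.isLinear.Build _ _ _ _ _ linL).
rewrite -[L]/(L' : _ -> _) {1}(row_sum_delta v) linear_sum.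
by apply: eq_bigr => i _; rewrite linearZ.
Qed.

(** Meant for a Christoffel form evaluated on a moving vector: linearity reduces it to the fixed
    basis vectors, for which smoothness is known. *)
Lemma smooth_near_linfam (V : normedModType R) k l (L : V -> 'rV[R]_m -> 'M[R]_(k, l)) y (x : V) :
  (\forall z \near x, linear (L z)) -> (forall v, smooth_near (fun z => L z v) x) ->
  smooth_near y x -> smooth_near (fun z => L z (y z)) x.
Proof.
move=> linL sL sy.
apply: (@eq_smooth_near _ _ _ (fun z => \sum_i y z 0 i *: L z (delta_mx 0 i))).
  by apply: filterS linL => z Lz; rewrite -(linear_rowE _ Lz).
apply: smooth_near_sum => i; apply: smooth_nearZ => //.
by move/smooth_near_mxP : sy.
Qed.

Lemma derive_linfam (V : normedModType R) k l (L : V -> 'rV[R]_m -> 'M[R]_(k, l)) y (x u : V) :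
  (\forall z \near x, linear (L z)) -> (forall v, smooth_near (fun z => L z v) x) ->
  smooth_near y x ->
  'D_u (fun z => L z (y z)) x = L x ('D_u y x) + 'D_u (fun z => L z (y x)) x.
Proof.
move=> linL sL sy; have linLx := nbhs_singleton linL.
have E (a : V -> 'rV[R]_m) : smooth_near a x -> 'D_u (fun z => L z (a z)) x =
   \sum_i (('D_u a x) 0 i *: L x (delta_mx 0 i) + a x 0 i *: 'D_u (fun z => L z (delta_mx 0 i)) x).
  move=> sa.
  (* The coefficients become scalar matrices, so that the product rule for [mulmx] applies. *)
  transitivity ('D_u (fun z => \sum_i (a z 0 i)%:M *m L z (delta_mx 0 i)) x).
    apply: near_eq_derive; apply: filterS linL => z Lz.
    by rewrite (linear_rowE _ Lz); apply: eq_bigr => i _; rewrite mul_scalar_mx.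
  have [|_ ->] := @is_derive_sum_fin _ _ _ _ (index_enum 'I_m)
     (fun i z => (a z 0 i)%:M *m L z (delta_mx 0 i)) x u (fun i =>
    ('D_u a x) 0 i *: L x (delta_mx 0 i) + a x 0 i *: 'D_u (fun z => L z (delta_mx 0 i)) x) => //.
  move=> i; have sai : smooth_near (fun z => a z 0 i) x by move/smooth_near_mxP : sa.
  have smi : derivable (fun z => (a z 0 i)%:M : 'M[R]_k) x u.
    exact: smooth_near_derivable (smooth_near_scalarmx k sai).
  have [d1 d2] := is_derive_mulmx smi (smooth_near_derivable (sL (delta_mx 0 i))).
  apply: DeriveDef; first exact: d1.
  rewrite [LHS]d2 mul_scalar_mx; congr (_ + _).
  suff -> : 'D_u (fun z => (a z 0 i)%:M : 'M[R]_k) x = (('D_u a x) 0 i)%:M by rewrite mul_scalar_mx.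
  apply/matrixP => r s; rewrite -derivable_mxij// mxE.
  under eq_fun do rewrite mxE.
  case: (r == s); last by rewrite !mulr0n; exact: derive_cst.
  by rewrite !mulr1n derivable_mxij//; exact: smooth_near_derivable.
rewrite (E y sy) (E (fun=> y x) (smooth_near_cst _ _)) (linear_rowE _ linLx) -big_split/=.
by apply: eq_bigr => i _; rewrite derive_cst mxE scale0r add0r.
Qed.

(** [d Gamma + Gamma /\ Gamma] evaluated on [u] and [v]. It acts on rows from the right, whence the
    reversed order of the products. *)
Definition coord_curv (Gam : 'rV[R]_m -> 'rV[R]_m -> 'M[R]_m) x u v : 'M[R]_m :=
  'D_u (fun z => Gam z v) x - 'D_v (fun z => Gam z u) x
  + Gam x v *m Gam x u - Gam x u *m Gam x v.

(** Second derivatives of [Z] cancel by the symmetry of second derivatives, mixed terms with one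
    derivative of [Z] cancel in pairs, and derivatives of [X] and [Y] occur only through the bracket
    [b]. *)
Lemma coord_curvE (Gam : 'rV[R]_m -> 'rV[R]_m -> 'M[R]_m) (X Y Z : 'rV[R]_m -> 'rV[R]_m) x :
  (\forall z \near x, linear (Gam z)) -> (forall v, smooth_near (fun z => Gam z v) x) ->
  smooth_near X x -> smooth_near Y x -> smooth_near Z x ->
  let nab V W z := 'D_(V z) W z + W z *m Gam z (V z) in
  let b := 'D_(X x) Y x - 'D_(Y x) X x in
  nab X (nab Y Z) x - nab Y (nab X Z) x - ('D_b Z x + Z x *m Gam x b)
  = Z x *m coord_curv Gam x (X x) (Y x).
Proof.
move=> linG sG sX sY sZ nab b.
have dZ := smooth_near_differentiable sZ.
have H V W : smooth_near V x -> smooth_near W x -> nab V (nab W Z) x =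
   'D_('D_(V x) W x) Z x + 'D_(V x) (fun z => 'D_(W x) Z z) x
   + ('D_(V x) Z x *m Gam x (W x) + Z x *m Gam x ('D_(V x) W x)
      + Z x *m 'D_(V x) (fun z => Gam z (W x)) x)
   + ('D_(W x) Z x *m Gam x (V x) + Z x *m Gam x (W x) *m Gam x (V x)).
  move=> sV sW; rewrite {1}/nab mulmxDl; congr (_ + _).
  have s1 : smooth_near (fun z => 'D_(W z) Z z) x by exact: smooth_near_derive_dir.
  have sG' : smooth_near (fun z => Gam z (W z)) x by exact: smooth_near_linfam.
  have s2 : smooth_near (fun z => Z z *m Gam z (W z)) x by exact: smooth_near_mulmx.
  rewrite [LHS](deriveD (smooth_near_derivable s1) (smooth_near_derivable s2)).
  congr (_ + _).
    apply: (@derive_linfam _ _ _ (fun z w => 'D_w Z z) W x (V x)) sW.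
      apply: filterS (smooth_near_near sZ) => z sz.
      exact: derive_lin (smooth_near_differentiable sz).
    by move=> v; exact: smooth_near_derive.
  rewrite [LHS](derive_mulmx (smooth_near_derivable sZ) (smooth_near_derivable sG')).
  by rewrite (derive_linfam _ linG sG sW) mulmxDr addrA.
rewrite (H _ _ sX sY) (H _ _ sY sX).
rewrite (schwarz (Y x) (X x) sZ).
have -> : 'D_b Z x = 'D_('D_(X x) Y x) Z x - 'D_('D_(Y x) X x) Z x.
  have linD : forall a u v, 'D_(a *: u + v) Z x = a *: 'D_u Z x + 'D_v Z x.
    exact: derive_lin dZ.
  by rewrite /b addrC -scaleN1r linD scaleN1r addrC.
have -> : Gam x b = Gam x ('D_(X x) Y x) - Gam x ('D_(Y x) X x).
  have linGx := nbhs_singleton linG.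
  by rewrite /b addrC -scaleN1r linGx scaleN1r addrC.
rewrite /coord_curv !mulmxDr !mulmxN !mulmxA.
move: ('D_('D_(X x) Y x) Z x) ('D_('D_(Y x) X x) Z x) ('D_(Y x) _ x) => d1 d2 d3.
mx_lin.
Qed.

(** The symmetry of the Christoffel form holds on a neighbourhood, so its derivatives have it too;
    all terms of the cyclic sum then cancel. *)
Lemma coord_bianchi (Gam : 'rV[R]_m -> 'rV[R]_m -> 'M[R]_m) x u v w :
  (forall v, smooth_near (fun z => Gam z v) x) ->
  (\forall z \near x, forall u v, v *m Gam z u = u *m Gam z v) ->
  w *m coord_curv Gam x u v + u *m coord_curv Gam x v w + v *m coord_curv Gam x w u = 0.
Proof.
move=> sG symG; have symGx := nbhs_singleton symG.
have H a b c : a *m 'D_c (fun z => Gam z b) x = b *m 'D_c (fun z => Gam z a) x.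
  rewrite -!derive_mulmxl; [|exact: smooth_near_derivable..].
  by apply: near_eq_derive; apply: filterS symG => z.
rewrite /coord_curv !mulmxDr !mulmxN !mulmxA.
rewrite (H w v u) (H w u v) (H u v w) (symGx v w) (symGx u w) (symGx u v).
mx_lin.
Qed.

(** The compatibility equation for [dG] is differentiated once more. Antisymmetrising the result in
    [u] and [v] kills the second derivatives of [G] and leaves the claim. *)
Lemma coord_curv_skew (Gam : 'rV[R]_m -> 'rV[R]_m -> 'M[R]_m) (G : 'rV[R]_m -> 'M[R]_m) x u v :
  (forall v, smooth_near (fun z => Gam z v) x) -> smooth_near G x ->
  (\forall z \near x, forall u, 'D_u G z = Gam z u *m G z + G z *m (Gam z u)^T) ->
  coord_curv Gam x u v *m G x + G x *m (coord_curv Gam x u v)^T = 0.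
Proof.
move=> sG sg comp; have compx := nbhs_singleton comp.
have H a b : 'D_a (fun z => 'D_b G z) x =
  'D_a (fun z => Gam z b) x *m G x + Gam x b *m (Gam x a *m G x + G x *m (Gam x a)^T)
  + ((Gam x a *m G x + G x *m (Gam x a)^T) *m (Gam x b)^T
     + G x *m ('D_a (fun z => Gam z b) x)^T).
  have sT : smooth_near (fun z => (Gam z b)^T) x by exact: smooth_near_trmx.
  transitivity ('D_a (fun z => Gam z b *m G z + G z *m (Gam z b)^T) x).
    by apply: near_eq_derive; apply: filterS comp => z; exact.
  have s1 := smooth_near_mulmx (sG b) sg; have s2 := smooth_near_mulmx sg sT.
  rewrite [LHS](deriveD (smooth_near_derivable s1) (smooth_near_derivable s2)).
  rewrite [X in X + _ = _](derive_mulmx (smooth_near_derivable (sG b)) (smooth_near_derivable sg)).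
  rewrite [X in _ + X = _](derive_mulmx (smooth_near_derivable sg) (smooth_near_derivable sT)).
  rewrite compx; congr (_ + (_ + _ *m _)).
  exact: derive_trmx (smooth_near_derivable (sG b)).
have /eqP := schwarz v u sg; rewrite -subr_eq0 !H => /eqP <-.
rewrite /coord_curv.
move: ('D_u _ x) ('D_v _ x) (Gam x u) (Gam x v) (G x) => A B C E G0.
have tD (P Q : 'M[R]_m) : (P + Q)^T = P^T + Q^T by rewrite linearD.
have tN (P : 'M[R]_m) : (- P)^T = - P^T by rewrite linearN.
rewrite !tD !tN !trmx_mul.
rewrite !mulmxDr !mulmxDl !mulmxN !mulNmx !mulmxA.
mx_lin.
Qed.

(** The classical octahedron argument: four Bianchi identities, combined through the two
    antisymmetries. *)
Lemma pair_symmetry (T : Type) (K : T -> T -> T -> T -> R) :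
  (forall a b c d, K a b c d = - K b a c d) -> (forall a b c d, K a b c d = - K a b d c) ->
  (forall a b c d, K a b c d + K b c a d + K c a b d = 0) ->
  forall a b c d, K a b c d = K c d a b.
Proof.
move=> A1 A2 B a b c d.
have B1 := B a b c d; have B2 := B b c d a; have B3 := B c d a b; have B4 := B d a b c.
move: (A1 b c a d) (A1 c a b d) (A2 b c d a) (A1 c d b a) (A2 c d b a) (A1 d b c a) (A2 d b c a)
  (A1 d a c b) (A1 a c d b) (A2 c d a b) (A2 d a c b) (A2 a c d b) (A2 d a b c)
  (A1 a b d c) (A2 a b d c) (A1 b d a c) (A2 b d a c) (A1 a b c d) (A2 a b c d) (A1 d a b c) (A1 b c d a) (A2 c a d b) (A2 b d c a).
lra.
Qed.

End CoordCurvature.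

(** * Curvature of a Levi-Civita connection *)

Section Curvature.
Variables (R : realType) (m : nat) (M : smoothManifold R m).
Variables (g : bilinfield M) (D : connection M).
Hypothesis lc : levi_civita g D.
Hypothesis sg : bilinfield_smooth g.
Hypothesis symg : forall p u v, bilin (g p) u v = bilin (g p) v u.
Let cD := lc_connection lc.
Implicit Types (p q : M) (X Y Z : vfield M).

Lemma near_christ_linear p q : dom p q -> \forall x \near chart p q, linear (christ D p x).
Proof. by move=> pq; apply: filterS (near_chart pq) => x Ux; exact: christ_linear. Qed.

(** Shows that the curvature is tensorial. The coordinate form of the inner covariant derivative
    holds on a whole neighbourhood, which is what permits differentiating it again. *)
Lemma curv_coord p X Y Z :
  vfield_smooth_at p X -> vfield_smooth_at p Y -> vfield_smooth_at p Z ->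
  curv D X Y Z p = Z p *m coord_curv (christ D p) (chart p p) (X p) (Y p).
Proof.
move=> sX sY sZ; have pp := dom_center p; set x := chart p p.
have linG := near_christ_linear pp.
have sG v := christ_smooth cD v pp.
have H V W : vfield_smooth_at p V -> vfield_smooth_at p W ->
  cov D V (cov D W Z) p =
  'D_(vrep p V x) (fun z => 'D_(vrep p W z) (vrep p Z) z
        + vrep p Z z *m christ D p z (vrep p W z)) x
  + ('D_(vrep p W x) (vrep p Z) x + vrep p Z x *m christ D p x (vrep p W x))
     *m christ D p x (vrep p V x).
  move=> sV sW; have sWZ := conn_smooth cD sW sZ.
  rewrite {1}/cov (conn_center cD _ sWZ) -/x -(vrep_center p V).
  rewrite -(vrep_center p (cov D W Z)) (vrep_cov cD _ pp sZ) -/x.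
  apply: (f_equal (fun d => d + _)); apply: near_eq_derive.
  apply: filterS2 (near_chart pp) (smooth_near_near sZ) => z Uz sz.
  rewrite -(chartIK Uz); apply: (vrep_cov cD); first exact: dom_chartI.
  by apply/(vfield_smoothP _ (dom_chartI Uz)); rewrite chartIK.
rewrite /curv (H _ _ sX sY) (H _ _ sY sX) /cov (conn_center cD _ sZ) -/x.
rewrite /lie_bracket -/x -(vrep_center p X) -(vrep_center p Y) -(vrep_center p Z) -/x.
exact: (coord_curvE linG sG sX sY sZ).
Qed.

Lemma curv4_coord p X Y Z U :
  vfield_smooth_at p X -> vfield_smooth_at p Y -> vfield_smooth_at p Z ->
  curv4 g D X Y Z U p =
  bilin (g p) (Z p *m coord_curv (christ D p) (chart p p) (X p) (Y p)) (U p).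
Proof. by move=> sX sY sZ; rewrite /curv4 curv_coord. Qed.

Lemma curv4_pair_symmetry p X Y Z U :
  vfield_smooth_at p X -> vfield_smooth_at p Y ->
  vfield_smooth_at p Z -> vfield_smooth_at p U ->
  curv4 g D X Y Z U p = curv4 g D Z U X Y p.
Proof.
move=> sX sY sZ sU; rewrite !curv4_coord//.
have pp := dom_center p; set x := chart p p; set Q := coord_curv _ _.
have sG v := christ_smooth cD v pp.
have sym_near : \forall z \near x, forall u v,
    v *m christ D p z u = u *m christ D p z v.
  apply: filterS (near_chart pp) => z Uz u v; rewrite -(chartIK Uz).
  by apply: (christ_sym cD lc); exact: dom_chartI.
have comp_near : \forall z \near x, forall u, 'D_u (bilin_rep g p) z =
    christ D p z u *m bilin_rep g p z + bilin_rep g p z *m (christ D p z u)^T.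
  apply: filterS (near_chart pp) => z Uz u; rewrite -(chartIK Uz).
  by apply: (christ_metric lc sg); exact: dom_chartI.
have antiQ u v : Q u v = - Q v u by rewrite /Q /coord_curv; mx_lin.
apply: (@pair_symmetry R _ (fun a b c d => bilin (g p) (c *m Q a b) d)).
- by move=> a b c d; rewrite antiQ mulmxN bilinNl.
- move=> a b c d.
  have := coord_curv_skew a b sG (bilin_rep_smooth sg pp) comp_near.
  rewrite (bilin_rep_center g p) -/Q => /eqP; rewrite addr_eq0 => /eqP E.
  rewrite (symg p _ c) bilin_mulmxl bilin_mulmxr E.
  by rewrite /bilin mulmxN mulNmx mxE.
- move=> a b c d; rewrite -!bilinDl.
  by rewrite (coord_bianchi a b c sG sym_near) bilin0l.
Qed.

End Curvature.

(** * Curvature in the direction of the structure vector field *)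

Section SasakiCurvature.
Variables (R : realType) (n : nat) (M : smoothManifold R n.*2.+1).
Variables (phi : endofield M) (xi : vfield M) (eta : formfield M) (g : bilinfield M).
Variable D : connection M.
Hypothesis acr : almost_contact_complex_riemannian phi xi eta g.
Hypothesis lc : levi_civita g D.
Hypothesis sas : sasaki_like phi xi eta g D.
Let cD := lc_connection lc.

(** With [D_V xi = - phi V], torsion-freeness leaves [- (D_X phi) Y + (D_Y phi) X]. The coefficient
    of [xi] in [(D_X phi) Y] is symmetric in [X] and [Y] and cancels. *)
Lemma curv_xi (p : M) X Y : vfield_smooth_at p X -> vfield_smooth_at p Y ->
  curv D X Y xi p = covec (eta p) (Y p) *: X p - covec (eta p) (X p) *: Y p.
Proof.
move=> sX sY.
have covx V : cov D V xi = fun q => -1 *: endo_app phi V q.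
  by apply/funext => q; rewrite scaleN1r /cov (cov_xi acr lc sas).
have sphi V : vfield_smooth_at p V -> vfield_smooth_at p (endo_app phi V).
  exact: (acr_phi_smooth acr).
have H V W : vfield_smooth_at p W -> cov D V (cov D W xi) p =
    - (W p *m nabla_phi phi D p (V p)) - cov D V W p *m phi p.
  move=> sW; rewrite covx {1}/cov (conn_leibniz cD _ (fun_smooth_cst p (-1)) (sphi _ sW)).
  rewrite dfun_cst scale0r add0r scaleN1r -(cov_endo_center acr lc _ sW) /cov_endo.
  by rewrite opprB addrAC subrr add0r.
rewrite /curv (H _ _ sY) (H _ _ sX) covx /endo_app scaleN1r -(lc_torsion_free lc sX sY).
rewrite !(nabla_phiE acr lc sas) mulmxBl (acr_g_sym acr p (Y p)).
rewrite [2 * covec (eta p) (Y p) * _]mulrAC.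
move: (cov D X Y p *m _) (cov D Y X p *m _) (_ *: xi p) => a b c.
move: (_ *: X p) (_ *: Y p) => d e.
by mx_lin.
Qed.

Lemma curv4_xi (p : M) x y z :
  vfield_smooth_at p x -> vfield_smooth_at p y -> vfield_smooth_at p z ->
  curv4 g D x y xi z p = curv4 g D xi z x y p /\
  curv4 g D xi z x y p = covec (eta p) (y p) * bilin (g p) (x p) (z p)
          - covec (eta p) (x p) * bilin (g p) (y p) (z p).
Proof.
move=> sx sy sz; have E : curv4 g D x y xi z p = curv4 g D xi z x y p.
  apply: (curv4_pair_symmetry lc (acr_g_smooth acr) (acr_g_sym acr)) => //.
  exact: (acr_xi_smooth acr).
split=> //; rewrite -E /curv4 curv_xi//.
by rewrite bilinDl bilinNl !bilinZl.
Qed.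

End SasakiCurvature.

(** The matrix algebra of the Gauss equation with opaque entries. [h] stands for [G T^T], so
    [xi0 h = 0] kills the normal terms; [ru] and [rv] are minus the derivatives of the normal, and
    their tangential parts are the second fundamental form again. *)
Lemma gauss_algebra (R : realType) (k m : nat) (a1 a2 p1 p2 : 'M[R]_k) (t : 'M[R]_(k, m))
  (c1 c2 su sv : 'cV[R]_k) (xi0 ru rv : 'rV[R]_m) (h : 'M[R]_(m, k)) :
  xi0 *m h = 0 -> ru *m h = su^T -> rv *m h = sv^T ->
  (a1 *m t + p1 *m t + c1 *m xi0 - sv *m ru - (a2 *m t + p2 *m t + c2 *m xi0 - su *m rv)) *m h
  = (a1 - a2 + p1 - p2) *m (t *m h) - sv *m su^T + su *m sv^T.
Proof.
move=> e1 e2 e3; rewrite -e2 -e3.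
rewrite !(mulmxDl, mulmxBl, mulNmx, opprB, opprD) -!mulmxA e1 !mulmx0; mx_lin.
Qed.

(** * Hypersurfaces tangent to the kernel of a form *)

Section GaussCoord.
Variables (R : realType) (k m : nat).
Variables (f : 'rV[R]_k -> 'rV[R]_m) (G Phi : 'rV[R]_m -> 'M[R]_m).
Variables (xi : 'rV[R]_m -> 'rV[R]_m) (eta : 'rV[R]_m -> 'cV[R]_m).
Variables (Gam : 'rV[R]_m -> 'rV[R]_m -> 'M[R]_m) (Gamh : 'rV[R]_k -> 'rV[R]_k -> 'M[R]_k).
Variable x0 : 'rV[R]_k.
Local Notation y0 := (f x0).
Local Notation T := (jacobian f).
Implicit Types (u v : 'rV[R]_k) (x : 'rV[R]_k) (y w : 'rV[R]_m).

Hypothesis sf : smooth_near f x0.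
Hypothesis sG : smooth_near G y0.
Hypothesis sPhi : smooth_near Phi y0.
Hypothesis sxi : smooth_near xi y0.
Hypothesis seta : smooth_near eta y0.
Hypothesis sGam : forall w, smooth_near (fun y => Gam y w) y0.
Hypothesis linGam : \forall y \near y0, linear (Gam y).
Hypothesis symGam : \forall y \near y0, forall w w', w' *m Gam y w = w *m Gam y w'.
Hypothesis metG : \forall y \near y0, forall w,
  'D_w G y = Gam y w *m G y + G y *m (Gam y w)^T.
Hypothesis trG : \forall y \near y0, (G y)^T = G y.
Hypothesis covxi : \forall y \near y0, forall w, 'D_w xi y + xi y *m Gam y w = - (w *m Phi y).
Hypothesis etaE : \forall y \near y0, eta y = G y *m (xi y)^T.
Hypothesis eta_xi : \forall y \near y0, xi y *m eta y = 1%:M.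

Definition hmet x : 'M[R]_k := T x *m G (f x) *m (T x)^T.
(** As a column: multiplied on the left by a row [v] it gives [g(phi X, Y)] for the images [X = u T]
    and [Y = v T]. *)
Definition second_form x u : 'cV[R]_k := T x *m G (f x) *m (u *m T x *m Phi (f x))^T.
(** Its rows are the ambient covariant derivatives, along the image of [u], of the tangent frame
    given by the rows of [T]. *)
Definition cov_tangent x u : 'M[R]_(k, m) := 'D_u T x + T x *m Gam (f x) (u *m T x).

Hypothesis Teta : \forall x \near x0, T x *m eta (f x) = 0.
Hypothesis kerT : \forall x \near x0, forall W : 'M[R]_(k, m),
  W *m eta (f x) = 0 -> exists A, W = A *m T x.
Hypothesis unith : \forall x \near x0, hmet x \in unitmx.
Hypothesis sGamh : forall u, smooth_near (fun x => Gamh x u) x0.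
Hypothesis symGamh : \forall x \near x0, forall u v, v *m Gamh x u = u *m Gamh x v.
Hypothesis meth : \forall x \near x0, forall u,
  'D_u hmet x = Gamh x u *m hmet x + hmet x *m (Gamh x u)^T.

Lemma near_comp_f (P : 'rV[R]_m -> Prop) :
  (\forall y \near y0, P y) -> \forall x \near x0, P (f x).
Proof. by move=> nP; apply: (smooth_near_continuous sf). Qed.

Lemma near_smooth_f : \forall x \near x0, [/\ smooth_near f x, smooth_near G (f x),
  smooth_near xi (f x), smooth_near eta (f x) & smooth_near Phi (f x)].
Proof.
have H1 := smooth_near_near sf; have H2 := near_comp_f (smooth_near_near sG).
have H3 := near_comp_f (smooth_near_near sxi); have H4 := near_comp_f (smooth_near_near seta).
have H5 := near_comp_f (smooth_near_near sPhi).
by apply: filterS2 (filterI H1 H2) (filterI H3 (filterI H4 H5)) => x [? ?] [? [? ?]].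
Qed.

Lemma derive_f x u : smooth_near f x -> 'D_u f x = u *m T x.
Proof. by move=> s; rewrite deriveEjacobian//; exact: smooth_near_differentiable. Qed.

Lemma derive_comp_f p q (F : 'rV[R]_m -> 'M[R]_(p, q)) x u :
  smooth_near f x -> smooth_near F (f x) -> 'D_u (fun z => F (f z)) x = 'D_(u *m T x) F (f x).
Proof.
move=> s1 s2; rewrite -(derive_f u s1).
exact: derive_comp (smooth_near_differentiable s1) (smooth_near_differentiable s2).
Qed.

Lemma derive_tangent_sym x u v : smooth_near f x -> v *m 'D_u T x = u *m 'D_v T x.
Proof.
move=> s; have sT := smooth_near_jacobian s.
have H a b : a *m 'D_b T x = 'D_b (fun z => 'D_a f z) x.
  rewrite -(derive_mulmxl a (smooth_near_derivable sT)).
  by apply: near_eq_derive; apply: filterS (smooth_near_near s) => z /derive_f ->.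
by rewrite !H; exact: schwarz.
Qed.

Lemma cov_tangent_sym : \forall x \near x0, forall u v,
  v *m cov_tangent x u = u *m cov_tangent x v.
Proof.
apply: filterS2 near_smooth_f (near_comp_f symGam) => x [s _ _ _ _] sy u v.
by rewrite /cov_tangent !mulmxDr (derive_tangent_sym u v s) !mulmxA sy.
Qed.

Lemma derive_hmet : \forall x \near x0, forall u, 'D_u hmet x =
  cov_tangent x u *m G (f x) *m (T x)^T + T x *m G (f x) *m (cov_tangent x u)^T.
Proof.
apply: filterS2 near_smooth_f (near_comp_f metG) => x [s sg _ _ _] mg u.
have sT := smooth_near_jacobian s.
have sGf := smooth_near_comp s sg.
have sTG := smooth_near_mulmx sT sGf.
have sTt := smooth_near_trmx sT.
rewrite [LHS](derive_mulmx (smooth_near_derivable sTG) (smooth_near_derivable sTt)).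
rewrite (derive_mulmx (smooth_near_derivable sT) (smooth_near_derivable sGf)).
rewrite (derive_trmx (smooth_near_derivable sT)) (derive_comp_f _ s sg) mg.
rewrite /cov_tangent; move: ('D_u T x) => dT.
have tD (P Q : 'M[R]_(k, m)) : (P + Q)^T = P^T + Q^T by rewrite linearD.
rewrite tD trmx_mul !mulmxDr !mulmxDl !mulmxA; mx_lin.
Qed.

(* Uniqueness of a symmetric metric connection: the difference is a tensor symmetric in its first
   two and antisymmetric in its last two arguments. *)
Lemma sym_skew0 (S : 'rV[R]_k -> 'M[R]_k) :
  (forall u v, v *m S u = u *m S v) -> (forall u, S u + (S u)^T = 0) -> forall u, S u = 0.
Proof.
move=> sS aS.
pose K (u v t : 'rV[R]_k) := bilin (S u) v t.
have K1 u v (t : 'rV[R]_k) : K u v t = K v u t by rewrite /K /bilin sS.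
have K2 u v (t : 'rV[R]_k) : K u v t = - K u t v.
  have /eqP := aS u; rewrite addr_eq0 => /eqP E.
  by rewrite /K {1}E bilin_tr -/K /bilin linearN/= trmxK mulmxN mulNmx mxE.
move=> u; apply: bilin_inj => v w; rewrite -/(K u v w).
have -> : bilin 0 v w = 0 by rewrite /bilin mulmx0 mul0mx mxE.
have := K1 u v w; have := K2 v u w; have := K1 v w u; have := K2 w v u.
have := K1 w u v; have := K2 u w v; lra.
Qed.

(** Both sides are symmetric in direction and argument, and both have a symmetrisation equal to the
    derivative of [hmet]. Their difference falls under [sym_skew0], so the tangential part of the
    ambient derivative is the given connection of the leaf. *)
Lemma cov_tangent_proj : \forall x \near x0, forall u,
  cov_tangent x u *m G (f x) *m (T x)^T = Gamh x u *m hmet x.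
Proof.
have H1 := cov_tangent_sym; have H2 := derive_hmet; have H3 := near_comp_f trG.
apply: filterS2 (filterI H1 H2) (filterI H3 (filterI symGamh meth)).
move=> x [sC dh] [tG [sGh mh]] u; apply/eqP; rewrite -subr_eq0; apply/eqP.
move: u; apply: sym_skew0 => [u v|u].
  by rewrite !mulmxBr !mulmxA (sC u v) (sGh u v).
have /eqP := mh u; rewrite dh -subr_eq0 => /eqP <-.
have tB (P Q : 'M[R]_k) : (P - Q)^T = P^T - Q^T by rewrite linearB.
have th : (hmet x)^T = hmet x by rewrite /hmet !trmx_mul trmxK tG mulmxA.
rewrite tB (trmx_mul (Gamh x u)) th !trmx_mul trmxK tG !mulmxA; mx_lin.
Qed.

(** The product rule for [eta = g(., xi)], where [D xi = - phi] supplies the last term. *)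
Lemma derive_eta : \forall y \near y0, forall w,
  'D_w eta y = Gam y w *m eta y - G y *m (w *m Phi y)^T.
Proof.
have H1 := smooth_near_near sG; have H2 := smooth_near_near sxi.
have E := near_join etaE.
apply: filterS2 (filterI H1 H2) (filterI metG (filterI covxi E)).
move=> y [sGy sxy] [mG [cx eE]] w.
transitivity ('D_w (fun z => G z *m (xi z)^T) y); first exact: near_eq_derive.
have st := smooth_near_trmx sxy.
rewrite [LHS](derive_mulmx (smooth_near_derivable sGy) (smooth_near_derivable st)).
rewrite (derive_trmx (smooth_near_derivable sxy)) mG (nbhs_singleton eE).
have -> : w *m Phi y = - ('D_w xi y + xi y *m Gam y w) by rewrite cx opprK.
have tD (P Q : 'rV[R]_m) : (- (P + Q))^T = - P^T - Q^T by rewrite linearN linearD opprD.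
rewrite tD trmx_mul mulmxDl mulmxDr !mulmxN !mulmxA; mx_lin.
Qed.

(** Differentiating [T eta = 0] gives the normal part. Once both parts are subtracted, the remainder
    is tangent by [kerT] and orthogonal to the leaf by [cov_tangent_proj]; it vanishes because
    [hmet] is invertible. *)
Lemma gauss_decomp : \forall x \near x0, forall u,
  cov_tangent x u = Gamh x u *m T x + second_form x u *m xi (f x).
Proof.
have H1 := near_smooth_f; have H2 := cov_tangent_proj; have H3 := near_comp_f derive_eta.
have H4 := near_comp_f eta_xi; have H5 := near_join Teta; have H6 := near_comp_f etaE.
have H7 := near_comp_f trG.
apply: filterS2 (filterI H1 (filterI H2 (filterI H3 H4)))
  (filterI H5 (filterI kerT (filterI unith (filterI H6 H7)))).
move=> x [[s sg _ se _] [pr [de ex]]] [Te [kT [uh [eE tG]]]] u.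
have Tex := nbhs_singleton Te.
have Ceta : cov_tangent x u *m eta (f x) = second_form x u.
  have sT := smooth_near_jacobian s; have sef := smooth_near_comp s se.
  have := derive_mulmx (smooth_near_derivable (v := u) sT) (smooth_near_derivable sef).
  have -> : 'D_u (fun z => T z *m eta (f z)) x = 'D_u (fun=> 0) x by exact: near_eq_derive.
  rewrite derive_cst (derive_comp_f _ s se) de mulmxBr => E.
  rewrite /cov_tangent /second_form mulmxDl; move: E; rewrite !mulmxA => E.
  by apply/eqP; rewrite -subr_eq0 -addrA -E.
pose W := cov_tangent x u - Gamh x u *m T x.
have Weta : W *m eta (f x) = second_form x u.
  by rewrite /W mulmxBl Ceta -mulmxA Tex mulmx0 subr0.
have [|A WE] := kT (W - second_form x u *m xi (f x)).
  by rewrite mulmxBl Weta -mulmxA ex mulmx1 subrr.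
suff A0 : A = 0.
  apply/eqP; rewrite -subr_eq0 opprD addrA; apply/eqP.
  by move: WE; rewrite A0 mul0mx /W.
have xiT : xi (f x) *m G (f x) *m (T x)^T = 0.
  apply: trmx_inj; rewrite !trmx_mul trmxK tG -eE Tex.
  by rewrite trmx0.
have : A *m hmet x = 0.
  have E1 : second_form x u *m xi (f x) *m G (f x) *m (T x)^T = 0.
    move: (second_form x u) => c.
    by rewrite -!mulmxA [xi (f x) *m _]mulmxA xiT mulmx0.
  rewrite /hmet !mulmxA -WE !mulmxBl E1 subr0.
  by rewrite pr /hmet !mulmxA subrr.
by move/(congr1 (fun B => B *m invmx (hmet x))); rewrite mulmxK// mul0mx.
Qed.

Lemma second_form_smooth u : smooth_near (fun x => second_form x u) x0.
Proof.
have sT := smooth_near_jacobian sf.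
apply: smooth_near_mulmx.
  by apply: smooth_near_mulmx => //; exact: smooth_near_comp.
apply: smooth_near_trmx; apply: smooth_near_mulmx; last exact: smooth_near_comp.
by apply: smooth_near_mulmx => //; exact: smooth_near_cst.
Qed.

(** The commutator of two ambient derivatives of the tangent frame. Third derivatives of [f] cancel
    by the symmetry of second derivatives of [T]. *)
Lemma cov_tangent_curv u v :
  'D_u (fun x => cov_tangent x v) x0 + cov_tangent x0 v *m Gam y0 (u *m T x0)
  - ('D_v (fun x => cov_tangent x u) x0 + cov_tangent x0 u *m Gam y0 (v *m T x0))
  = T x0 *m coord_curv Gam y0 (u *m T x0) (v *m T x0).
Proof.
have sT := smooth_near_jacobian sf.
have linL : \forall z \near x0, linear (fun w => Gam (f z) w) := near_comp_f linGam.
have sL w : smooth_near (fun z => Gam (f z) w) x0 := smooth_near_comp sf (sGam w).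
(* Names the second derivatives of [T], so that later steps see them as atoms. *)
have [dd ddE] : exists dd, forall a b, 'D_a (fun z => 'D_b T z) x0 = dd a b.
  by exists (fun a b => 'D_a (fun z => 'D_b T z) x0).
have Hs : dd u v = dd v u by rewrite -!ddE; exact: schwarz.
have H a b : 'D_a (fun x => cov_tangent x b) x0 = dd a b
   + ('D_a T x0 *m Gam y0 (b *m T x0) + (T x0 *m Gam y0 (b *m 'D_a T x0)
      + T x0 *m 'D_(a *m T x0) (fun y => Gam y (b *m T x0)) y0)).
  have sbT : smooth_near (fun z => b *m T z) x0.
    by apply: smooth_near_mulmx => //; exact: smooth_near_cst.
  have sDT := smooth_near_derive b sT.
  have sGT : smooth_near (fun z => Gam (f z) (b *m T z)) x0.
    exact: (smooth_near_linfam linL sL sbT).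
  have sTG := smooth_near_mulmx sT sGT.
  rewrite -ddE [LHS](deriveD (smooth_near_derivable sDT) (smooth_near_derivable sTG)).
  apply: (f_equal (fun d => _ + d)).
  rewrite [LHS](derive_mulmx (smooth_near_derivable sT) (smooth_near_derivable sGT)).
  apply: (f_equal (fun d => _ + d)); rewrite -mulmxDr.
  apply: (f_equal (fun d => _ *m d)).
  rewrite [LHS](derive_linfam a linL sL sbT).
  rewrite (derive_mulmxl b (smooth_near_derivable sT)).
  by rewrite -(derive_comp_f a sf (sGam (b *m T x0))).
have := derive_tangent_sym u v sf; rewrite (H u v) (H v u) Hs.
rewrite /cov_tangent /coord_curv !mulmxDl !mulmxBr !mulmxDr !mulmxN !mulmxA.
move: ('D_u T x0) ('D_v T x0) => e1 e2 <-.
mx_lin.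
Qed.

(** The decomposition of [gauss_decomp] is inserted in [cov_tangent_curv] and the result paired with
    the tangent frame. Differentiating the normal part brings in [D xi = - phi], and this produces
    the quadratic terms. *)
Lemma gauss_curvature u v :
  T x0 *m coord_curv Gam y0 (u *m T x0) (v *m T x0) *m G y0 *m (T x0)^T
  = coord_curv Gamh x0 u v *m hmet x0
    - second_form x0 v *m (second_form x0 u)^T + second_form x0 u *m (second_form x0 v)^T.
Proof.
have sT := smooth_near_jacobian sf; have sX := smooth_near_comp sf sxi.
have dec := nbhs_singleton gauss_decomp.
have H a b : 'D_a (fun x => cov_tangent x b) x0 + cov_tangent x0 b *m Gam y0 (a *m T x0) =
  'D_a (fun x => Gamh x b) x0 *m T x0 + Gamh x0 b *m Gamh x0 a *m T x0
  + (Gamh x0 b *m second_form x0 a + 'D_a (fun x => second_form x b) x0) *m xi y0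
  - second_form x0 b *m (a *m T x0 *m Phi y0).
  have sS := second_form_smooth b.
  have s1 := smooth_near_mulmx (sGamh b) sT; have s2 := smooth_near_mulmx sS sX.
  have -> : 'D_a (fun x => cov_tangent x b) x0 =
     'D_a (fun x => Gamh x b *m T x + second_form x b *m xi (f x)) x0.
    by apply: near_eq_derive; apply: filterS gauss_decomp => x E; rewrite E.
  rewrite [X in X + _ = _](deriveD (smooth_near_derivable s1) (smooth_near_derivable s2)).
  rewrite (derive_mulmx (smooth_near_derivable (sGamh b)) (smooth_near_derivable sT)).
  rewrite (derive_mulmx (smooth_near_derivable sS) (smooth_near_derivable sX)).
  rewrite (derive_comp_f a sf sxi).
  have -> : a *m T x0 *m Phi y0 = - ('D_(a *m T x0) xi y0 + xi y0 *m Gam y0 (a *m T x0)).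
    by rewrite (nbhs_singleton covxi) opprK.
  have -> : 'D_a T x0 = Gamh x0 a *m T x0 + second_form x0 a *m xi y0
      - T x0 *m Gam y0 (a *m T x0) by rewrite -dec /cov_tangent addrK.
  rewrite dec; move: (second_form x0 a) (second_form x0 b) => sa sb.
  rewrite !mulmxN !mulmxDl !mulmxBr !mulmxDr !mulmxA; mx_lin.
have tG := nbhs_singleton trG.
have xiT : xi y0 *m G y0 *m (T x0)^T = 0.
  apply: trmx_inj; rewrite !trmx_mul trmxK tG -(nbhs_singleton etaE).
  by rewrite (nbhs_singleton Teta) trmx0.
have sfT a : a *m T x0 *m Phi y0 *m G y0 *m (T x0)^T = (second_form x0 a)^T.
  by rewrite /second_form !trmx_mul !trmxK tG !mulmxA.
rewrite -cov_tangent_curv -[LHS]mulmxA; rewrite (H u v) (H v u).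
rewrite /hmet -[T x0 *m _ *m _]mulmxA; apply: gauss_algebra.
- by rewrite mulmxA.
- by rewrite mulmxA sfT.
- by rewrite mulmxA sfT.
Qed.

Variable J : 'rV[R]_k -> 'M[R]_k.
Hypothesis sJ : smooth_near J x0.
Hypothesis JT : \forall x \near x0, J x *m T x = T x *m Phi (f x).
Hypothesis covPhi : forall u v, v *m T x0 *m endo_cov (Gam y0) Phi y0 (u *m T x0) =
  - bilin (G y0) (u *m T x0) (v *m T x0) *: xi y0.
Hypothesis xiPhi : xi y0 *m Phi y0 = 0.
Hypothesis freeT : row_free (T x0).

(** Differentiating [J T = T Phi] expresses [S T] through [D phi] and the second form; by [covPhi]
    every row is then a multiple of [xi]. It is also tangent, hence killed by [eta], and
    [eta(xi) = 1] leaves only zero. *)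
Lemma parallel_restriction u : endo_cov (Gamh x0) J x0 u = 0.
Proof.
have sT := smooth_near_jacobian sf; have sPf := smooth_near_comp sf sPhi.
have dec := nbhs_singleton gauss_decomp u.
have Tex := nbhs_singleton Teta; have ex := nbhs_singleton eta_xi.
set S := endo_cov _ _ _ _.
have dJT : 'D_u J x0 *m T x0 = 'D_u T x0 *m Phi y0 + T x0 *m 'D_(u *m T x0) Phi y0
    - J x0 *m 'D_u T x0.
  have : 'D_u (fun x => J x *m T x) x0 = 'D_u (fun x => T x *m Phi (f x)) x0.
    exact: near_eq_derive.
  rewrite (derive_mulmx (smooth_near_derivable sJ) (smooth_near_derivable sT)).
  rewrite (derive_mulmx (smooth_near_derivable sT) (smooth_near_derivable sPf)).
  by rewrite (derive_comp_f u sf sPhi) => <-; rewrite addrK.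
have JT0 := nbhs_singleton JT.
have ST : S *m T x0 = T x0 *m endo_cov (Gam y0) Phi y0 (u *m T x0)
    - J x0 *m second_form x0 u *m xi y0.
  have dT : 'D_u T x0 = Gamh x0 u *m T x0 + second_form x0 u *m xi y0
      - T x0 *m Gam y0 (u *m T x0) by rewrite -dec /cov_tangent addrK.
  rewrite /S /endo_cov mulmxBl mulmxDl dJT dT -[Gamh x0 u *m J x0 *m _]mulmxA JT0.
  rewrite !mulmxBl !mulmxDl !mulmxBr !mulmxDr -[second_form x0 u *m xi y0 *m _]mulmxA xiPhi.
  rewrite mulmx0 [J x0 *m (T x0 *m _)]mulmxA JT0 !mulmxA; mx_lin.
suff ST0 : S *m T x0 = 0 by apply: (row_free_inj freeT); rewrite mul0mx.
apply/row_matrixP => i; rewrite row0 rowE mulmxA.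
set v := delta_mx 0 i.
have STv : v *m S *m T x0 = (- bilin (G y0) (u *m T x0) (v *m T x0)
    - (v *m J x0 *m second_form x0 u) 0 0) *: xi y0.
  rewrite -mulmxA ST mulmxBr [v *m (T x0 *m _)]mulmxA covPhi !mulmxA scalerBl.
  by congr (_ - _); rewrite [X in X *m xi _]mx11_scalar mul_scalar_mx.
have : v *m S *m T x0 *m eta y0 = 0 by rewrite -[LHS]mulmxA Tex mulmx0.
rewrite STv -scalemxAl ex => /matrixP/(_ 0 0).
by rewrite !mxE eqxx mulr1 => ->; rewrite scale0r.
Qed.

End GaussCoord.

(** * Neutral signature from an anti-isometry *)

Section Signature.
Variable R : realType.

Lemma bilin_row1 m (h : 'M[R]_m) (u v : 'rV[R]_m) : u *m h *m v^T = (bilin h u v)%:M.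
Proof. by rewrite [LHS]mx11_scalar. Qed.

(** The rows of [E] span a nondegenerate subspace. Were its orthogonal complement totally isotropic,
    polarisation would put it in the radical of [h], which is zero; then [h E^T] would have rank
    [m], more than its [k] columns allow. *)
Lemma exists_anisotropic m (h : 'M[R]_m) k (E : 'M[R]_(k, m)) (S : 'M[R]_k) :
  h^T = h -> h \in unitmx -> E *m h *m E^T *m S = 1%:M -> (k < m)%N ->
  exists2 w : 'rV[R]_m, w *m h *m E^T = 0 & bilin h w w != 0.
Proof.
move=> hT hu ES km; apply: contrapT => nw.
have iso (w : 'rV[R]_m) : w *m h *m E^T = 0 -> bilin h w w = 0.
  by move=> w0; apply/eqP; apply: contrapT => /negP bw; apply: nw; exists w.
have bS u v : bilin h u v = bilin h v u by rewrite bilin_tr hT.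
have ker0 (w : 'rV[R]_m) : w *m h *m E^T = 0 -> w = 0.
  move=> w0; apply: (bilin_nondeg hu) => v.
  have SE : S^T *m (E *m h *m E^T) = 1%:M.
    by have := congr1 trmx ES; rewrite !trmx_mul trmxK hT trmx1 !mulmxA.
  have [v' [c [v'0 vE]]] : exists v' c, v' *m h *m E^T = 0 /\ v = v' + c *m E.
    (* Orthogonal projection off the span of [E]; [S^T] inverts the Gram matrix. *)
    exists (v - v *m h *m E^T *m S^T *m E), (v *m h *m E^T *m S^T); split; last by rewrite subrK.
    by rewrite !mulmxBl -!mulmxA [E *m _]mulmxA SE mulmx1 subrr.
  have b0 : bilin h w v' = 0.
    have : bilin h (w + v') (w + v') = 0.
      by apply: iso; rewrite !mulmxDl w0 v'0 addr0.
    rewrite !bilinDl !bilinDr (iso _ w0) (iso _ v'0) add0r addr0 (bS v') => /eqP.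
    by rewrite -mulr2n mulrn_eq0 => /eqP.
  by rewrite vE bilinDr b0 add0r /bilin trmx_mul mulmxA w0 mul0mx mxE.
have : row_free (h *m E^T).
  by apply: inj_row_free => v; rewrite mulmxA; exact: ker0.
rewrite /row_free => /eqP rk; have := rank_leq_col (h *m E^T).
by rewrite rk leqNgt km.
Qed.

(** Induction on the size of the family: the orthogonal complement of a smaller one contains an
    anisotropic vector, which is normalised and filed according to the sign of its square. *)
Lemma orthogonal_family m (h : 'M[R]_m) k : h^T = h -> h \in unitmx -> (k <= m)%N ->
  exists a b (E1 : 'M[R]_(a, m)) (E2 : 'M[R]_(b, m)), [/\ (a + b)%N = k,
    E1 *m h *m E1^T = 1%:M, E2 *m h *m E2^T = - 1%:M & E1 *m h *m E2^T = 0].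
Proof.
move=> hT hu; elim: k => [_|k IH km].
  exists 0%N, 0%N, 0, 0; rewrite !mul0mx; split=> //.
  - by rewrite [RHS]flatmx0.
  - by rewrite [RHS]flatmx0.
have [a [b [E1 [E2 [abk H1 H2 H12]]]]] := IH (ltnW km).
have H21 : E2 *m h *m E1^T = 0.
  by apply: trmx_inj; rewrite !trmx_mul trmxK hT trmx0 mulmxA.
have HE : col_mx E1 E2 *m h *m (col_mx E1 E2)^T = block_mx 1%:M 0 0 (- 1%:M).
  by rewrite mul_col_mx tr_col_mx mul_col_row H1 H2 H12 H21.
have HS : col_mx E1 E2 *m h *m (col_mx E1 E2)^T *m block_mx 1%:M 0 0 (- 1%:M) = 1%:M.
  rewrite HE mulmx_block !mulmx0 !mul0mx !mulmx1 !addr0 !add0r mulNmx mulmxN mulmx1 opprK.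
  by rewrite -scalar_mx_block.
have abm : (a + b < m)%N by rewrite abk.
have [w w0 bw] := exists_anisotropic hT hu HS abm.
have wE : w *m h *m E1^T = 0 /\ w *m h *m E2^T = 0.
  by move: w0; rewrite tr_col_mx mul_mx_row -row_mx0 => /eq_row_mx.
have [w1 w2] := wE.
pose s := (Num.sqrt `|bilin h w w|)^-1; pose e := s *: w.
have se : bilin h e e = Num.sg (bilin h w w).
  rewrite /e bilinZl bilinZr mulrA /s -expr2 exprVn sqr_sqrtr// {2}[bilin h w w]numEsg.
  by rewrite mulrCA mulVf ?mulr1// normr_eq0.
have e1 : e *m h *m E1^T = 0 by rewrite /e -!scalemxAl w1 scaler0.
have e2 : e *m h *m E2^T = 0 by rewrite /e -!scalemxAl w2 scaler0.
have e1' : E1 *m h *m e^T = 0.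
  by apply: trmx_inj; rewrite !trmx_mul trmxK hT trmx0 mulmxA.
have e2' : E2 *m h *m e^T = 0.
  by apply: trmx_inj; rewrite !trmx_mul trmxK hT trmx0 mulmxA.
have [pos|neg|z] := ltrgt0P (bilin h w w); last by rewrite z eqxx in bw.
- exists (a + 1)%N, b, (col_mx E1 e), E2; split=> //.
  + by rewrite addnAC abk addn1.
  + rewrite mul_col_mx tr_col_mx mul_col_row H1 e1 e1' bilin_row1 se gtr0_sg//.
    by rewrite -scalar_mx_block.
  + by rewrite mul_col_mx mul_col_mx H12 e2 col_mx0.
- exists a, (b + 1)%N, E1, (col_mx E2 e); split=> //.
  + by rewrite addnA abk addn1.
  + rewrite mul_col_mx tr_col_mx mul_col_row H2 e2 e2' bilin_row1 se ltr0_sg//.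
    by rewrite [in RHS]scalar_mx_block opp_block_mx !oppr0 raddfN.
  + by rewrite tr_col_mx mul_mx_row H12 e1' row_mx0.
Qed.

Lemma family_signature a b m (h : 'M[R]_m) (E1 : 'M[R]_(a, m)) (E2 : 'M[R]_(b, m)) :
  h^T = h -> (a + b)%N = m -> E1 *m h *m E1^T = 1%:M -> E2 *m h *m E2^T = - 1%:M ->
  E1 *m h *m E2^T = 0 -> has_signature a b h.
Proof.
(* Eliminating the equation [a + b = m] gives the stacked matrix a square type. *)
move=> hT abm; case: m / abm h E1 E2 hT => h E1 E2 hT H1 H2 H12; split=> //.
have H21 : E2 *m h *m E1^T = 0.
  by apply: trmx_inj; rewrite !trmx_mul trmxK hT trmx0 mulmxA.
have HE : col_mx E1 E2 *m h *m (col_mx E1 E2)^T = block_mx 1%:M 0 0 (- 1%:M).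
  by rewrite mul_col_mx tr_col_mx mul_col_row H1 H2 H12 H21.
exists (col_mx E1 E2).
  have : block_mx 1%:M 0 0 (- 1%:M) \in @unitmx R (a + b).
    rewrite unitmxE det_ublock det1 mul1r -scaleN1r detZ det1 mulr1.
    by rewrite unitrX// unitrN1.
  by rewrite -HE !unitmx_mul => /andP[/andP[]].
rewrite HE; apply/matrixP => i j; rewrite [RHS]mxE [X in X *+ _]mxE.
case: (split_ordP i) => i' ->; case: (split_ordP j) => j' ->.
- by rewrite block_mxEul mxE (inj_eq (@lshift_inj _ _)).
- by rewrite block_mxEur mxE eq_lrshift.
- by rewrite block_mxEdl mxE eq_rlshift.
- by rewrite block_mxEdr !mxE (inj_eq (@rshift_inj _ _)) mulNrn.
Qed.

(** On the span of [E] the form has the sign of [c], on its image under [J] the opposite sign. The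
    two subspaces meet only in zero, so the stacked matrix is row free. *)
Lemma definite_half m (h J : 'M[R]_m) a (E : 'M[R]_(a, m)) (c : R) : c != 0 ->
  J *m h *m J^T = - h -> E *m h *m E^T = c%:M -> (a + a <= m)%N.
Proof.
move=> c0 Jh Eh.
have sq (x : 'rV[R]_a) : bilin 1%:M x x = \sum_i x 0 i ^+ 2.
  by rewrite /bilin mulmx1 mxE; apply: eq_bigr => i _; rewrite mxE expr2.
have sq0 (x : 'rV[R]_a) : 0 <= bilin 1%:M x x.
  by rewrite sq; apply: sumr_ge0 => i _; exact: sqr_ge0.
have sqE (x : 'rV[R]_a) : bilin 1%:M x x = 0 -> x = 0.
  rewrite sq => /eqP; rewrite psumr_eq0; last by move=> i _; exact: sqr_ge0.
  move=> /allP H; apply/rowP => i; rewrite mxE.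
  by have := H i (mem_index_enum _); rewrite /= sqrf_eq0 => /eqP.
have B1 (x : 'rV[R]_a) : bilin h (x *m E) (x *m E) = c * bilin 1%:M x x.
  rewrite /bilin trmx_mul !mulmxA -2!(mulmxA x) Eh mul_mx_scalar -scalemxAl mulmx1.
  by rewrite mxE.
have B2 (x : 'rV[R]_a) : bilin h (x *m E *m J) (x *m E *m J) = - (c * bilin 1%:M x x).
  rewrite -B1 /bilin (trmx_mul (x *m E)) !mulmxA.
  have -> : x *m E *m J *m h *m J^T = - (x *m E *m h) by rewrite -mulmxN -Jh !mulmxA.
  by rewrite mulNmx mxE.
have : row_free (col_mx E (E *m J)).
  apply: inj_row_free => v; rewrite -[v]hsubmxK mul_row_col.
  move: (lsubmx v) (rsubmx v) => x y; rewrite mulmxA => /eqP; rewrite addr_eq0 => /eqP xy.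
  have : c * bilin 1%:M x x = - (c * bilin 1%:M y y).
    by rewrite -B1 xy bilinNl bilinNr opprK B2.
  rewrite -mulrN => /(mulfI c0) E0.
  have y0 : bilin 1%:M y y = 0 by have := sq0 x; have := sq0 y; move: E0; lra.
  have x0 : bilin 1%:M x x = 0 by rewrite E0 y0 oppr0.
  by rewrite (sqE _ x0) (sqE _ y0) row_mx0.
rewrite /row_free => /eqP <-; exact: rank_leq_col.
Qed.

(** The bounds [2a <= 2n] and [2b <= 2n] together with [a + b = 2n] leave only [a = b = n]. *)
Lemma neutral_signature n (h J : 'M[R]_(n.*2)) : h^T = h -> h \in unitmx ->
  J *m h *m J^T = - h -> has_signature n n h.
Proof.
move=> hT hu Jh.
have [a [b [E1 [E2 [ab H1 H2 H12]]]]] := orthogonal_family hT hu (leqnn _).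
have aa : (a + a <= n.*2)%N := definite_half (oner_neq0 R) Jh H1.
have bb : (b + b <= n.*2)%N.
  have N1 : (-1 : R) != 0 by rewrite oppr_eq0 oner_neq0.
  by apply: (definite_half N1 Jh (E := E2)); rewrite H2 raddfN.
rewrite -!addnn in ab aa bb.
have an : a = n by apply/eqP; rewrite eqn_leq; lia.
have bn : b = n by move: ab; rewrite an => /addnI.
move: E1 E2 H1 H2 H12; rewrite an bn => E1 E2 H1 H2 H12.
by apply: (family_signature hT (addnn n) H1 H2 H12).
Qed.

End Signature.

(** * Smooth maps in charts *)

Section MapRep.
Variables (R : realType) (k m : nat) (N : smoothManifold R k) (M : smoothManifold R m).
Variable f : N -> M.
Hypothesis sf : smooth_map f.

Definition map_rep (p : N) (p' : M) : 'rV[R]_k -> 'rV[R]_m := chart p' \o f \o chartI p.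

Lemma map_repE p p' q : dom p q -> map_rep p p' (chart p q) = chart p' (f q).
Proof. by move=> pq; rewrite /map_rep /= chartK. Qed.

Lemma near_map p p' q : dom p q -> dom p' (f q) ->
  \forall x \near chart p q, dom p' (f (chartI p x)).
Proof.
move=> pq p'q; have [cf _] := sf q.
by apply: (near_chartI (P := fun q => dom p' (f q)) pq); apply: cf; exact: near_dom.
Qed.

Lemma near_map_rep p p' q : dom p q -> dom p' (f q) ->
  \forall x \near chart p q, map_rep p p' x =
    ((chart p' \o chartI (f q)) \o (map_rep q (f q) \o (chart q \o chartI p))) x.
Proof.
move=> pq p'q; have qq := dom_center q.
apply: filterS2 (near_chartIK pq qq) (near_map pq (dom_center (f q))) => x E1 E2.
by rewrite /map_rep /= E1 chartK.
Qed.

Lemma map_rep_smooth p p' q : dom p q -> dom p' (f q) ->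
  smooth_near (map_rep p p') (chart p q).
Proof.
move=> pq p'q; have qq := dom_center q; have fqq := dom_center (f q).
have [_ s] := sf q.
apply: (@eq_smooth_near _ _ _
  ((chart p' \o chartI (f q)) \o (map_rep q (f q) \o (chart q \o chartI p)))).
  by apply: filterS (near_map_rep pq p'q) => x ->.
have s1 := smooth_near_transition pq qq.
apply: smooth_near_comp.
  by apply: smooth_near_comp => //; rewrite /= chartK.
by rewrite /= /map_rep /= !chartK//; exact: smooth_near_transition.
Qed.

(** Chain rule through the preferred charts of [q] and [f q], in which [tangent_map] is defined. *)
Lemma jacobian_map_rep p p' q : dom p q -> dom p' (f q) ->
  jacobian (map_rep p p') (chart p q) =
  trans_jac p q q *m tangent_map f q *m trans_jac (f q) p' (f q).
Proof.
move=> pq p'q; have qq := dom_center q; have fqq := dom_center (f q).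
have s1 := smooth_near_differentiable (smooth_near_transition pq qq).
have s2 := smooth_near_differentiable (map_rep_smooth qq fqq).
have s3 := smooth_near_differentiable (smooth_near_transition fqq p'q).
have E1 : (chart q \o chartI p) (chart p q) = chart q q by rewrite /= chartK.
have E2 : (map_rep q (f q) \o (chart q \o chartI p)) (chart p q) = chart (f q) (f q).
  by rewrite /= chartK// map_repE.
have s2' : differentiable (map_rep q (f q)) ((chart q \o chartI p) (chart p q)) by rewrite E1.
have s12 : differentiable (map_rep q (f q) \o (chart q \o chartI p)) (chart p q).
  exact: differentiable_comp.
have s3' : differentiable (chart p' \o chartI (f q))
  ((map_rep q (f q) \o (chart q \o chartI p)) (chart p q)) by rewrite E2.
have -> : jacobian (map_rep p p') (chart p q) = jacobian
    ((chart p' \o chartI (f q)) \o (map_rep q (f q) \o (chart q \o chartI p))) (chart p q).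
  apply: near_eq_jacobian; first exact: near_map_rep.
  exact: smooth_near_differentiable (map_rep_smooth pq p'q).
rewrite (jacobian_comp s12 s3') (jacobian_comp s1 s2') E1 E2.
by rewrite -!trans_jacE.
Qed.

End MapRep.

(** * Sasaki-like structures in one chart *)

Section SasakiCoordinates.
Variables (R : realType) (n : nat) (M : smoothManifold R n.*2.+1).
Variables (phi : endofield M) (xi : vfield M) (eta : formfield M) (g : bilinfield M).
Variable D : connection M.
Hypothesis acr : almost_contact_complex_riemannian phi xi eta g.
Hypothesis lc : levi_civita g D.
Hypothesis sas : sasaki_like phi xi eta g D.
Implicit Types P q : M.
Let cD := lc_connection lc.

Lemma rep_g_tr P q : dom P q -> (bilin_rep g P (chart P q))^T = bilin_rep g P (chart P q).
Proof.
move=> Pq; apply: bilin_inj => u v.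
by rewrite -bilin_tr !bilin_repE// (acr_g_sym acr).
Qed.

Lemma rep_cov_xi P q w : dom P q ->
  'D_w (vrep P xi) (chart P q) + vrep P xi (chart P q) *m christ D P (chart P q) w =
  - (w *m endo_rep phi P (chart P q)).
Proof.
move=> Pq; have := conn_rep cD (w *m trans_jac P q q) Pq (acr_xi_smooth acr q).
by rewrite (cov_xi acr lc sas) trans_jacVK// mulNmx => <-; rewrite endo_repE.
Qed.

Lemma rep_eta P q : dom P q ->
  form_rep eta P (chart P q) = bilin_rep g P (chart P q) *m (vrep P xi (chart P q))^T.
Proof.
move=> Pq; apply/row_matrixP => i; rewrite !rowE.
apply/rowP => j; rewrite (ord1 j).
transitivity (covec (eta q) (delta_mx 0 i *m trans_jac P q q)); first exact: form_repE.
rewrite (acr_eta_g acr).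
transitivity (bilin (bilin_rep g P (chart P q)) (delta_mx 0 i) (vrep P xi (chart P q))).
  by rewrite bilin_repE// (vrepE xi Pq) trans_jacKV.
by move: (bilin_rep g P _) => A; rewrite /bilin mulmxA.
Qed.

Lemma rep_eta_xi P q : dom P q ->
  vrep P xi (chart P q) *m form_rep eta P (chart P q) = 1%:M.
Proof.
move=> Pq; rewrite [LHS]mx11_scalar; congr (_%:M).
transitivity (covec (eta q) (xi q)); last exact: (acr_eta_xi acr q).
transitivity (covec (form_rep eta P (chart P q)) (vrep P xi (chart P q))); first by [].
by rewrite form_repE// (vrepE xi Pq) trans_jacKV.
Qed.

Lemma rep_eta_closed P : \forall x \near chart P P, forall u v,
  u *m 'D_v (form_rep eta P) x = v *m 'D_u (form_rep eta P) x.
Proof.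
have PP := dom_center P.
have near_chartP (Q : 'rV[R]_(n.*2.+1) -> Prop) :
    (forall q : M, dom P q -> Q (chart P q)) -> \forall y \near chart P P, Q y.
  move=> H; apply: filterS (near_chart PP) => y Uy.
  by rewrite -(chartIK Uy); apply: H; exact: dom_chartI.
(* The hypersurface formula is reused with the identity as map [f]. *)
have := @derive_eta R _ _ id (bilin_rep g P) (endo_rep phi P) (vrep P xi) (form_rep eta P)
  (christ D P) (chart P P) (bilin_rep_smooth (acr_g_smooth acr) PP) (acr_xi_smooth acr P).
have metP : \forall y \near chart P P, forall w, 'D_w (bilin_rep g P) y =
    christ D P y w *m bilin_rep g P y + bilin_rep g P y *m (christ D P y w)^T.
  by apply: near_chartP => q Pq w; exact: (christ_metric lc (acr_g_smooth acr) _ Pq).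
have covP : \forall y \near chart P P, forall w,
    'D_w (vrep P xi) y + vrep P xi y *m christ D P y w = - (w *m endo_rep phi P y).
  by apply: near_chartP => q Pq w; exact: rep_cov_xi.
have etaP : \forall y \near chart P P, form_rep eta P y = bilin_rep g P y *m (vrep P xi y)^T.
  by apply: near_chartP => q; exact: rep_eta.
have symP : \forall y \near chart P P, forall w w',
    w' *m christ D P y w = w *m christ D P y w'.
  by apply: near_chartP => q Pq w w'; exact: (christ_sym cD lc _ _ Pq).
have phiP : \forall y \near chart P P, forall u v,
    bilin (bilin_rep g P y) u (v *m endo_rep phi P y) =
    bilin (bilin_rep g P y) v (u *m endo_rep phi P y).
  apply: near_chartP => q Pq u v.
  rewrite !bilin_repE// !endo_repE// !trans_jacKV//.
  by rewrite (acr_g_sym acr) (acr_phi_sym acr).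
move=> /(_ metP covP etaP) deta.
apply: filterS2 deta (filterI symP phiP) => y De [Sy Py] u v.
rewrite [X in u *m X]De [X in v *m X]De.
move: (christ D P y) (form_rep eta P y) (bilin_rep g P y) (endo_rep phi P y) Sy Py.
move=> Gam e G Phi Sy Py.
rewrite !mulmxBr !mulmxA Sy; congr (_ - _); apply/matrixP => i j.
by rewrite !ord1; exact: Py.
Qed.

End SasakiCoordinates.

(** * The structure induced on an integral submanifold *)

Section IntegralSubmanifold.
Variables (R : realType) (n : nat) (M : smoothManifold R n.*2.+1).
Variables (phi : endofield M) (xi : vfield M) (eta : formfield M) (g : bilinfield M).
Variable D : connection M.
Hypothesis acr : almost_contact_complex_riemannian phi xi eta g.
Hypothesis lc : levi_civita g D.
Hypothesis sas : sasaki_like phi xi eta g D.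
Variables (N : smoothManifold R n.*2) (iota : N -> M).
Hypothesis sub : integral_submanifold (ker_form eta) iota.
Local Notation k := n.*2.
Local Notation m := n.*2.+1.
Local Notation T := (tangent_map iota).
Local Notation h := (pullback_form iota g).
Implicit Types (q : N) (u v : 'rV[R]_k).
Let cD := lc_connection lc.
Let sg := acr_g_smooth acr.

Let siota : smooth_map iota. Proof. by have [] := sub. Qed.

Lemma tangent_free q : row_free (T q).
Proof. by have [_ _ H _] := sub; exact: H. Qed.

Lemma tangent_ker q v : covec (eta (iota q)) (v *m T q) = 0.
Proof.
have [_ _ _ /(_ q) E] := sub.
by have : ker_form eta (iota q) (v *m T q) by rewrite -E; exists v.
Qed.

Lemma ker_tangent q w : covec (eta (iota q)) w = 0 -> exists v, w = v *m T q.
Proof.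
have [_ _ _ /(_ q) E] := sub; move=> w0.
have : ker_form eta (iota q) w by [].
by rewrite -E => -[v _ <-]; exists v.
Qed.

(** Since [eta (phi u) = 0], the rows of [T phi] lie in the row space of [T], and the pseudo-inverse
    solves [J T = T phi]. *)
Lemma restr_phi_exists : exists J : endofield N, restricts_endo iota phi J.
Proof.
exists (fun q => T q *m phi (iota q) *m pinvmx (T q)) => q v.
rewrite -[LHS]mulmxA mulmxKpV ?mulmxA//; apply/row_subP => i.
have [|w ->] := @ker_tangent q (row i (T q *m phi (iota q))); last exact: submxMl.
by rewrite row_mul (acr_eta_phi acr).
Qed.

Variable restr_phi : endofield N.
Hypothesis restr_phi_restricts : restricts_endo iota phi restr_phi.

Lemma restr_phi2 q v : v *m restr_phi q *m restr_phi q = - v.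
Proof.
apply: (row_free_inj (tangent_free q)).
rewrite !restr_phi_restricts.
by rewrite (acr_phi2 acr) tangent_ker scale0r addr0 mulNmx.
Qed.

Lemma pullbackE q u v : bilin (h q) u v = bilin (g (iota q)) (u *m T q) (v *m T q).
Proof. by rewrite /bilin /pullback_form trmx_mul !mulmxA. Qed.

Lemma pullback_sym q u v : bilin (h q) u v = bilin (h q) v u.
Proof. by rewrite !pullbackE (acr_g_sym acr). Qed.

Lemma pullback_tr q : (h q)^T = h q.
Proof. by apply: bilin_inj => u v; rewrite -bilin_tr pullback_sym. Qed.

Lemma pullback_phi q u v :
  bilin (h q) (u *m restr_phi q) (v *m restr_phi q) = - bilin (h q) u v.
Proof.
rewrite !pullbackE !restr_phi_restricts (acr_g_phi acr) !tangent_ker.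
by rewrite mulr0 addr0.
Qed.

(** A tangent vector of the leaf is orthogonal to [xi], as [eta] vanishes on it. If it is also
    orthogonal to the leaf, it is orthogonal to every ambient vector. *)
Lemma pullback_unit q : h q \in unitmx.
Proof.
rewrite -row_free_unit; apply: inj_row_free => v vh.
apply: (row_free_inj (tangent_free q)); rewrite mul0mx.
apply: (bilin_nondeg (acr_g_unit acr (iota q))) => w.
have [|w' E] := @ker_tangent q (horiz xi eta (iota q) w); first exact: (horiz_ker acr).
rewrite (horizE xi eta (iota q) w) bilinDr bilinZr -(acr_eta_g acr) tangent_ker mulr0 addr0.
by rewrite E -pullbackE /bilin vh mul0mx mxE.
Qed.

Lemma pullback_signature q : has_signature n n (h q).
Proof.
apply: (@neutral_signature _ _ _ (restr_phi q)); [exact: pullback_tr|exact: pullback_unit|].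
apply: bilin_inj => u v; have := pullback_phi q u v.
rewrite bilin_mulmxl bilin_mulmxr => ->.
by rewrite /bilin mulmxN mulNmx [RHS]mxE.
Qed.

Section AtPoint.
Variable p : N.
Local Notation f := (map_rep iota p (iota p)).
Local Notation x0 := (chart p p).
Local Notation P := (iota p).

Let good x := (chart p @` dom p) x /\ dom P (iota (chartI p x)).

Lemma near_good : \forall x \near x0, good x.
Proof.
have pp := dom_center p; have PP := dom_center P.
exact: filterI (near_chart pp) (near_map siota pp PP).
Qed.

Lemma goodE x : good x -> exists q, [/\ dom p q, x = chart p q, dom P (iota q),
    f x = chart P (iota q) & jacobian f x = trans_jac p q q *m T q *m trans_jac (iota q) P (iota q)].
Proof.
move=> [Ux Px]; exists (chartI p x); have px := dom_chartI Ux.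
split=> //; first by rewrite chartIK.
by have := jacobian_map_rep siota px Px; rewrite (chartIK Ux).
Qed.

Lemma rep0 : f x0 = chart P P.
Proof. exact: map_repE (dom_center p). Qed.

Lemma rep_smooth : smooth_near f x0.
Proof. exact: map_rep_smooth (dom_center p) (dom_center P). Qed.

Lemma jacobian0 : jacobian f x0 = T p.
Proof.
rewrite jacobian_map_rep//; try exact: dom_center.
by rewrite !trans_jac1; try exact: dom_center; rewrite mul1mx mulmx1.
Qed.

(** Identifies the induced metric of the coordinate computation with the pullback form, so that a
    Levi-Civita connection of the latter satisfies the hypotheses made there. *)
Lemma hmet_pullback x : good x -> hmet f (bilin_rep g P) x = bilin_rep h p x.
Proof.
move=> /goodE[q [pq xE Pq E JE]]; rewrite /hmet JE E xE.
apply: bilin_inj => u v; rewrite bilin_repE// pullbackE.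
set C := trans_jac (iota q) P (iota q); set A := _ *m T q *m C.
transitivity (bilin (bilin_rep g P (chart P (iota q))) (u *m A) (v *m A)).
  by move: A (bilin_rep g P _) => A B; rewrite /bilin trmx_mul !mulmxA.
by rewrite bilin_repE// /A /C !mulmxA !trans_jacKV.
Qed.

Let PP := dom_center P.
Let pp := dom_center p.

Lemma near_hmet : \forall x \near x0, hmet f (bilin_rep g P) x = bilin_rep h p x.
Proof. by apply: filterS near_good => x; exact: hmet_pullback. Qed.

Lemma hmet_smooth : smooth_near (hmet f (bilin_rep g P)) x0.
Proof.
have sT := smooth_near_jacobian rep_smooth.
have sG : smooth_near (fun x => bilin_rep g P (f x)) x0.
  by apply: smooth_near_comp; [exact: rep_smooth|rewrite rep0; exact: bilin_rep_smooth].
apply: smooth_near_mulmx; last exact: smooth_near_trmx.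
exact: smooth_near_mulmx.
Qed.

Lemma pullback_rep_smooth : smooth_near (bilin_rep h p) x0.
Proof. exact: eq_smooth_near near_hmet hmet_smooth. Qed.

Lemma near_JT : \forall x \near x0,
  endo_rep restr_phi p x *m jacobian f x = jacobian f x *m endo_rep phi P (f x).
Proof.
apply: filterS near_good => x /goodE[q [pq xE Pq E JE]].
rewrite JE E xE; apply/row_matrixP => i; rewrite !rowE.
rewrite [LHS]mulmxA (endo_repE _ _ pq) [RHS]mulmxA (endo_repE _ _ Pq) !mulmxA.
by rewrite !trans_jacKV// restr_phi_restricts.
Qed.

(** [restr_phi] is given pointwise only. Solving [T phi G T^T = J h] for [J] expresses it through
    smooth matrices. *)
Lemma restr_phi_rep_smooth : smooth_near (endo_rep restr_phi p) x0.
Proof.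
have sT := smooth_near_jacobian rep_smooth.
have sG : smooth_near (fun x => bilin_rep g P (f x)) x0.
  by apply: smooth_near_comp; [exact: rep_smooth|rewrite rep0; exact: bilin_rep_smooth].
have sP : smooth_near (fun x => endo_rep phi P (f x)) x0.
  apply: smooth_near_comp; first exact: rep_smooth.
  by rewrite rep0; exact: endo_rep_smooth (acr_phi_smooth acr) PP.
have h0 : hmet f (bilin_rep g P) x0 \in unitmx.
  by rewrite (nbhs_singleton near_hmet) bilin_rep_center pullback_unit.
have sd := smooth_near_det hmet_smooth.
have d0 : \det (hmet f (bilin_rep g P) x0) != 0 by rewrite -unitfE -unitmxE.
have nd : \forall x \near x0, \det (hmet f (bilin_rep g P) x) != 0.
  exact: cvgr_neq0 _ (smooth_near_continuous sd) d0.
have sX := smooth_near_mulmx (smooth_near_mulmx (smooth_near_mulmx sT sP) sG) (smooth_near_trmx sT).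
have := smooth_near_mulmx sX (smooth_near_invmx h0 hmet_smooth).
apply: eq_smooth_near; apply: filterS2 near_JT nd => x JTx dx.
have hx : hmet f (bilin_rep g P) x \in unitmx by rewrite unitmxE unitfE.
have E : jacobian f x *m endo_rep phi P (f x) *m bilin_rep g P (f x) *m (jacobian f x)^T =
    endo_rep restr_phi p x *m hmet f (bilin_rep g P) x.
  rewrite -JTx /hmet; move: (endo_rep restr_phi p x) (bilin_rep g P (f x)) => A B.
  by rewrite !mulmxA.
by rewrite E (mulmxK hx).
Qed.

End AtPoint.

Lemma pullback_smooth : bilinfield_smooth h.
Proof.
move=> p X Y sX sY; have pp := dom_center p.
have := smooth_near_mulmx (smooth_near_mulmx sX (pullback_rep_smooth p)) (smooth_near_trmx sY).
move/smooth_near_mxP/(_ 0 0); apply: eq_smooth_near.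
apply: filterS (near_chart pp) => x Ux; have px := dom_chartI Ux.
by have := bilin_vrep h X Y px; rewrite (chartIK Ux).
Qed.

Lemma restr_phi_smooth : endofield_smooth restr_phi.
Proof.
move=> p X sX; have pp := dom_center p.
apply: eq_smooth_near (smooth_near_mulmx sX (restr_phi_rep_smooth p)).
apply: filterS (near_chart pp) => x Ux; have px := dom_chartI Ux.
by rewrite -(chartIK Ux) vrep_endo.
Qed.

Lemma pullback_metric : pseudo_riemannian_metric n n h.
Proof.
split; [exact: pullback_smooth|exact: pullback_sym|exact: pullback_signature].
Qed.

(** * The coordinate computation applied to a leaf *)

Section Gauss.
Variables (p : N) (Dh : connection N).
Hypothesis lch : levi_civita h Dh.
Let cDh := lc_connection lch.
Local Notation f := (map_rep iota p (iota p)).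
Local Notation x0 := (chart p p).
Local Notation P := (iota p).
Local Notation y0 := (f x0).
Let PP := dom_center P.
Let pp := dom_center p.

Lemma near_y0 (Q : 'rV[R]_m -> Prop) :
  (forall q : M, dom P q -> Q (chart P q)) -> \forall y \near y0, Q y.
Proof.
move=> H; rewrite rep0; apply: filterS (near_chart PP) => y Uy.
by rewrite -(chartIK Uy); apply: H; exact: dom_chartI.
Qed.

Lemma near_x0 (Q : 'rV[R]_k -> Prop) :
  (forall q, dom p q -> Q (chart p q)) -> \forall x \near x0, Q x.
Proof.
move=> H; apply: filterS (near_chart pp) => y Uy.
by rewrite -(chartIK Uy); apply: H; exact: dom_chartI.
Qed.

Let G := bilin_rep g P.
Let Phi := endo_rep phi P.
Let xir := vrep P xi.
Let etar := form_rep eta P.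
Let Gam := christ D P.
Let Gamh := christ Dh p.

Let sf : smooth_near f x0. Proof. exact: rep_smooth. Qed.
Let sG : smooth_near G y0. Proof. by rewrite rep0; exact: bilin_rep_smooth. Qed.
Let sPhi : smooth_near Phi y0.
Proof. by rewrite rep0; exact: (endo_rep_smooth (acr_phi_smooth acr) PP). Qed.
Let sxi : smooth_near xir y0. Proof. by rewrite rep0; exact: (acr_xi_smooth acr P). Qed.
Let seta : smooth_near etar y0.
Proof. by rewrite rep0; exact: (form_rep_smooth (acr_eta_smooth acr) PP). Qed.
Let sGam w : smooth_near (fun y => Gam y w) y0.
Proof. by rewrite rep0; exact: christ_smooth. Qed.
Let linGam : \forall y \near y0, linear (Gam y).
Proof. by rewrite rep0; exact: (near_christ_linear lc PP). Qed.
Let symGam : \forall y \near y0, forall w w', w' *m Gam y w = w *m Gam y w'.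
Proof. by apply: near_y0 => q Pq w w'; exact: (christ_sym cD lc _ _ Pq). Qed.
Let metG : \forall y \near y0, forall w,
  'D_w G y = Gam y w *m G y + G y *m (Gam y w)^T.
Proof. by apply: near_y0 => q Pq w; exact: (christ_metric lc sg _ Pq). Qed.

Let trG : \forall y \near y0, (G y)^T = G y.
Proof. by apply: near_y0 => q; exact: rep_g_tr acr _ _. Qed.
Let covxi : \forall y \near y0, forall w, 'D_w xir y + xir y *m Gam y w = - (w *m Phi y).
Proof. by apply: near_y0 => q Pq w; exact: (rep_cov_xi acr lc sas _ Pq). Qed.
Let etaE : \forall y \near y0, etar y = G y *m (xir y)^T.
Proof. by apply: near_y0 => q; exact: rep_eta acr _ _. Qed.
Let eta_xi : \forall y \near y0, xir y *m etar y = 1%:M.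
Proof. by apply: near_y0 => q; exact: rep_eta_xi acr _ _. Qed.

Let Teta : \forall x \near x0, jacobian f x *m etar (f x) = 0.
Proof.
apply: filterS (near_good p) => x /goodE[q [pq xE Pq E JE]].
apply/row_matrixP => i; rewrite row0 rowE; apply/rowP => j; rewrite (ord1 j) [RHS]mxE mulmxA.
transitivity (covec (etar (chart P (iota q))) (delta_mx 0 i *m jacobian f x)); first by rewrite -E.
by rewrite /etar form_repE// JE !mulmxA trans_jacKV// tangent_ker.
Qed.

Let kerT : \forall x \near x0, forall W : 'M[R]_(k, m),
  W *m etar (f x) = 0 -> exists A, W = A *m jacobian f x.
Proof.
apply: filterS (near_good p) => x /goodE[q [pq xE Pq E JE]] W We.
have H i : exists v, row i W *m trans_jac P (iota q) (iota q) = v *m T q.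
  apply: ker_tangent; rewrite -form_repE// -E /covec -row_mul We.
  by rewrite row0 mxE.
have [B BE] := choice H.
exists (\matrix_i B i *m trans_jac q p q); rewrite JE !mulmxA.
apply/row_matrixP => i; rewrite !row_mul rowK.
by rewrite trans_jacKV// -BE trans_jacVK.
Qed.

Let unith : \forall x \near x0, hmet f G x \in unitmx.
Proof.
have h0 : hmet f G x0 \in unitmx.
  by rewrite (nbhs_singleton (near_hmet p)) bilin_rep_center pullback_unit.
have sd := smooth_near_det (hmet_smooth p).
have d0 : \det (hmet f G x0) != 0 by rewrite -unitfE -unitmxE.
have nd : \forall x \near x0, \det (hmet f G x) != 0.
  exact: cvgr_neq0 _ (smooth_near_continuous sd) d0.
by apply: filterS nd => x dx; rewrite unitmxE unitfE.
Qed.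

Let sGamh u : smooth_near (fun x => Gamh x u) x0. Proof. exact: christ_smooth. Qed.
Let symGamh : \forall x \near x0, forall u v, v *m Gamh x u = u *m Gamh x v.
Proof. by apply: near_x0 => q pq u v; exact: (christ_sym cDh lch _ _ pq). Qed.

Let meth : \forall x \near x0, forall u,
  'D_u (hmet f G) x = Gamh x u *m hmet f G x + hmet f G x *m (Gamh x u)^T.
Proof.
have H : \forall x \near x0, forall u, 'D_u (bilin_rep h p) x =
    Gamh x u *m bilin_rep h p x + bilin_rep h p x *m (Gamh x u)^T.
  by apply: near_x0 => q pq u; exact: (christ_metric lch pullback_smooth _ pq).
apply: filterS2 H (near_join (near_hmet p)) => x Hx nx u.
have <- : bilin_rep h p x = hmet f G x by exact/esym/(nbhs_singleton nx).
by rewrite -Hx; exact: near_eq_derive.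
Qed.

Let covPhi u v : v *m jacobian f x0 *m endo_cov (Gam y0) Phi y0 (u *m jacobian f x0) =
  - bilin (G y0) (u *m jacobian f x0) (v *m jacobian f x0) *: xir y0.
Proof.
rewrite !rep0 !jacobian0 /G bilin_rep_center /xir vrep_center.
exact: (nabla_phi_horiz acr lc sas _ (tangent_ker p v)).
Qed.

Lemma restr_phi_parallel u Y : vfield_smooth_at p Y -> cov_endo Dh restr_phi p u Y = 0.
Proof.
move=> sY; have := cov_endo_rep cDh u restr_phi_smooth pp sY.
rewrite trans_jac1// !mulmx1 vrep_center => ->.
suff -> : endo_cov (Gamh x0) (endo_rep restr_phi p) x0 u = 0 by rewrite mulmx0.
apply: (@parallel_restriction _ _ _ f G Phi xir etar Gam Gamh x0) => //.
- exact: restr_phi_rep_smooth.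
- exact: near_JT.
- by rewrite rep0 /xir vrep_center /Phi endo_rep_center; exact: (acr_phi_xi acr).
- by rewrite jacobian0; exact: tangent_free.
Qed.

(** Both curvatures are tensorial by [curv4_coord], so agreement of the fields at the single point
    suffices, and [gauss_curvature] is evaluated on their values there. *)
Lemma gauss_equation (X' Y' Z' U' : vfield N) (X Y Z U : vfield M) :
  vfield_smooth_at p X' -> vfield_smooth_at p Y' -> vfield_smooth_at p Z' ->
  vfield_smooth_at P X -> vfield_smooth_at P Y -> vfield_smooth_at P Z ->
  X P = X' p *m T p -> Y P = Y' p *m T p -> Z P = Z' p *m T p -> U P = U' p *m T p ->
  curv4 g D X Y Z U P = curv4 h Dh X' Y' Z' U' p
   + bilin (g P) (X P *m phi P) (Z P) * bilin (g P) (Y P *m phi P) (U P)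
   - bilin (g P) (Y P *m phi P) (Z P) * bilin (g P) (X P *m phi P) (U P).
Proof.
move=> sX' sY' sZ' sX sY sZ XE YE ZE UE.
rewrite (curv4_coord lc _ sX sY sZ) (curv4_coord lch _ sX' sY' sZ') XE YE ZE UE.
have := @gauss_curvature _ _ _ f G Phi xir etar Gam Gamh x0 sf sG sPhi sxi seta sGam linGam
  symGam metG trG covxi etaE eta_xi Teta kerT unith sGamh symGamh meth (X' p) (Y' p).
rewrite /second_form !rep0 !jacobian0 (nbhs_singleton (near_hmet p)) bilin_rep_center.
rewrite /G bilin_rep_center /Phi endo_rep_center => E.
have SE (u z : 'rV[R]_k) : z *m (T p *m g P *m (u *m T p *m phi P)^T) =
    (bilin (g P) (u *m T p *m phi P) (z *m T p))%:M.
  by rewrite (acr_g_sym acr) -bilin_row1 !mulmxA.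
have SEt (u z : 'rV[R]_k) : (T p *m g P *m (u *m T p *m phi P)^T)^T *m z^T =
    (bilin (g P) (u *m T p *m phi P) (z *m T p))%:M.
  by rewrite -trmx_mul SE tr_scalar_mx.
move: E; set Rm := coord_curv _ (chart P P) _ _; set Rh := coord_curv _ x0 _ _ => E.
have := congr1 (fun B => (Z' p *m B *m (U' p)^T) 0 0) E.
rewrite /= => {}E.
transitivity ((Z' p *m (T p *m Rm *m g P *m (T p)^T) *m (U' p)^T) 0 0).
  by rewrite /bilin trmx_mul !mulmxA.
have T1 (u v : 'rV[R]_k) : Z' p *m (T p *m g P *m (u *m T p *m phi P)^T *m
    (T p *m g P *m (v *m T p *m phi P)^T)^T) *m (U' p)^T =
    (bilin (g P) (u *m T p *m phi P) (Z' p *m T p) *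
     bilin (g P) (v *m T p *m phi P) (U' p *m T p))%:M.
  by rewrite [Z' p *m _]mulmxA SE -[LHS]mulmxA SEt -scalar_mxM.
rewrite E mulmxDr mulmxBr mulmxDl mulmxBl !T1.
have -> : bilin (h p) (Z' p *m Rh) (U' p) = (Z' p *m (Rh *m h p) *m (U' p)^T) 0 0.
  by rewrite /bilin mulmxA.
move: (Z' p *m (Rh *m h p) *m _) => A.
by rewrite !mxE eqxx !mulr1n addrAC.
Qed.

End Gauss.

End IntegralSubmanifold.

(** * Integrability of closed forms *)

Section Primitive.
Variable R : realType.
Local Notation mu := (@lebesgue_measure R).

(** Differentiation under the integral sign with the constant [C] as dominating function, followed
    by the fundamental theorem of calculus for [Psi]. *)
Lemma is_derive_param_integral (phi d : R -> R -> R) (Psi : R -> R) (r C : R) : 0 < r ->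
  (forall t s : R, `|t| < r -> 0 <= s <= 1 -> derivable (phi t) s 1) ->
  (forall t s : R, `|t| < r -> 0 <= s <= 1 -> is_derive t 1 (phi^~ s) (d t s)) ->
  (forall t s : R, `|t| < r -> 0 <= s <= 1 -> `|d t s| <= C) ->
  (forall s : R, 0 <= s <= 1 -> derivable (d 0) s 1) ->
  (forall s : R, 0 <= s <= 1 -> is_derive s 1 Psi (d 0 s)) ->
  is_derive (0 : R) 1 (fun t => \int[mu]_(s in `[0, 1]) phi t s) (Psi 1 - Psi 0).
Proof.
move=> r0 phic phid dC dc Psid.
have C0 : 0 <= C by apply: le_trans (dC 0 0 _ _); rewrite ?normr0 ?lexx ?ler01.
have Ir (t : R) : `]-r, r[%classic t -> `|t| < r by rewrite /= in_itv/= ltr_norml.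
have Is (s : R) : `[0, 1]%classic s -> 0 <= s <= 1 by rewrite /= in_itv.
have I0 : `]-r, r[%classic (0 : R) by rewrite /= in_itv/= r0 oppr_lt0 r0.
have intf x : `]-r, r[%classic x -> mu.-integrable `[0, 1] (EFin \o phi x).
  move=> /Ir xr; apply: continuous_compact_integrable; first exact: segment_compact.
  by apply: derivable_within_continuous => s /Is s01; exact: phic.
have derf x y : `]-r, r[%classic x -> `[0, 1]%classic y -> derivable (phi^~ y) x 1.
  by move=> /Ir xr /Is y01; have [] := phid _ _ xr y01.
have pE x y : `]-r, r[%classic x -> `[0, 1]%classic y -> partial1of2 phi x y = d x y.
  by move=> /Ir xr /Is y01; rewrite partial1of2E; have [] := phid _ _ xr y01.
have intC : mu.-integrable `[0, 1] (EFin \o (cst C : R -> R)).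
  apply: continuous_compact_integrable; first exact: segment_compact.
  by apply: derivable_within_continuous => s _; exact: derivable_cst.
have ub x y : `]-r, r[%classic x -> `[0, 1]%classic y -> `|partial1of2 phi x y| <= cst C y.
  by move=> xr y01; rewrite pE//; apply: dC; [exact: Ir|exact: Is].
have C0' (y : R) : 0 <= cst C y by [].
apply: DeriveDef.
  exact: (@derivable_under_integral R _ _ mu phi `[0, 1] (measurable_itv _) 0 (- r) r
    I0 intf derf (cst C) C0' intC ub).
have := @differentiation_under_integral R _ _ mu phi `[0, 1] (measurable_itv _) 0 (- r) r
    I0 intf derf (cst C) C0' intC ub.
rewrite derive1E => ->.
transitivity (\int[mu]_(s in `[0, 1]) d 0 s).
  by apply: eq_Rintegral => s; rewrite inE => s01; rewrite pE.
have := @continuous_FTC2 R (d 0) Psi 0 1 ltr01.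
rewrite /Rintegral => -> //.
- by apply: derivable_within_continuous => s /Is s01; exact: dc.
- split.
  + move=> s; rewrite in_itv/= => /andP[s0 s1].
    by have [] := Psid s _; rewrite ?(ltW s0) ?(ltW s1).
  + apply: cvg_at_right_filter; apply/differentiable_continuous/derivable1_diffP.
    by have [] := Psid 0 _; rewrite ?lexx ?ler01.
  + apply: cvg_at_left_filter; apply/differentiable_continuous/derivable1_diffP.
    by have [] := Psid 1 _; rewrite ?lexx ?ler01.
- move=> s; rewrite in_itv/= => /andP[s0 s1]; rewrite derive1E.
  by have [] := Psid s _; rewrite ?(ltW s0) ?(ltW s1).
Qed.

Lemma mx_coord_le m n (A : 'M[R]_(m, n)) i j : `|A i j| <= `|A|.
Proof.
by rewrite {2}/Num.Def.normr/= mx_normrE; exact: (le_bigmax _ (fun i => `|A i.1 i.2|) (i, j)).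
Qed.

Lemma covec_bound m (w : 'cV[R]_m) (u : 'rV[R]_m) : `|covec w u| <= m%:R * `|u| * `|w|.
Proof.
rewrite /covec mxE; apply: le_trans (ler_norm_sum _ _ _) _.
apply: (@le_trans _ _ (\sum_(j < m) `|u| * `|w|)).
  by apply: ler_sum => j _; rewrite normrM; apply: ler_pM => //; exact: mx_coord_le.
by rewrite sumr_const card_ord -[X in X <= _]mulr_natl mulrA.
Qed.

(** Unlike [is_derive_line] it applies to a primitive of which only directional derivatives are
    known. *)
Lemma is_derive_line_dir (V W : normedModType R) (f : V -> W) x v (r : R) D :
  is_derive (r *: v + x) v f D -> is_derive r 1 (fun s => f (s *: v + x)) D.
Proof.
have E : (fun h : R => h^-1 *: (((fun s => f (s *: v + x)) \o shift r) (h *: 1) - f (r *: v + x)))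
  = (fun h => h^-1 *: ((f \o shift (r *: v + x)) (h *: v) - f (r *: v + x))).
  apply/funext => h /=; congr (_ *: (f _ - _)).
  by rewrite [h *: 1]mulr1 scalerDl addrA.
move=> [d1 d2]; apply: DeriveDef; first by rewrite /derivable E.
by rewrite -d2 /derive E.
Qed.

Lemma derive_dir_line (V W : normedModType R) (f : V -> W) x v D :
  is_derive (0 : R) 1 (fun s => f (s *: v + x)) D -> is_derive x v f D.
Proof.
have E : (fun h : R => h^-1 *: (((fun s => f (s *: v + x)) \o shift 0) (h *: 1) - f (0 *: v + x)))
  = (fun h => h^-1 *: ((f \o shift x) (h *: v) - f x)).
  apply/funext => h /=; rewrite scale0r add0r addr0.
  by rewrite [h *: 1]mulr1.
move=> [d1 d2]; apply: DeriveDef.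
  by move: d1; rewrite /derivable E.
by rewrite -d2 /derive E.
Qed.

End Primitive.

(** * The Poincare lemma for closed 1-forms *)

Section Poincare.
Variables (R : realType) (m : nat).
Implicit Types (w : 'rV[R]_m -> 'cV[R]_m) (x y z u v : 'rV[R]_m).

Lemma continuous_for_sum (V : normedModType R) I (s : seq I) (F : I -> V -> R) (t : V) :
  (forall i, {for t, continuous (F i)}) ->
  {for t, continuous (fun t : V => \sum_(i <- s) F i t)}.
Proof.
move=> cF; elim: s => [|i s IH].
  have -> : (fun t => \sum_(i <- [::]) F i t) = (fun=> 0 : R).
    by apply/funext => z'; rewrite big_nil.
  exact: cvg_cst.
have -> : (fun t => \sum_(j <- i :: s) F j t) = F i \+ (fun t => \sum_(j <- s) F j t).
  by apply/funext => z'; rewrite big_cons.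
exact: continuousD.
Qed.

Lemma smooth_near_covec w z u : smooth_near w z -> smooth_near (fun x => covec (w x) u) z.
Proof.
move=> sw; have := smooth_near_mulmx (smooth_near_cst u z) sw.
by move/smooth_near_mxP/(_ 0 0).
Qed.

Lemma derive_covec w z u v : smooth_near w z ->
  'D_v (fun x => covec (w x) u) z = covec ('D_v w z) u.
Proof.
move=> sw; rewrite /covec -(derive_mulmxl u (smooth_near_derivable sw)).
by rewrite -derivable_mxij//; apply: smooth_near_derivable;
   exact: smooth_near_mulmx (smooth_near_cst u z) sw.
Qed.

Lemma is_derive_covec_line w x u v (s : R) : smooth_near w (s *: v + x) ->
  is_derive s 1 (fun s => covec (w (s *: v + x)) u) (covec ('D_v w (s *: v + x)) u).
Proof.
move=> sw; rewrite -derive_covec//.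
by apply: is_derive_line; exact: smooth_near_differentiable (smooth_near_covec u sw).
Qed.

Lemma covecZl (a : R) (w : 'cV[R]_m) u : covec (a *: w) u = a * covec w u.
Proof. by rewrite /covec -scalemxAr mxE. Qed.

Lemma ball_segment x0 (r : R) y (s : R) : ball x0 r y -> 0 <= s <= 1 ->
  ball x0 r (s *: (y - x0) + x0).
Proof.
rewrite -!ball_normE /ball_/= => yr /andP[s0 s1].
rewrite opprD addrCA addrN addr0 normrN normrZ ger0_norm//.
by apply: le_lt_trans yr; rewrite distrC ler_piMl.
Qed.

(** [F(y)] integrates [w] along the segment from [x0] to [y]. After differentiation under the
    integral, closedness turns the integrand into [d/ds (s w(x0 + s (y - x0)) v)], whose integral is
    [w(y) v]. *)
Lemma poincare w x0 : smooth_near w x0 ->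
  (\forall x \near x0, forall u v, u *m 'D_v w x = v *m 'D_u w x) ->
  exists r F, 0 < r /\ forall y, ball x0 r y ->
    smooth_near w y /\ forall v, is_derive y v F (covec (w y) v).
Proof.
move=> sw cl.
(* Controls all directional derivatives of [w], by [|D_v w| <= |v| K]; local bounds on [K] and on
   [w] give the dominating constant. *)
pose K z := \sum_i `|'D_(delta_mx 0 i) w z|.
have cK : {for x0, continuous K}.
  apply: continuous_for_sum => i.
  have H : {for x0, continuous (fun z => 'D_(delta_mx 0 i) w z)}.
    exact: smooth_near_continuous (smooth_near_derive (delta_mx 0 i) sw).
  by apply: (@continuous_comp _ _ _ (fun z => 'D_(delta_mx 0 i) w z) (fun A => `|A|)) => //;
    exact: norm_continuous.
have lt1 (c : R) : c < c + 1 by rewrite ltrDl.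
have nK : \forall z \near x0, K z < K x0 + 1 by exact: (cvgr_lt _ cK _ (lt1 _)).
have cw : {for x0, continuous (fun z => `|w z|)}.
  apply: (@continuous_comp _ _ _ w (fun A => `|A|)); last exact: norm_continuous.
  exact: smooth_near_continuous.
have nw : \forall z \near x0, `|w z| < `|w x0| + 1 by exact: (cvgr_lt _ cw _ (lt1 _)).
have : \forall z \near x0, [/\ smooth_near w z, forall u v, u *m 'D_v w z = v *m 'D_u w z,
    K z < K x0 + 1 & `|w z| < `|w x0| + 1].
  by apply: filterS2 (filterI (smooth_near_near sw) cl) (filterI nK nw) => z [? ?] [? ?].
move=> /nbhs_ballP[r /= r0 Hr].
exists r, (fun y => \int[@lebesgue_measure R]_(s in `[0, 1])
    covec (w (s *: (y - x0) + x0)) (y - x0)); split=> // y yr.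
split=> [|v]; first by have [] := Hr y yr.
pose a := y - x0.
have [rho [rho0 yrho]] : exists rho : R, 0 < rho /\ forall t, `|t| < rho -> ball x0 r (t *: v + y).
  exists ((r - `|x0 - y|) / (`|v| + 1)).
  have yr' : 0 < r - `|x0 - y| by move: yr; rewrite -ball_normE /ball_/= subr_gt0.
  have v0 : 0 < `|v| + 1 by rewrite ltr_wpDl.
  split=> [|t]; first exact: divr_gt0.
  rewrite ltr_pdivlMr// => tr; rewrite -ball_normE /ball_/= opprD addrCA.
  apply: le_lt_trans (ler_normD _ _) _; rewrite normrN normrZ.
  have := normr_ge0 t; move: tr; rewrite mulrDr mulr1; lra.
pose pt (t s : R) := s *: (t *: v + a) + x0.
have ptb (t s : R) : `|t| < rho -> 0 <= s <= 1 -> ball x0 r (pt t s).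
  move=> tr s01; rewrite /pt /a addrA; apply: ball_segment s01; exact: yrho.
have spt (t s : R) : `|t| < rho -> 0 <= s <= 1 -> smooth_near w (pt t s).
  by move=> tr s01; have [] := Hr _ (ptb _ _ tr s01).
have t0 : `|0 : R| < rho by rewrite normr0.
have pt0 s : pt 0 s = s *: a + x0 by rewrite /pt scale0r add0r.
pose phi (t s : R) := covec (w (pt t s)) (t *: v + a).
pose d (t s : R) := covec (w (pt t s)) v + s * covec ('D_v w (pt t s)) (t *: v + a).
(* By closedness its derivative is [d 0 s]: the product rule gives [(D_a w) v] where [d 0] has
   [(D_v w) a]. *)
pose Psi s := s * covec (w (s *: a + x0)) v.
(* One summand for each term of [d], from [covec_bound] and the local bounds on [w] and [K]. *)
pose C := m%:R * `|v| * (`|w x0| + 1) + m%:R * (rho * `|v| + `|a|) * (`|v| * (K x0 + 1)).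
have K0 z : 0 <= K z by apply: sumr_ge0.
have bDv z : smooth_near w z -> `|'D_v w z| <= `|v| * K z.
  move=> /smooth_near_differentiable dz; rewrite derive_delta// mulr_sumr.
  apply: le_trans (ler_norm_sum _ _ _) _; apply: ler_sum => i _.
  by rewrite normrZ ler_wpM2r// mx_coord_le.
have := @is_derive_param_integral R phi d Psi rho C rho0.
have -> : Psi 1 - Psi 0 = covec (w y) v.
  by rewrite /Psi mul0r subr0 mul1r scale1r /a subrK.
move=> H; apply: derive_dir_line.
have -> : (fun s => \int[@lebesgue_measure R]_(s0 in `[0, 1])
     covec (w (s0 *: (s *: v + y - x0) + x0)) (s *: v + y - x0)) =
   (fun t => \int[@lebesgue_measure R]_(s in `[0, 1]) phi t s).
  by apply/funext => t; apply: eq_Rintegral => s _; rewrite /phi /pt /a addrA.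
apply: H.
- move=> t s tr s01.
  by have [] := is_derive_covec_line (t *: v + a) (spt _ _ tr s01).
- move=> t s tr s01.
  have E : pt t s = t *: (s *: v) + (s *: a + x0).
    by rewrite /pt scalerDr !scalerA (mulrC s) addrA.
  have sw' : smooth_near w (t *: (s *: v) + (s *: a + x0)) by rewrite -E; exact: spt.
  have dw := smooth_near_differentiable sw'.
  have [dB vB] := is_derive_line dw; have [dA vA] := is_derive_affine v a t.
  have [d1 d2] := is_derive_mulmx dA dB.
  have phE : phi^~ s = fun t => ((t *: v + a) *m w (t *: (s *: v) + (s *: a + x0))) 0 0.
    apply/funext => t'; rewrite /phi /covec; congr ((_ *m w _) 0 0).
    by rewrite /pt scalerDr !scalerA (mulrC s) addrA.
  rewrite phE; apply: DeriveDef.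
    exact: ((derivable_mxP _ _ _).1 d1).
  rewrite derivable_mxij// d2 vA vB mxE /d E /covec.
  have dl : forall b u z, 'D_(b *: u + z) w (t *: (s *: v) + (s *: a + x0)) =
     b *: 'D_u w (t *: (s *: v) + (s *: a + x0)) + 'D_z w (t *: (s *: v) + (s *: a + x0)).
    exact: derive_lin dw.
  have -> : 'D_(s *: v) w (t *: (s *: v) + (s *: a + x0)) =
     s *: 'D_v w (t *: (s *: v) + (s *: a + x0)).
    by have := dl s v 0; rewrite addr0 derive0 addr0.
  by rewrite -scalemxAr [X in _ + X]mxE.
- move=> t s tr s01; have [sp _ Kp wp] := Hr _ (ptb _ _ tr s01).
  apply: le_trans (ler_normD _ _) _; apply: lerD.
    apply: le_trans (covec_bound _ _) _; apply: ler_wpM2l; first by rewrite mulr_ge0.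
    exact: ltW.
  have /andP[s0 s1] := s01; rewrite normrM ger0_norm//.
  apply: (@le_trans _ _ `|covec ('D_v w (pt t s)) (t *: v + a)|).
    by rewrite ler_piMl.
  apply: le_trans (covec_bound _ _) _; apply: ler_pM; [by rewrite mulr_ge0|by []| |].
  + apply: ler_wpM2l => //; apply: le_trans (ler_normD _ _) _; rewrite normrZ lerD2r.
    by apply: ler_wpM2r => //; exact: ltW.
  + by apply: le_trans (bDv _ sp) _; apply: ler_wpM2l => //; exact: ltW.
- move=> s s01; have sp := spt 0 s t0 s01; rewrite pt0 in sp.
  have -> : d 0 = fun s => covec (w (s *: a + x0)) v + s * covec ('D_v w (s *: a + x0)) a.
    by apply/funext => s'; rewrite /d pt0 scale0r add0r.
  have d1 := is_derive_covec_line v sp.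
  have d2 := is_derive_covec_line a (smooth_near_derive v sp).
  by have [] := is_deriveD d1 (is_deriveM (is_derive_id s 1) d2).
- move=> s s01; have sp := spt 0 s t0 s01; rewrite pt0 in sp.
  have H1 := is_derive_covec_line v sp.
  have := is_deriveM (is_derive_id s 1) H1.
  have [_ clp _ _] := Hr _ (ptb 0 s t0 s01).
  rewrite /d pt0 scale0r add0r => H2; apply: is_derive_eq H2 _.
  rewrite /GRing.scale/= mulr1 addrC; congr (_ + s * _).
  by rewrite /covec -pt0 clp.
Qed.

End Poincare.

(** * Leaves as graphs over the kernel at a point *)

Section IntegralGraph.
Variable R : realType.

Lemma smooth_near_Ck (V W : normedModType R) (U : set V) (f : V -> W) j :
  (forall x, U x -> smooth_near f x) -> Ck j U f.
Proof.
elim: j f => [|j IH] f sf /=.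
  by move=> x Ux; apply: smooth_near_continuous; exact: sf.
split=> [x Ux|v]; first by apply: smooth_near_differentiable; exact: sf.
by apply: IH => x Ux; apply: smooth_near_derive; exact: sf.
Qed.

Lemma derive_scalarmx (V : normedModType R) (a : V -> R) x v l : smooth_near a x ->
  'D_v (fun z => (a z)%:M : 'M[R]_l) x = ('D_v a x)%:M.
Proof.
move=> sa; have sm : derivable (fun z => (a z)%:M : 'M[R]_l) x v.
  exact: smooth_near_derivable (smooth_near_scalarmx l sa).
apply/matrixP => i j; rewrite -(derivable_mxij _ _ sm) mxE.
under eq_fun do rewrite mxE.
by case: (i == j) => //; rewrite !mulr0n; exact: derive_cst.
Qed.

Lemma mulmx_row_bound k m (y : 'rV[R]_k) (A : 'M[R]_(k, m)) :
  `|y *m A| <= k%:R * `|y| * `|A|.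
Proof.
rewrite {1}/Num.Def.normr/= mx_normrE bigmax_le ?mulr_ge0// => -[i j] _ /=.
rewrite (ord1 i) mxE; apply: le_trans (ler_norm_sum _ _ _) _.
apply: (@le_trans _ _ (\sum_(l < k) `|y| * `|A|)).
  by apply: ler_sum => l _; rewrite normrM; apply: ler_pM => //; exact: mx_coord_le.
by rewrite sumr_const card_ord -[X in X <= _]mulr_natl mulrA.
Qed.

Lemma eps_is_diff_covec k (f : 'rV[R]_k -> R) (B : 'cV[R]_k) x :
  (forall e, 0 < e -> \forall h \near (0 : 'rV[R]_k),
     `|f (h + x) - f x - covec B h| <= e * `|h|) -> is_diff x f (covec B).
Proof.
move=> H.
have linB : linear (covec B : 'rV[R]_k -> R) by move=> a u v; rewrite covecD covecZ.
pose L := HB.pack_for {linear 'rV[R]_k -> R} (covec B : 'rV[R]_k -> R)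
  (GRing.isLinear.Build _ _ _ _ _ linB).
apply: (eps_is_diff (L := L)) => // y.
have := smooth_near_mulmx (smooth_near_id y) (smooth_near_cst B y).
by move/smooth_near_mxP/(_ 0 0)/smooth_near_continuous.
Qed.

Lemma ball_convex m (x0 x h : 'rV[R]_m) (r c : R) : ball x0 r x -> ball x0 r (h + x) ->
  0 <= c <= 1 -> ball x0 r (c *: h + x).
Proof.
rewrite -!ball_normE /ball_/= => xr hr /andP[c0 c1].
have -> : x0 - (c *: h + x) = (1 - c) *: (x0 - x) + c *: (x0 - (h + x)).
  apply/rowP => i; rewrite !mxE; ring.
apply: le_lt_trans (ler_normD _ _) _; rewrite !normrZ (ger0_norm c0) ger0_norm ?subr_ge0//.
have [->|c_neq0] := eqVneq c 0; first by rewrite subr0 mul1r mul0r addr0.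
have cpos : 0 < c by rewrite lt_neqAle eq_sym c_neq0.
have -> : r = (1 - c) * r + c * r by ring.
apply: ler_ltD; last by rewrite ltr_pM2l.
by apply: ler_wpM2l; [rewrite subr_ge0|exact: ltW].
Qed.

Lemma mvt_covec m (F : 'rV[R]_m -> R) (w : 'rV[R]_m -> 'cV[R]_m) (x0 : 'rV[R]_m) (r : R) x h :
  (forall y, ball x0 r y -> forall v, is_derive y v F (covec (w y) v)) ->
  ball x0 r x -> ball x0 r (h + x) ->
  exists2 c, 0 <= c <= 1 & F (h + x) - F x = covec (w (c *: h + x)) h.
Proof.
move=> dF xr hr.
have [|c c01 E] := @MVT_is_derive _ (fun s => F (s *: h + x))
  (fun s => covec (w (s *: h + x)) h) 1 ltr01.
  by move=> s s01; apply: is_derive_line_dir; apply: dF; exact: ball_convex.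
by exists c => //; rewrite scale1r scale0r add0r mulr1 in E.
Qed.

(* The leaf is y |-> x0 + y A + u(y) z0. With F a primitive of w, u(y) solves F = F x0: it exists by
   the intermediate value theorem, as F is strictly monotone along z0, and the mean value theorem
   shows that it is Lipschitz, then differentiable, and then smooth since its derivative is a
   smooth function of the leaf. *)
Lemma integral_graph k m (w : 'rV[R]_m -> 'cV[R]_m) (x0 : 'rV[R]_m) (A : 'M[R]_(k, m))
    (z0 : 'rV[R]_m) (U : set 'rV[R]_m) :
  smooth_near w x0 ->
  (\forall x \near x0, forall u v, u *m 'D_v w x = v *m 'D_u w x) ->
  covec (w x0) z0 = 1 -> A *m w x0 = 0 -> row_free A ->
  (forall z, covec (w x0) z = 0 -> exists y, z = y *m A) -> nbhs x0 U ->
  exists rho (gam : 'rV[R]_k -> 'rV[R]_m), [/\ 0 < rho, gam 0 = x0,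
    (forall y, `|y| < rho -> U (gam y) /\ smooth_near gam y),
    (forall y y', gam y = gam y' -> y = y')
  & (forall y, `|y| < rho -> row_free (jacobian gam y) /\
      forall z, covec (w (gam y)) z = 0 <-> exists v, z = v *m jacobian gam y)].
Proof.
move=> sw cl wz0 Aw0 fA kerA nU.
have [r1 [F [r10 HF]]] := poincare sw cl.
(* The derivative of [F] along [z0]. It is 1 at [x0], so it stays above 1/2 nearby. *)
pose b x := covec (w x) z0.
have cb : {for x0, continuous b} := smooth_near_continuous (smooth_near_covec z0 sw).
have b_gt : \forall x \near x0, 2^-1 < b x.
  by apply: (cvgr_gt _ cb); rewrite /b wz0 invf_lt1// ltr1n.
have cw : {for x0, continuous (fun z => `|w z|)}.
  apply: (@continuous_comp _ _ _ w (fun A => `|A|)); last exact: norm_continuous.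
  exact: smooth_near_continuous.
have lt1 (c : R) : c < c + 1 by rewrite ltrDl.
have nw : \forall z \near x0, `|w z| < `|w x0| + 1 by exact: (cvgr_lt _ cw _ (lt1 _)).
have nball : \forall z \near x0, ball x0 r1 z by exact: nbhsx_ballx.
have [r [r0 Hr]] : exists r : R, 0 < r /\ forall z, ball x0 r z ->
    [/\ U z, 2^-1 < b z, `|w z| < `|w x0| + 1, smooth_near w z &
     forall v, is_derive z v F (covec (w z) v)].
  have : \forall z \near x0, [/\ U z, 2^-1 < b z, `|w z| < `|w x0| + 1 & ball x0 r1 z].
    by apply: filterS2 (filterI nU b_gt) (filterI nw nball) => z [? ?] [? ?].
  move=> /nbhs_ballP[r /= r0 Hr]; exists r; split=> // z /Hr[? ? ? zr1].
  by have [? ?] := HF z zr1.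
have dF z : ball x0 r z -> forall v, is_derive z v F (covec (w z) v).
  by move=> /Hr[].
move: (`|w x0| + 1) Hr => C2 Hr.
have xr0 : ball x0 r x0 by exact: ballxx.
have C20 : 0 < C2 by have [_ _ H _ _] := Hr x0 xr0; exact: le_lt_trans H.
(* Normalised so that the graph function satisfies [du(v) = - q(v A)], the solution of
   [b du(v) + w(v A) = 0]. *)
pose q z := (b z)^-1 *: w z.
have bpos z : ball x0 r z -> 0 < b z.
  by move=> /Hr[_ H _ _ _]; apply: lt_trans H; rewrite invr_gt0.
have sq z : ball x0 r z -> smooth_near q z.
  move=> zr; have [_ _ _ swz _] := Hr z zr; apply: smooth_nearZ => //.
  apply: smooth_nearV; first by rewrite gt_eqF// bpos.
  exact: smooth_near_covec.
have bq z : ball x0 r z -> `|q z| <= 2 * C2.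
  move=> zr; have [_ bz wz _ _] := Hr z zr; rewrite /q normrZ normfV.
  apply: ler_pM => //; last exact: ltW.
  rewrite ger0_norm; last exact: ltW (bpos _ zr).
  by rewrite invf_ple ?posrE ?bpos// ltW.
pose CA := k%:R * `|A|.
have CA0 : 0 <= CA by rewrite mulr_ge0.
have bA (y : 'rV[R]_k) : `|y *m A| <= CA * `|y|.
  by apply: le_trans (mulmx_row_bound _ _) _; rewrite /CA mulrAC.
pose Psi (y : 'rV[R]_k) (t : R) := t *: z0 + (y *m A + x0).
have z01 : 0 < `|z0| + 1 by rewrite ltr_wpDl.
have CA1 : 0 < CA + 1 by rewrite ltr_wpDl.
have [del [del0 delz]] : exists del : R, 0 < del /\ del * `|z0| < r / 2.
  exists (r / 2 / (`|z0| + 1)); split; first by rewrite !divr_gt0.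
  rewrite mulrAC ltr_pdivrMr// ltr_pM2l ?divr_gt0//.
pose C3 := m%:R * CA * C2.
have C30 : 0 <= C3 by rewrite !mulr_ge0// ltW.
have C31 : 0 < C3 + 1 by rewrite ltr_wpDl.
(* The first bound uses half of the radius, the other half being left for [t z0]. The second makes
   [F] differ from [F x0] by at most [del / 2] at [t = 0], while moving by [del] along [z0] changes
   it by at least [del / 2]: the level is bracketed. *)
have [rho [rho0 rhoA rhoC]] : exists rho : R, [/\ 0 < rho, CA * rho <= r / 2 & C3 * rho <= del / 2].
  exists (Num.min (r / 2 / (CA + 1)) (del / 2 / (C3 + 1))); split.
  - by rewrite lt_min !divr_gt0.
  - apply: (@le_trans _ _ (CA * (r / 2 / (CA + 1)))).
      by apply: ler_wpM2l => //; rewrite ge_min lexx.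
    by rewrite mulrCA ler_piMr ?divr_ge0 ?(ltW r0)// ler_pdivrMr// mul1r lerDl.
  - apply: (@le_trans _ _ (C3 * (del / 2 / (C3 + 1)))).
      by apply: ler_wpM2l => //; rewrite ge_min lexx orbT.
    by rewrite mulrCA ler_piMr ?divr_ge0 ?(ltW del0)// ler_pdivrMr// mul1r lerDl.
have PsiB y t : `|y| < rho -> `|t| <= del -> ball x0 r (Psi y t).
  move=> yr td; rewrite -ball_normE /ball_/= distrC /Psi addrA addrK.
  apply: le_lt_trans (ler_normD _ _) _; rewrite normrZ [r]splitr; apply: ltr_leD.
    by apply: le_lt_trans delz; exact: ler_wpM2r.
  apply: le_trans (bA _) _; apply: le_trans rhoA; apply: ler_wpM2l => //; exact: ltW.
have Psi0 : Psi 0 0 = x0 by rewrite /Psi scale0r mul0mx !add0r.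
have Psi_t y t t' : Psi y t' = (t' - t) *: z0 + Psi y t.
  by rewrite /Psi [RHS]addrA -scalerDl subrK.
have mvt := mvt_covec dF.
have rho_abs0 : `|0 : 'rV[R]_k| < rho by rewrite normr0.
have del_abs0 : `|0 : R| <= del by rewrite normr0 ltW.
(* The bound on [y] sits under the existential, so that choice yields a total [u], arbitrary outside
   the ball. *)
have exu (y : 'rV[R]_k) : exists t : R, `|y| < rho -> `|t| <= del /\ F (Psi y t) = F x0.
  case: (ltP `|y| rho) => [yr|_]; last by exists 0.
  have F0 : `|F (Psi y 0) - F x0| <= del / 2.
    have E : Psi y 0 = y *m A + x0 by rewrite /Psi scale0r add0r.
    have yA : ball x0 r (y *m A + x0) by rewrite -E; exact: PsiB.
    have [c c01 Ec] := mvt _ _ xr0 yA; rewrite E Ec.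
    have [_ _ wz _ _] := Hr _ (ball_convex xr0 yA c01).
    apply: le_trans (covec_bound _ _) _; apply: le_trans rhoC.
    apply: (@le_trans _ _ (m%:R * (CA * `|y|) * C2)).
      by apply: ler_pM; rewrite ?mulr_ge0//; [apply: ler_wpM2l|exact: ltW].
    have -> : m%:R * (CA * `|y|) * C2 = C3 * `|y| by rewrite /C3; ring.
    by apply: ler_wpM2l => //; exact: ltW.
  have step t : `|t| <= del -> exists2 z, ball x0 r z & F (Psi y t) - F (Psi y 0) = t * b z.
    move=> td; have P0 := PsiB y 0 yr del_abs0; have Pt := PsiB y t yr td.
    rewrite (Psi_t y 0 t) subr0 in Pt *.
    have [c c01 ->] := mvt _ _ P0 Pt.
    by exists (c *: (t *: z0) + Psi y 0); [exact: ball_convex|rewrite covecZ].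
  have half z : ball x0 r z -> del / 2 <= del * b z.
    by move=> /Hr[_ bz _ _ _]; apply: ler_wpM2l; exact: ltW.
  have Fp : F x0 <= F (Psi y del).
    have [|z zr Ez] := step del; first by rewrite ger0_norm// ltW.
    have := half z zr; move: F0 Ez; rewrite ler_norml => /andP[]; lra.
  have Fm : F (Psi y (- del)) <= F x0.
    have [|z zr Ez] := step (- del); first by rewrite normrN ger0_norm// ltW.
    have := half z zr; move: F0 Ez; rewrite ler_norml mulNr => /andP[]; lra.
  have [|||t tI Et] := @IVT R (fun t => F (Psi y t)) (- del) del (F x0).
  - by rewrite ge0_cp// ltW.
  - apply: derivable_within_continuous => t; rewrite in_itv/= -ler_norml => td.
    by have [] := is_derive_line_dir (dF _ (PsiB y t yr td) z0).
  - by rewrite ge_min Fm le_max Fp orbT.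
  - by exists t => _; split=> //; move: tI; rewrite in_itv/= -ler_norml.
have [u Hu] := choice exu.
pose gam y := Psi y (u y).
have gamB y : `|y| < rho -> ball x0 r (gam y).
  by move=> yr; apply: PsiB => //; have [] := Hu y yr.
have Fgam y : `|y| < rho -> F (gam y) = F x0 by move=> /Hu[].
(* Both points lie on one level of [F], so the mean value theorem gives [w(z) (gam y' - gam y) = 0]
   at a point [z] of the segment, which is solved for the coefficient of [z0]. *)
have diff_u y y' : `|y| < rho -> `|y'| < rho -> exists c, [/\ 0 <= c <= 1,
    ball x0 r (c *: (gam y' - gam y) + gam y) &
    u y' - u y = - covec (q (c *: (gam y' - gam y) + gam y)) ((y' - y) *m A)].
  move=> yr yr'; have By := gamB y yr; have By' := gamB y' yr'.
  have By2 : ball x0 r (gam y' - gam y + gam y) by rewrite subrK.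
  have [c c01] := mvt _ _ By By2; rewrite subrK !Fgam// subrr => Ec.
  have zB := ball_convex By By2 c01; exists c; split=> //.
  set z := c *: _ + _ in Ec zB *.
  have bz := bpos z zB.
  have gE : gam y' - gam y = (u y' - u y) *: z0 + (y' - y) *m A.
    rewrite /gam /Psi mulmxBl; apply/rowP => j; rewrite !mxE; ring.
  move: Ec; rewrite gE covecD covecZ -/(b z) => /esym/eqP.
  rewrite addr_eq0 => /eqP Eu; rewrite /q covecZl.
  apply: (mulIf (lt0r_neq0 bz)); rewrite Eu mulNr mulrAC mulVf ?mul1r//.
  exact: lt0r_neq0.
pose CL := m%:R * CA * (2 * C2).
have CL0 : 0 <= CL by rewrite !mulr_ge0// ltW.
have bcov (B : 'cV[R]_m) (h : 'rV[R]_k) : `|covec B (h *m A)| <= m%:R * CA * `|h| * `|B|.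
  apply: le_trans (covec_bound _ _) _; apply: ler_wpM2r => //.
  by rewrite -mulrA; apply: ler_wpM2l.
have lip y y' : `|y| < rho -> `|y'| < rho -> `|u y' - u y| <= CL * `|y' - y|.
  move=> yr yr'; have [c [c01 zB ->]] := diff_u _ _ yr yr'; rewrite normrN.
  apply: le_trans (bcov _ _) _; rewrite /CL mulrAC; apply: ler_wpM2r => //.
  by apply: ler_wpM2l; [rewrite mulr_ge0|exact: bq].
pose CH := CL * `|z0| + CA.
have CH0 : 0 <= CH by rewrite addr_ge0// mulr_ge0.
have lipg y y' : `|y| < rho -> `|y'| < rho -> `|gam y' - gam y| <= CH * `|y' - y|.
  move=> yr yr'.
  have -> : gam y' - gam y = (u y' - u y) *: z0 + (y' - y) *m A.
    rewrite /gam /Psi mulmxBl; apply/rowP => j; rewrite !mxE; ring.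
  apply: le_trans (ler_normD _ _) _; rewrite /CH mulrDl; apply: lerD; last exact: bA.
  by rewrite normrZ mulrAC; apply: ler_wpM2r => //; exact: lip.
(* The error of this candidate differential is the variation of [q] between [gam y] and [z], small
   because [gam] is Lipschitz and [q] continuous. *)
have du y : `|y| < rho -> is_diff y u (covec (- (A *m q (gam y)))).
  move=> yr; apply: eps_is_diff_covec => e e0.
  have cq : {for gam y, continuous q} := smooth_near_continuous (sq _ (gamB y yr)).
  have mA1 : 0 < m%:R * CA + 1 by rewrite ltr_wpDl ?mulr_ge0.
  have e1 : 0 < e / (m%:R * CA + 1) by rewrite divr_gt0.
  have /nbhs_ballP[s /= s0 Hs] : \forall z \near gam y, `|q (gam y) - q z| <= e / (m%:R * CA + 1).
    exact: ((cvgrPdist_le _ _).1 cq).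
  have CH1 : 0 < CH + 1 by rewrite ltr_wpDl.
  have : \forall h \near (0 : 'rV[R]_k), ball 0 (Num.min (rho - `|y|) (s / (CH + 1))) h.
    by apply: nbhsx_ballx; rewrite lt_min subr_gt0 yr divr_gt0.
  apply: filterS => h; rewrite -ball_normE /ball_/= sub0r normrN lt_min => /andP[h1 h2].
  have yhr : `|h + y| < rho.
    by apply: le_lt_trans (ler_normD _ _) _; rewrite -ltrBrDr.
  have [c [/andP[c0 c1] zB ->]] := diff_u _ _ yr yhr; have hE : h + y - y = h by rewrite addrK.
  set z := c *: _ + _ in zB *; rewrite hE.
  have zs : `|q (gam y) - q z| <= e / (m%:R * CA + 1).
    apply: Hs; rewrite -ball_normE /ball_/= /z opprD addrCA addrN addr0 normrN normrZ ger0_norm//.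
    apply: le_lt_trans (_ : CH * `|h| < s).
      apply: (@le_trans _ _ `|gam (h + y) - gam y|); first by rewrite ler_piMl.
      by have := lipg y (h + y) yr yhr; rewrite hE.
    apply: le_lt_trans (_ : (CH + 1) * `|h| < s); first by rewrite ler_wpM2r// lerDl.
    by rewrite mulrC -ltr_pdivlMr.
  have -> : - covec (q z) (h *m A) - covec (- (A *m q (gam y))) h =
     covec (q (gam y) - q z) (h *m A).
    by rewrite /covec mulmxN mulmxBr !mulmxA !mxE; ring.
  apply: le_trans (bcov _ _) _; rewrite mulrAC; apply: ler_wpM2r => //.
  apply: (@le_trans _ _ (m%:R * CA * (e / (m%:R * CA + 1)))).
    by apply: ler_wpM2l => //; rewrite mulr_ge0.
  by rewrite mulrCA ler_piMr ?(ltW e0)// ler_pdivrMr// mul1r lerDl.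
have Du y v : `|y| < rho -> 'D_v u y = - covec (q (gam y)) (v *m A).
  move=> yr; have [d1 d2] := du y yr; rewrite deriveE// d2 /covec mulmxN mulmxA mxE.
  by [].
pose B := ball (0 : 'rV[R]_k) rho.
have BE y : B y = (`|y| < rho) :> Prop.
  by rewrite /B -ball_normE /ball_/= sub0r normrN.
have oB : open B by exact: ball_open.
have oBr : open (ball x0 r) by exact: ball_open.
have sPsi y : smooth_near (fun y : 'rV[R]_k => y *m A + x0) y.
  apply: smooth_nearD; last exact: smooth_near_cst.
  by apply: smooth_near_mulmx; [exact: smooth_near_id|exact: smooth_near_cst].
have Cgam j : Ck j B u -> Ck j B gam.
  move=> Cu; apply: CkD => //; last by apply: smooth_near_Ck => y _.
  apply/(Ck_mxP _ _ oB) => i1 i2.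
  apply: (@eq_Ck _ _ _ _ _ (fun y => u y * z0 i1 i2)) => //.
    by move=> y _; rewrite mxE.
  by apply: CkM => //; exact: Ck_cst.
(* Bootstrapping: if [u] is of class C^j then so is [gam], hence so is the derivative
   [- q(gam y)(v A)], and [u] is of class C^(j+1). *)
have Cu j : Ck j B u.
  elim: j => [|j IH].
    move=> y; rewrite BE => yr; apply: differentiable_continuous.
    by have [] := du y yr.
  split=> [y|v]; first by rewrite BE => yr; have [] := du y yr.
  apply: (@eq_Ck _ _ _ _ _ (fun y => - covec (q (gam y)) (v *m A))) => //.
    by move=> y; rewrite inE BE => yr; rewrite Du.
  apply: CkN => //.
  apply: (Ck_comp (U' := ball x0 r) (f := fun z => covec (q z) (v *m A)) oB oBr).
  - by move=> y; rewrite BE; exact: gamB.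
  - exact: Cgam.
  - by apply: smooth_near_Ck => z zr; apply: smooth_near_covec; exact: sq.
have su y : `|y| < rho -> smooth_near u y.
  by move=> yr; exists B; split=> //; rewrite BE.
have sgam y : `|y| < rho -> smooth_near gam y.
  by move=> yr; exists B; split=> [//||j]; [rewrite BE|exact: Cgam].
have Dgam y v : `|y| < rho -> 'D_v gam y = v *m A - covec (q (gam y)) (v *m A) *: z0.
  move=> yr; have s1 := smooth_near_scalarmx 1 (su y yr).
  have s2 : smooth_near (fun y => (u y)%:M *m z0) y.
    by apply: smooth_near_mulmx => //; exact: smooth_near_cst.
  have s3 : smooth_near (fun y : 'rV[R]_k => y *m A) y.
    by apply: smooth_near_mulmx; [exact: smooth_near_id|exact: smooth_near_cst].
  have s4 := sPsi y.
  transitivity ('D_v (fun y => (u y)%:M *m z0 + (y *m A + x0)) y).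
    by congr ('D_v _ y); apply/funext => y'; rewrite /gam /Psi mul_scalar_mx.
  rewrite [LHS](deriveD (smooth_near_derivable s2) (smooth_near_derivable s4)).
  rewrite (deriveD (smooth_near_derivable s3) (smooth_near_derivable (smooth_near_cst x0 y))).
  rewrite derive_cst addr0 (derive_mulmxr _ (smooth_near_derivable s1)).
  rewrite (derive_mulmxr _ (smooth_near_derivable (smooth_near_id y))) derive_id.
  by rewrite (derive_scalarmx _ _ (su y yr)) mul_scalar_mx Du// scaleNr addrC.
have cov0 (v : 'rV[R]_k) : covec (w x0) (v *m A) = 0.
  by rewrite /covec -mulmxA Aw0 mulmx0 mxE.
have jacE y v : `|y| < rho -> v *m jacobian gam y = 'D_v gam y.
  move=> yr; have dg := smooth_near_differentiable (sgam y yr).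
  exact: (esym (deriveEjacobian v dg)).
(* [u] comes from choice; its value at 0 is recovered from the positivity of [b] along the line
   through [x0]. *)
have u0 : u 0 = 0.
  have G0 : gam 0 = u 0 *: z0 + x0 by rewrite /gam /Psi mul0mx add0r.
  have g0B := gamB 0 rho_abs0; rewrite G0 in g0B.
  have [c c01] := mvt _ _ xr0 g0B; rewrite -G0 Fgam// subrr covecZ => /esym/eqP.
  rewrite mulf_eq0 => /orP[/eqP//|/eqP bz].
  by have := bpos _ (ball_convex xr0 g0B c01); rewrite /b bz ltxx.
exists rho, gam; split=> //.
- by rewrite /gam u0 Psi0.
- by move=> y yr; split; [have [] := Hr _ (gamB y yr)|exact: sgam].
(* [w x0] vanishes on the image of [A] and is 1 on [z0], so it reads off [u]. *)
- move=> y y'; rewrite /gam /Psi !addrA => /addIr E.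
  have := congr1 (covec (w x0)) E; rewrite !covecD !covecZ wz0 !cov0 !mulr1 !addr0 => Eu.
  by move: E; rewrite Eu => /addrI; exact: row_free_inj.
- move=> y yr; split.
    apply: inj_row_free => v; rewrite jacE// Dgam// => E.
    have := congr1 (covec (w x0)) E.
    rewrite covecD covecN covecZ wz0 cov0 mulr1 sub0r.
    have -> : covec (w x0) 0 = 0 by rewrite /covec mul0mx mxE.
    move/eqP; rewrite oppr_eq0 => /eqP c0; move: E; rewrite c0 scale0r subr0 => E.
    by apply: (row_free_inj fA); rewrite mul0mx.
  have bg : covec (w (gam y)) z0 != 0 by rewrite gt_eqF//; apply: bpos; exact: gamB.
  have qE z : covec (q (gam y)) z * covec (w (gam y)) z0 = covec (w (gam y)) z.
    by rewrite /q covecZl mulrAC mulVf ?mul1r.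
  have im0 v : covec (w (gam y)) (v *m jacobian gam y) = 0.
    by rewrite jacE// Dgam// covecD covecN covecZ qE subrr.
  move=> z; split=> [z0'|[v ->]]; last exact: im0.
  have [|v vE] := kerA (z - covec (w x0) z *: z0).
    by rewrite covecD covecN covecZ wz0 mulr1 subrr.
  exists v.
  (* The difference is a multiple of [z0] that [w (gam y)] kills, though it does not kill [z0]; so
     the multiple is zero. *)
  have zE : z - v *m jacobian gam y = (covec (w x0) z + covec (q (gam y)) (v *m A)) *: z0.
    rewrite jacE// Dgam// -vE scalerDl; apply/rowP => j; rewrite !mxE; ring.
  have : covec (w (gam y)) (z - v *m jacobian gam y) = 0.
    by rewrite covecD covecN im0 z0' subrr.
  rewrite zE covecZ => /eqP; rewrite mulf_eq0 (negbTE bg) orbF => /eqP c0.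
  by apply/eqP; rewrite -subr_eq0 zE c0 scale0r.
Qed.

End IntegralGraph.

(** * The model space as a manifold, and its embedding in a ball *)

Section EuclideanManifold.
Variables (R : realType) (k : nat).

(** The base consists of the balls with rational centre and radius [1/(n+1)]. *)
Lemma second_countable_rV : @second_countable 'rV[R]_k.
Proof.
pose c (q : 'rV[rat]_k) : 'rV[R]_k := map_mx ratr q.
exists (range (fun a : 'rV[rat]_k * nat => ball (c a.1) (a.2.+1%:R^-1 : R))).
  apply: sub_countable (card_image_le _ _) _.
  exact: countableP.
split=> [_ [[q n] _ <-]|x U /= /nbhs_ballP[e /= e0 eU]]; first exact: ball_open.
have [n ne] : exists n, n.+1%:R^-1 < e / 2.
  have e20 : 0 < e / 2 by rewrite divr_gt0.
  exists (Num.bound (e / 2)^-1); rewrite invf_plt ?posrE//.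
  apply: lt_trans (archi_boundP _) _; first by rewrite invr_ge0 ltW.
  by rewrite ltr_nat.
have n0 : 0 < n.+1%:R^-1 :> R by rewrite invr_gt0 ltr0n.
have H i : exists q : rat, `|x 0 i - ratr q| < n.+1%:R^-1.
  have [|q] := @rat_in_itvoo R (x 0 i - n.+1%:R^-1) (x 0 i + n.+1%:R^-1).
    by rewrite ltrBlDr -addrA ltrDl addr_gt0.
  by rewrite in_itv/= -ltr_distlC => q1; exists q.
have [q qx] := choice H.
have cx : ball (c (\row_i q i)) n.+1%:R^-1 x.
  rewrite -ball_normE /ball_/= distrC; rewrite /Num.Def.normr/= mx_normrE.
  apply: bigmax_lt => // -[i j] _ /=; rewrite !mxE (ord1 i); exact: qx.
exists (ball (c (\row_i q i)) n.+1%:R^-1).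
  by split=> //; exists (\row_i q i, n).
apply: subset_trans eU => y yq; apply: (@le_ball _ _ x (n.+1%:R^-1 + n.+1%:R^-1)).
  by rewrite [e]splitr lerD// ltW.
by apply: ball_triangle yq; exact: ball_sym.
Qed.

(** Transparent, since the construction of leaves relies on its charts reducing to the identity. *)
Definition euclidean : smoothManifold R k.
Proof.
apply: (@SmoothManifold R k 'rV[R]_k (fun=> setT) (fun=> id) (fun=> id)).
- exact: (@norm_hausdorff R 'rV[R]_k).
- exact: second_countable_rV.
- by move=> _; exact: openT.
- by [].
- by move=> _; rewrite image_id; exact: openT.
- by [].
- by move=> p q _; exact: cvg_id.
- by move=> p q _; exact: cvg_id.
- by move=> p q j; apply: smooth_near_Ck => x _; exact: smooth_near_id.
Defined.

End EuclideanManifold.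

Section Squash.
Variables (R : realType) (k : nat).
Implicit Types (x y v : 'rV[R]_k).

Lemma is_diff_coord_atan i y : differentiable (fun y : 'rV[R]_k => atan (y 0 i)) y /\
  forall v, 'D_v (fun y : 'rV[R]_k => atan (y 0 i)) y = (1 + y 0 i ^+ 2)^-1 * v 0 i.
Proof.
have dc : differentiable (fun y : 'rV[R]_k => y 0 i) y by exact: differentiable_coord.
have da : differentiable (@atan R) (y 0 i).
  by apply/derivable1_diffP; exact: derivable_atan.
split=> [|v]; first exact: (differentiable_comp dc da).
rewrite (derive_comp _ dc da) deriveE// diff1E// derive1_atan /GRing.scale/= mulrC.
congr (_ * _); rewrite (derivable_mxij (f := id)) ?derive_id//.
Qed.

Lemma smooth_near_coord i y : smooth_near (fun y : 'rV[R]_k => y 0 i) y.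
Proof. by have /smooth_near_mxP := smooth_near_id y; apply. Qed.

Lemma smooth_near_coord_atan i y : smooth_near (fun y : 'rV[R]_k => atan (y 0 i)) y.
Proof.
exists setT; split; [exact: openT|by []|case=> [|j]].
  move=> x _; have [H _] := is_diff_coord_atan i x.
  exact: differentiable_continuous H.
split=> [x _|v]; first by have [] := is_diff_coord_atan i x.
have -> : (fun x => 'D_v (fun y : 'rV[R]_k => atan (y 0 i)) x) =
    fun x => (1 + x 0 i ^+ 2)^-1 * v 0 i.
  by apply/funext => x; have [_ ->] := is_diff_coord_atan i x.
apply: smooth_near_Ck => x _; apply: smooth_nearM; last exact: smooth_near_cst.
apply: smooth_nearV; first by rewrite gt_eqF// ltr_pwDl// sqr_ge0.
apply: smooth_nearD; first exact: smooth_near_cst.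
by apply: smooth_nearM; exact: smooth_near_coord.
Qed.

(* Lets a leaf defined over a ball be parametrised by the whole space, that is, by a manifold with
   a single chart. *)
Lemma ball_parametrization (rho : R) : 0 < rho -> exists s : 'rV[R]_k -> 'rV[R]_k,
  [/\ s 0 = 0, forall y, `|s y| < rho, injective s, forall y, smooth_near s y
    & forall y, jacobian s y \in unitmx].
Proof.
move=> rho0; have pi0 : 0 < pi :> R := pi_gt0 R.
(* Scales the range of [atan], the interval between [- pi/2] and [pi/2], to that between [- rho] and
   [rho]; for the maximum norm this is the ball. *)
pose c : R := rho * 2 / pi; have c0 : 0 < c by rewrite divr_gt0// mulr_gt0.
pose s (y : 'rV[R]_k) : 'rV[R]_k := \row_i (c * atan (y 0 i)).
have ss y : smooth_near s y.
  apply/smooth_near_mxP => i j; rewrite (ord1 i); under eq_fun do rewrite mxE.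
  by apply: smooth_nearM; [exact: smooth_near_cst|exact: smooth_near_coord_atan].
exists s; split=> //.
- by apply/rowP => i; rewrite !mxE atan0 mulr0.
- move=> y; rewrite /Num.Def.normr/= mx_normrE; apply: bigmax_lt => // -[i j] _ /=.
  rewrite mxE normrM (gtr0_norm c0).
  have -> : rho = c * (pi / 2).
    by rewrite /c mulrA mulfVK ?lt0r_neq0// mulfK// lt0r_neq0.
  by rewrite ltr_pM2l// ltr_norml atan_gtNpi2 atan_ltpi2.
- move=> y y' /rowP E; apply/rowP => i; have := E i; rewrite !mxE.
  by move/(mulfI (lt0r_neq0 c0))/(can_inj (@atanK R)).
- move=> y; rewrite -row_free_unit; apply: inj_row_free => v.
  have ds := smooth_near_differentiable (ss y).
  rewrite -(deriveEjacobian v ds) => /rowP E; apply/rowP => i; have := E i.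
  have dy : derivable s y v by exact: smooth_near_derivable (ss y).
  rewrite -(derivable_mxij _ _ dy) !mxE; under eq_fun do rewrite mxE.
  have [H Hv] := is_diff_coord_atan i y.
  rewrite deriveM//; last exact: diff_derivable.
  rewrite derive_cst Hv /GRing.scale/= mulr0 addr0 => /eqP.
  rewrite mulf_eq0 (gt_eqF c0) mulf_eq0 invr_eq0 gt_eqF/=; first by move/eqP.
  by rewrite ltr_pwDl// sqr_ge0.
Qed.

End Squash.

Lemma covec_ker_basis (R : realType) (k : nat) (w : 'cV[R]_k.+1) : w != 0 ->
  exists A : 'M[R]_(k, k.+1), [/\ A *m w = 0, row_free A &
    forall z, covec w z = 0 -> exists y, z = y *m A].
Proof.
move=> w0; have rw : \rank (kermx w) = k.
  suff rk1 : \rank w = 1%N by rewrite mxrank_ker rk1 subn1.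
  by apply/eqP; rewrite eqn_leq rank_leq_col lt0n mxrank_eq0.
(* [row_base] has the rank in its type; generalising it allows the substitution of [k]. *)
suff H r : \rank (kermx w) = r -> exists A : 'M[R]_(r, k.+1), [/\ A *m w = 0, row_free A &
    forall z, covec w z = 0 -> exists y, z = y *m A] by exact: H.
move=> <-; exists (row_base (kermx w)); split=> [||z zw].
- by apply: sub_kermxP; rewrite eq_row_base.
- exact: row_base_free.
- apply/submxP; rewrite eq_row_base; apply/sub_kermxP.
  by apply/matrixP => i j; rewrite !ord1 [RHS]mxE.
Qed.

(** * Integrability of the kernel of a closed form *)

Section ClosedForm.
Variables (R : realType) (k : nat) (M : smoothManifold R k.+1) (eta : formfield M).
Hypothesis eta_smooth : formfield_smooth eta.
Hypothesis eta_neq0 : forall p, exists z, covec (eta p) z = 1.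
Hypothesis eta_closed : forall p, \forall x \near chart p p, forall u v,
  u *m 'D_v (form_rep eta p) x = v *m 'D_u (form_rep eta p) x.

(** The leaf through [p] is the graph of [integral_graph] in the chart around [p], parametrised by
    the whole model space through [ball_parametrization] and carried to [M] by [chartI p]. *)
Lemma closed_form_integrable : integrable_distribution k (ker_form eta).
Proof.
move=> p; have pp := dom_center p; have [z0 ez0] := eta_neq0 p.
have ep : eta p != 0.
  apply/eqP => e0; move: ez0; rewrite e0 /covec mulmx0 mxE => /esym/eqP.
  by rewrite oner_eq0.
have [A [Ae fA kA]] := covec_ker_basis ep.
have sw := form_rep_smooth eta_smooth pp.
have := integral_graph sw (eta_closed p); rewrite (form_rep_center eta p).
move=> /(_ k A z0 _ ez0 Ae fA kA (near_chart pp))[rho [gam [rho0 gam0 sgam injgam Tgam]]].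
have [s [s0 srho injs ss us]] := ball_parametrization k rho0.
pose f y := gam (s y).
have Uf y : (chart p @` dom p) (f y) by have [] := sgam _ (srho y).
have sf y : smooth_near f y.
  by apply: smooth_near_comp; [exact: ss|have [] := sgam _ (srho y)].
pose iota : euclidean R k -> M := fun y => chartI p (f y).
have pf y : dom p (iota y) by exact: dom_chartI.
have cf y : chart p (iota y) = f y by exact: chartIK.
have st y : smooth_near (chart (iota y) \o chartI p) (f y).
  by rewrite -cf; apply: smooth_near_transition; [exact: pf|exact: dom_center].
have TE y : tangent_map iota y = jacobian f y *m trans_jac p (iota y) (iota y).
  have d1 := smooth_near_differentiable (sf y).
  have d2 := smooth_near_differentiable (st y).
  by rewrite trans_jacE cf; exact: (jacobian_comp d1 d2).
have JE y : jacobian f y = jacobian s y *m jacobian gam (s y).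
  have d1 := smooth_near_differentiable (ss y).
  have d2 : differentiable gam (s y).
    by apply: smooth_near_differentiable; have [] := sgam _ (srho y).
  exact: (jacobian_comp d1 d2).
have fJ y : row_free (jacobian f y).
  rewrite JE; apply: inj_row_free => v; rewrite mulmxA => E.
  have [fg _] := Tgam _ (srho y).
  apply: (can_inj (mulmxK (us y))); apply: (row_free_inj fg).
  by rewrite E !mul0mx.
have kJ y z : covec (form_rep eta p (f y)) z = 0 <-> exists v, z = v *m jacobian f y.
  have [_ H] := Tgam _ (srho y); split=> [/H[v ->]|[v ->]].
    by exists (v *m invmx (jacobian s y)); rewrite JE mulmxA mulmxKV.
  by apply/H; exists (v *m jacobian s y); rewrite JE mulmxA.
exists (euclidean R k), iota; split; last first.
  by exists 0; rewrite /iota /f s0 gam0 chartK.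
split=> [y|y y' E|y|y].
- split.
    apply: (@continuous_comp _ _ _ f (chartI p)).
      exact: smooth_near_continuous (sf y).
    exact: (chartI_continuous (Uf y)).
  exact: (smooth_near_comp (sf y) (st y)).
- by apply/injs/injgam; rewrite -[LHS]cf E; exact: cf.
- rewrite TE; apply: inj_row_free => v; rewrite mulmxA => E.
  apply: (row_free_inj (fJ y)); rewrite mul0mx.
  by rewrite -(trans_jacVK (v *m jacobian f y) (pf y)) E mul0mx.
- apply/seteqP; split=> [_ [v _ <-]|u u0]; rewrite /ker_form/=.
    rewrite TE mulmxA -form_repE//; rewrite cf; apply/kJ; by exists v.
  have [|v vE] := (kJ y (u *m trans_jac (iota y) p (iota y))).1.
    by rewrite -cf form_repE// trans_jacKV.
  exists v; first by [].
  rewrite TE mulmxA -vE.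
  exact: trans_jacKV.
Qed.

End ClosedForm.

Lemma ker_eta_integrable (R : realType) (n : nat) (M : smoothManifold R n.*2.+1)
    (phi : endofield M) (xi : vfield M) (eta : formfield M) (g : bilinfield M)
    (D : connection M) :
  almost_contact_complex_riemannian phi xi eta g -> levi_civita g D ->
  sasaki_like phi xi eta g D -> integrable_distribution n.*2 (ker_form eta).
Proof.
move=> acr lc sas; apply: closed_form_integrable.
- exact: acr_eta_smooth acr.
- by move=> p; exists (xi p); exact: (acr_eta_xi acr).
- by move=> p; exact: (rep_eta_closed acr lc sas).
Qed.

Theorem mainTheorem4 (R : realType) (n : nat) (M : smoothManifold R n.*2.+1)
    (phi : endofield M) (xi : vfield M) (eta : formfield M) (g : bilinfield M)
    (D : connection M) :
  almost_contact_complex_riemannian phi xi eta g ->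
  levi_civita g D ->
  sasaki_like phi xi eta g D ->
  [/\ integrable_distribution n.*2 (ker_form eta),
      (forall (N : smoothManifold R n.*2) (iota : N -> M),
        integral_submanifold (ker_form eta) iota ->
        exists J : endofield N,
          [/\ restricts_endo iota phi J,
              holomorphic_complex_riemannian J (pullback_form iota g)
            & forall Dh : connection N,
                levi_civita (pullback_form iota g) Dh ->
                forall (p : N) (X' Y' Z' U' : vfield N) (X Y Z U : vfield M),
                  vfield_smooth_at p X' -> vfield_smooth_at p Y' ->
                  vfield_smooth_at p Z' -> vfield_smooth_at p U' ->
                  vfield_smooth_at (iota p) X -> vfield_smooth_at (iota p) Y ->
                  vfield_smooth_at (iota p) Z -> vfield_smooth_at (iota p) U ->
                  X (iota p) = X' p *m tangent_map iota p ->
                  Y (iota p) = Y' p *m tangent_map iota p ->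
                  Z (iota p) = Z' p *m tangent_map iota p ->
                  U (iota p) = U' p *m tangent_map iota p ->
                  let G := bilin (g (iota p)) in
                  let phiX := X (iota p) *m phi (iota p) in
                  let phiY := Y (iota p) *m phi (iota p) in
                  curv4 g D X Y Z U (iota p)
                  = curv4 (pullback_form iota g) Dh X' Y' Z' U' p
                    + G phiX (Z (iota p)) * G phiY (U (iota p))
                    - G phiY (Z (iota p)) * G phiX (U (iota p))])
    & (forall (p : M) (x y z : vfield M),
        vfield_smooth_at p x -> vfield_smooth_at p y -> vfield_smooth_at p z ->
        curv4 g D x y xi z p = curv4 g D xi z x y p /\
        curv4 g D xi z x y p
        = covec (eta p) (y p) * bilin (g p) (x p) (z p)
          - covec (eta p) (x p) * bilin (g p) (y p) (z p))].
Proof.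
move=> acr lc sas; split=> [|N iota sub|p x y z sx sy sz].
- exact: (ker_eta_integrable acr lc sas).
- have [J JE] := restr_phi_exists acr sub; exists J; split=> //.
  + split.
    * exact: (restr_phi_smooth acr sub JE).
    * exact: (restr_phi2 acr sub JE).
    * exact: (pullback_metric acr sub JE).
    * exact: (pullback_phi acr sub JE).
    * move=> Dh lch p u Y; exact: (restr_phi_parallel acr lc sas sub JE lch).
  + move=> Dh lch p X' Y' Z' U' X Y Z U sX' sY' sZ' _ sX sY sZ _ XE YE ZE UE.
    exact: (gauss_equation acr lc sas sub lch sX' sY' sZ' sX sY sZ XE YE ZE UE).
- exact: (curv4_xi acr lc sas).
Qed.
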